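(* Let $A$ be the ring of integers in a global field, let $G$ be a finite subgroup of $GL_n(A)$, let $P$ be a maximal ideal of $A$, and set $(\mathcal{O},(\pi)) = (A_P, PA_P)$. Let $\widehat{\mathcal{O}}$ be the completion of $\mathcal{O}$ with respect to $(\pi)$. Suppose $G = \mathbb{Z}/3\mathbb{Z}$. Assume that $\widehat{\mathcal{O}}$ is of mixed characteristic, that a primitive third root of unity $\zeta$ is in $\widehat{\mathcal{O}}$, and that the residue field of $\widehat{\mathcal{O}}$ has characteristic three. Then $\widehat{\mathcal{O}}[G] = \widehat{\mathcal{O}}[X]/(X^3-1)$. If $M$ is an indecomposable rigid maximal Cohen-Macaulay $\widehat{\mathcal{O}}[G]$-module, then $S(M)^G$ is Cohen-Macaulay.
   Context: ''$A$ is the ring of integers in a global field'' means that either $A$ is the ring of integers of a number field, or $A$ is the ring of integers (the integral closure of $\mathbb{F}_q[t]$) of a finite extension of $\mathbb{F}_q(t)$, with $\mathbb{F}_q$ a finite field. $\widehat{\mathcal{O}}[G]$ is the group ring; the displayed equality identifies a generator of $G$ with the class of $X$. A maximal Cohen-Macaulay (MCM) $\widehat{\mathcal{O}}[G]$-module $M$ is a finitely generated module that is maximal Cohen-Macaulay; such an $M$ is free of finite rank as an $\widehat{\mathcal{O}}$-module, so it gives a (not necessarily injective) representation $G\to GL(M)$. $S(M) = S_{\widehat{\mathcal{O}}}(M)$ denotes the symmetric algebra of $M$ as an $\widehat{\mathcal{O}}$-module, with $G$ acting by the $\widehat{\mathcal{O}}$-algebra automorphisms extending the action on $M$, and $S(M)^G$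 is the ring of invariants. For a complete Cohen-Macaulay local ring $T$, an MCM $T$-module $M$ is called rigid if $\operatorname{Ext}^1_T(M,M)=0$; here $T=\widehat{\mathcal{O}}[G]$. *)

(* Defs.v *)
From HB Require Import structures.
From mathcomp Require Import all_boot all_order all_fingroup all_algebra.
From mathcomp Require Import all_solvable all_field mxrepresentation.

Set Implicit Arguments.
Unset Strict Implicit.
Unset Printing Implicit Defensive.

Import GRing.Theory.
Local Open Scope ring_scope.

Definition surjective (T U : Type) (f : T -> U) : Prop :=
  forall y, exists x, f x = y.

Definition divides (R : comNzRingType) (x y : R) : Prop :=
  exists z, y = x * z.

(* Proper ideals of a ring R are the elements of the library type [idealr R]. *)

Definition maximal_ideal (R : comNzRingType) (m : idealr R) : Prop :=
  forall J : idealr R, {subset m <= J} -> {subset J <= m}.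

Definition local_with (R : comNzRingType) (m : idealr R) : Prop :=
  maximal_ideal m /\ forall J : idealr R, maximal_ideal J -> J =i m.

Definition noetherian (R : comNzRingType) : Prop :=
  forall I : idealr R, exists (n : nat) (s : 'I_n -> R),
    (forall i, s i \in I) /\
    forall x, x \in I -> exists c : 'I_n -> R, x = \sum_i c i * s i.

Definition prime_chain (R : comNzRingType) (d : nat) : Prop :=
  exists p : nat -> prime_idealr R, forall i, (i < d)%N ->
    {subset p i <= p i.+1} /\ ~ {subset p i.+1 <= p i}.

Definition krull_dim (R : comNzRingType) (d : nat) : Prop :=
  prime_chain R d /\ forall e, prime_chain R e -> (e <= d)%N.

(* f exhibits B as the localization of R at the complement of P. *)
Definition is_localization (R : comNzRingType) (P : idealr R)
    (B : comNzRingType) (f : {rmorphism R -> B}) : Prop :=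
  [/\ forall s, s \notin P -> exists t, f s * t = 1,
      forall b, exists a s, s \notin P /\ f s * b = f a &
      forall a, f a = 0 -> exists2 s, s \notin P & s * a = 0].

(* The ideal of B generated by f(P). *)
Definition ideal_extension (R B : comNzRingType) (f : {rmorphism R -> B})
    (P : idealr R) (x : B) : Prop :=
  exists (n : nat) (a : 'I_n -> R) (b : 'I_n -> B),
    (forall i, a i \in P) /\ x = \sum_i f (a i) * b i.

(* c exhibits C as the (x)-adic completion of B: c induces isomorphisms       *)
(* B/(x^n) -> C/(x^n) for all n, and C is separated and complete for the      *)
(* (x)-adic topology.                                                         *)
Definition is_completion (B : comNzRingType) (x : B) (C : comNzRingType)
    (c : {rmorphism B -> C}) : Prop :=
  [/\ forall n b, divides (c x ^+ n) (c b) -> divides (x ^+ n) b,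
      forall n y, exists b, divides (c x ^+ n) (y - c b),
      forall y, (forall n, divides (c x ^+ n) y) -> y = 0 &
      forall u : nat -> C,
        (forall n, divides (c x ^+ n) (u n.+1 - u n)) ->
        exists l, forall n, divides (c x ^+ n) (u n - l)].

Definition is_number_ring (A : comNzRingType) : Prop :=
  exists (K : fieldExtType rat) (j : {rmorphism A -> K}),
    injective j /\
    forall x : K, integralOver (fun n : int => n%:~R : K) x <->
      exists a, j a = x.

Definition is_function_ring (A : comNzRingType) : Prop :=
  exists (F : finFieldType) (K : fieldExtType {fraction {poly F}})
         (j : {rmorphism A -> K}),
    injective j /\
    forall x : K, integralOver (fun p : {poly F} => (tofrac p)%:A : K) x <->
      exists a, j a = x.

Definition is_global_integers (A : comNzRingType) : Prop :=
  is_number_ring A \/ is_function_ring A.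

Definition mixed_characteristic (R : comNzRingType) (m : idealr R) : Prop :=
  injective (fun n : nat => n%:R : R) /\ exists p, p \in [pchar {ideal_quot m}].

Section Modules.
Variable R : comNzRingType.
Implicit Types M N : lmodType R.

Definition finitely_generated M : Prop :=
  exists (n : nat) (s : 'I_n -> M),
    forall v, exists c : 'I_n -> R, v = \sum_i c i *: s i.

Definition indecomposable M : Prop :=
  (exists v : M, v <> 0) /\
  forall (N1 N2 : lmodType R) (f : {linear M -> (N1 * N2)%type}),
    bijective f -> (forall v : N1, v = 0) \/ (forall v : N2, v = 0).

(* v lies in (xs) M. *)
Definition in_smul M (xs : seq R) (v : M) : Prop :=
  exists w : 'I_(size xs) -> M, v = \sum_(i < size xs) xs`_i *: w i.

Definition regular_sequence M (xs : seq R) : Prop :=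
  (forall i, (i < size xs)%N -> forall v : M,
     in_smul (take i xs) (xs`_i *: v) -> in_smul (take i xs) v) /\
  exists v : M, ~ in_smul xs v.

Definition depth (m : idealr R) M (d : nat) : Prop :=
  (exists xs : seq R,
     [/\ {subset xs <= m}, regular_sequence M xs & size xs = d]) /\
  forall xs : seq R,
    {subset xs <= m} -> regular_sequence M xs -> (size xs <= d)%N.

Definition maximal_cohen_macaulay M : Prop :=
  finitely_generated M /\
  exists (m : idealr R) (d : nat),
    [/\ local_with m, krull_dim R d & depth m M d].

Definition projective (P : lmodType R) : Prop :=
  forall M N (p : {linear M -> N}) (f : {linear P -> N}),
    surjective p -> exists h : {linear P -> M}, forall v, p (h v) = f v.

(* Ext^1_R(M, N) = 0: for P2 -> P1 -> P0 -> M -> 0 the start of a projective  *)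
(* resolution of M, the complex Hom(P0,N) -> Hom(P1,N) -> Hom(P2,N) is exact. *)
Definition ext1_vanishes M N : Prop :=
  forall (P0 P1 P2 : lmodType R) (e : {linear P0 -> M})
         (d1 : {linear P1 -> P0}) (d2 : {linear P2 -> P1}),
    projective P0 -> projective P1 -> projective P2 ->
    surjective e ->
    (forall v, e v = 0 <-> exists w, d1 w = v) ->
    (forall v, d1 v = 0 <-> exists w, d2 w = v) ->
    forall f : {linear P1 -> N}, (forall v, f (d2 v) = 0) ->
      exists h : {linear P0 -> N}, forall v, f v = h (d1 v).

Definition rigid M : Prop := ext1_vanishes M M.

Definition is_symmetric_algebra M (S : comAlgType R)
    (iota : {linear M -> S}) : Prop :=
  forall (B : comAlgType R) (f : {linear M -> B}),
    exists phi : {lrmorphism S -> B},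
      (forall v, phi (iota v) = f v) /\
      forall psi : {lrmorphism S -> B},
        (forall v, psi (iota v) = f v) -> psi =1 phi.

End Modules.

Definition cohen_macaulay_local (R : comNzRingType) : Prop :=
  noetherian R /\
  exists (m : idealr R) (d : nat),
    [/\ local_with m, krull_dim R d & depth m (R^o : lmodType R) d].

Definition cohen_macaulay (R : comNzRingType) : Prop :=
  noetherian R /\
  forall m : idealr R, maximal_ideal m ->
  forall (B : comNzRingType) (f : {rmorphism R -> B}),
    is_localization m f -> cohen_macaulay_local B.

(* The group ring R[G] of G = [set: gT]. The type carries the proof that G is *)
(* abelian so that it can be equipped with a commutative algebra structure.   *)
Definition group_algebra (R : comNzRingType) (gT : finGroupType)
  (abG : abelian [set: gT]) : Type := {ffun gT -> R^o}.

Section GroupRing.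
Variables (R : comNzRingType) (gT : finGroupType) (abG : abelian [set: gT]).
Local Notation RG := (group_algebra R abG).

HB.instance Definition _ := GRing.Lmodule.on RG.

Implicit Types a b c : RG.

Definition gr_basis (g : gT) : RG := [ffun h => (h == g)%:R].

Definition gr_mul a b : RG := [ffun g => \sum_h a h * b (h^-1 * g)%g].

Lemma gr_mulA : associative gr_mul.
Proof.
move=> a b c; apply/ffunP=> g; rewrite !ffunE.
under [RHS]eq_bigr => h _ do rewrite ffunE mulr_suml.
rewrite [RHS]exchange_big /=; apply: eq_bigr => k _.
rewrite ffunE mulr_sumr [RHS](reindex_inj (mulgI k)) /=.
by apply: eq_bigr => h _; rewrite mulrA mulKg invMg mulgA.
Qed.

Lemma gr_mulC : commutative gr_mul.
Proof.
move=> a b; apply/ffunP=> g; rewrite !ffunE.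
have inj : injective (fun h : gT => h^-1 * g)%g.
  by move=> h k /mulIg /invg_inj.
rewrite (reindex_inj inj) /=; apply: eq_bigr => h _.
rewrite mulrC; congr (b _ * a _).
by rewrite invMg invgK -mulgA ((centsP abG) h (in_setT _) g (in_setT _)) mulKg.
Qed.

Lemma gr_mul1 : left_id (gr_basis 1%g) gr_mul.
Proof.
move=> a; apply/ffunP=> g; rewrite ffunE (bigD1 1%g) //= big1 => [|h /negPf h1].
  by rewrite ffunE eqxx mul1r invg1 mul1g addr0.
by rewrite ffunE h1 mul0r.
Qed.

Lemma gr_mulDl : left_distributive gr_mul +%R.
Proof.
move=> a b c; apply/ffunP=> g; rewrite !ffunE -big_split /=.
by apply: eq_bigr => h _; rewrite ffunE mulrDl.
Qed.

Lemma gr_1neq0 : gr_basis 1%g != 0.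
Proof.
by apply/eqP => /ffunP/(_ 1%g)/eqP; rewrite !ffunE eqxx (negPf (oner_neq0 R)).
Qed.

HB.instance Definition _ := GRing.Zmodule_isComNzRing.Build RG
  gr_mulA gr_mulC gr_mul1 gr_mulDl gr_1neq0.

Lemma gr_scalerAl (r : R) a b : r *: (a * b) = (r *: a) * b.
Proof.
apply/ffunP=> g; rewrite !ffunE scaler_sumr.
by apply: eq_bigr => h _; rewrite ffunE -scalerAl.
Qed.

HB.instance Definition _ := GRing.Lmodule_isLalgebra.Build R RG gr_scalerAl.
HB.instance Definition _ := GRing.Lalgebra_isComAlgebra.Build R RG.

End GroupRing.

Lemma abelian_of_isog_Z3 (gT : finGroupType) :
  [set: gT] \isog [set: 'Z_3] -> abelian [set: gT].
Proof. by move=> iG; rewrite (isog_abelian iG) FinRing.zmod_abelian. Qed.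

(* A module over an R-algebra T, regarded as an R-module. *)
Definition restrict (R : comNzRingType) (T : comAlgType R) (M : lmodType T) :
  Type := M.

Section Restrict.
Variables (R : comNzRingType) (T : comAlgType R) (M : lmodType T).

HB.instance Definition _ := GRing.Zmodule.on (restrict M).

Definition restrict_scale (r : R) (v : restrict M) : restrict M :=
  (r%:A : T) *: (v : M).

Lemma restrict_scalerA r s v :
  restrict_scale r (restrict_scale s v) = restrict_scale (r * s) v.
Proof. by rewrite /restrict_scale scalerA mulr_algl scalerA. Qed.

Lemma restrict_scale1r : left_id 1 restrict_scale.
Proof. by move=> v; rewrite /restrict_scale !scale1r. Qed.

Lemma restrict_scalerDr : right_distributive restrict_scale +%R.
Proof. by move=> r v w; apply: scalerDr. Qed.

Lemma restrict_scalerDl v :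
  {morph restrict_scale^~ v : r s / r + s}.
Proof. by move=> r s; rewrite /restrict_scale !scalerDl. Qed.

HB.instance Definition _ := GRing.Zmodule_isLmodule.Build R (restrict M)
  restrict_scalerA restrict_scale1r restrict_scalerDr restrict_scalerDl.

End Restrict.

Section Invariants.
Variables (R : comNzRingType) (S : comAlgType R) (I : finType).
Variable sigma : I -> {lrmorphism S -> S}.

Definition invariant : {pred S} := fun x => [forall g, sigma g x == x].

Lemma invariant_subring : subring_closed invariant.
Proof.
split=> [|x y /forallP/= fx /forallP/= fy|x y /forallP/= fx /forallP/= fy];
  apply/forallP => g /=.
- by rewrite rmorph1.
- by rewrite rmorphB /= (eqP (fx g)) (eqP (fy g)).
- by rewrite rmorphM /= (eqP (fx g)) (eqP (fy g)).
Qed.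

HB.instance Definition _ :=
  GRing.isSubringClosed.Build S invariant invariant_subring.

Record invariant_ring : Type :=
  InvariantRing { invariant_val :> S; _ : invariant_val \in invariant }.

HB.instance Definition _ := [isSub for invariant_val].
HB.instance Definition _ := [Choice of invariant_ring by <:].
HB.instance Definition _ :=
  [SubChoice_isSubComNzRing of invariant_ring by <:].

End Invariants.

(* Main.v *)
(* The completion [Ohat] is a discrete valuation ring with uniformizer [p], a *)
(* maximal Cohen-Macaulay module [M] is free over it, and a generator of [G]  *)
(* acts on [M] by some [X] with [X^3 = 1]. Rigidity says that every linear    *)
(* [A] with [X^2 A + X A X + A X^2 = 0] has the form [X H - H X]. Testing it  *)
(* on maps of rank one produces a vector whose orbit spans a direct summand,  *)
(* because [p] divides [3] and the differences of the cube roots of unity.    *)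
(* So an indecomposable rigid [M] has rank at most [3], and [X] is a scalar,  *)
(* a reflection, or the cyclic permutation of three vectors that are a basis  *)
(* or have sum zero.                                                          *)
(*                                                                            *)
(* In each case the invariants of the polynomial ring [S(M)] are free of      *)
(* finite rank over a polynomial subring. Such a ring is Cohen-Macaulay: for  *)
(* a maximal ideal [m], a regular sequence is built in [m] one variable at a  *)
(* time, and a longer chain of primes below [m] would, together with the      *)
(* variables left over, be algebraically independent, which is excluded by    *)
(* counting monomials.                                                        *)
Require Import Defs.
From HB Require Import structures.
From mathcomp Require Import all_boot all_order all_fingroup all_algebra.
From mathcomp Require Import all_solvable all_field mxrepresentation.
From mathcomp Require Import ring boolp.
From mathcomp Require classical_sets.

Set Implicit Arguments.
Unset Strict Implicit.
Unset Printing Implicit Defensive.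

Import GRing.Theory.
Local Open Scope ring_scope.

(** * Ideals and regular sequences *)

Section Ideals.
Variable R : comNzRingType.
Implicit Types (I : R -> Prop) (xs : seq R).

(** Let [p] be the image of [pi] in the completion. Geometric series invert every element outside
    [(p)], residue characteristic three makes [p] divide 3, and mixed characteristic then keeps [p]
    from being nilpotent; so the completion is a discrete valuation ring with uniformizer [p]. A
    maximal Cohen-Macaulay module [M] over the group ring has an element [y] of the maximal ideal
    regular on it, and [y^3] is a multiple of [p]; hence [M] is torsion free, and free of finite
    rank.

    Let [X] be the action of a generator. A periodic free resolution of [M] turns rigidity into the
    statement that every [A] with [X^2 A + X A X + A X^2 = 0] is a commutator [X H - H X]
    ([restrict_rigid]). For a rank one [A], evaluating this commutator at one well chosen vector
    shows that, when two cube roots of unity occur as eigenvalues, [X - a2] does not map the kernel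
    of [(X - a1) (X - a2)] into [p V], and that, when all three occur, [(X - a2) (X - a3)] does not
    map [V] into [p V] ([classify_step], [classify3]). As the roots agree modulo [p], the resulting
    vector can be corrected so that its orbit is the image of an equivariant projector ([cyclic2],
    [cyclic3]), and indecomposability yields the short list of [classification].

    The symmetric algebra is a polynomial ring, and its invariants are computed explicitly; 3 is not
    invertible, so averaging is replaced by solving linear equations in a basis. For a reflection
    they are generated over the coefficients by a norm ([free_invariants_reflection]); for a cyclic
    permutation of [x], [y], [z] they are free over the symmetric polynomials on 1 and
    [x^2 y + y^2 z + z^2 x], up to sign ([free_invariants_cyclic]).

    Finally [cm_criterion] shows that such a ring [R], free of finite rank over a polynomial ring
    and embedded in one, is Cohen-Macaulay. For a maximal ideal [m], [prime_structure] produces in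
    [m] a sequence that is regular after localization, with [k] variables left over. A chain of
    primes below [m] longer than this sequence would give elements that, by counting monomials, are
    related over the [k] variables; following the lowest coefficients of the relation along the
    chain ([pchain_coef]) puts into [m] a constant that it does not contain. *)

Definition is_ideal I : Prop :=
  [/\ I 0, forall x y, I x -> I y -> I (x + y) & forall a x, I x -> I (a * x)].

(** Taken as an intersection, so that membership is used by exhibiting one ideal that contains [xs];
    [genP] recovers coefficients. *)
Definition gen xs (x : R) : Prop :=
  forall I, is_ideal I -> (forall y, y \in xs -> I y) -> I x.

Lemma is_ideal_sum I : is_ideal I ->
  forall (T : Type) (r : seq T) (P : pred T) (F : T -> R),
    (forall i, P i -> I (F i)) -> I (\sum_(i <- r | P i) F i).
Proof. by case=> I0 ID _ T r P F IF; apply: big_ind. Qed.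

Lemma is_idealMl I a x : is_ideal I -> I x -> I (x * a).
Proof. by case=> _ _ IM Ix; rewrite mulrC; apply: IM. Qed.

Lemma is_idealB I x y : is_ideal I -> I x -> I y -> I (x - y).
Proof. by case=> _ ID IM Ix Iy; apply: ID => //; rewrite -mulN1r; apply: IM. Qed.

Lemma gen_ideal xs : is_ideal (gen xs).
Proof.
split=> [I [] // | x y gx gy I iI sI | a x gx I iI sI].
  by case: (iI) => _ ID _; apply: ID; [apply: gx | apply: gy].
by case: (iI) => _ _ IM; apply: IM; apply: gx.
Qed.

Lemma gen_mem xs x : x \in xs -> gen xs x.
Proof. by move=> xxs I _; exact. Qed.

Lemma gen_sub xs ys : (forall x, x \in xs -> gen ys x) ->
  forall x, gen xs x -> gen ys x.
Proof. by move=> sub x gx; apply: gx => //; apply: gen_ideal. Qed.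

Lemma idealr_ideal (J : idealr R) : is_ideal (fun x => x \in J).
Proof.
split=> [|x y|a x]; [exact: idealr0 | exact: rpredD | exact: idealMr].
Qed.

Lemma gen_idealr (J : idealr R) xs x : {subset xs <= J} -> gen xs x -> x \in J.
Proof. by move=> sJ gx; exact: (gx _ (idealr_ideal J)). Qed.

Lemma idealr_of I : is_ideal I -> ~ I 1 ->
  exists J : idealr R, forall x, (x \in J) <-> I x.
Proof.
move=> [I0 ID IM] I1; pose S : R -> bool := fun x => `[< I x >].
have cS : idealr_closed S.
  split; rewrite ?unfold_in /S; first exact/asboolP.
    by apply/asboolP.
  move=> a u v; rewrite !unfold_in /S => /asboolP Iu /asboolP Iv.
  by apply/asboolP; apply: ID => //; apply: IM.
pose m := isIdealr.Build R S cS.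
pose J : idealr R := HB.pack S m.
by exists J => x; split => [/asboolP|/asboolP].
Qed.

Lemma prime_idealr_of I : is_ideal I -> ~ I 1 ->
  (forall x y, I (x * y) -> I x \/ I y) ->
  exists J : prime_idealr R, forall x, (x \in J) <-> I x.
Proof.
move=> [I0 ID IM] I1 IP; pose S : R -> bool := fun x => `[< I x >].
have cS : idealr_closed S.
  split; rewrite ?unfold_in /S; first exact/asboolP.
    by apply/asboolP.
  move=> a u v; rewrite !unfold_in /S => /asboolP Iu /asboolP Iv.
  by apply/asboolP; apply: ID => //; apply: IM.
have pS : prime_idealr_closed S.
  move=> u v; rewrite !unfold_in /S => /asboolP /IP [] ?; apply/orP;
    by [left; apply/asboolP | right; apply/asboolP].
pose m := isIdealr.Build R S cS.
pose m' := isPrimeIdealrClosed.Build R S pS.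
pose J : prime_idealr R := HB.pack S m m'.
by exists J => x; split => [/asboolP|/asboolP].
Qed.

(** An ideal maximal among those containing [I] and missing [W] is prime: if neither factor of a
    product lay in it, adjoining either one would reach an element of [W], and the product of these
    two elements would lie both in the ideal and in [W]. *)
Lemma exists_prime_avoiding I (W : R -> Prop) :
  is_ideal I -> W 1 -> (forall x y, W x -> W y -> W (x * y)) ->
  (forall x, I x -> ~ W x) ->
  exists q : prime_idealr R,
    (forall x, I x -> x \in q) /\ (forall x, W x -> x \notin q).
Proof.
move=> iI W1 WM IW.
pose good (X : R -> Prop) :=
  [/\ is_ideal X, forall x, I x -> X x & forall x, X x -> ~ W x].
pose P (X : classical_sets.set R) := (forall x, ~ X x) \/ good X.
have [F PF tF|A [PA maxA]] := @classical_sets.Zorn_bigcup R P.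
  have [[X FX gX]|noX] := pselect (exists2 X, F X & good X); last first.
    left=> x [X FX Xx]; case: (PF X FX) => [nX|gX]; first exact: (nX x).
    by apply: noX; exists X.
  right.
  have cmp Y y : F Y -> Y y -> exists Z, [/\ F Z, good Z, Z y & Y = Z].
    move=> FY Yy; exists Y; split=> //.
    by case: (PF Y FY) => // nY; case: (nY y).
  split=> [|x Ix|x [Y FY Yx] Wx].
  - split=> [|x y [Y FY Yx] [Z FZ Zy]|a x [Y FY Yx]].
    + by exists X => //; case: gX => [[]].
    + have [? [_ [[_ YD _] _ _] _ E]] := cmp _ _ FY Yx; subst.
      have [? [_ [[_ ZD _] _ _] _ E]] := cmp _ _ FZ Zy; subst.
      case: (tF _ _ FY FZ) => sub.
        by eexists; [exact: FZ | apply: ZD => //; apply: sub].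
      by eexists; [exact: FY | apply: YD => //; apply: sub].
    + have [? [_ [[_ _ YM] _ _] _ E]] := cmp _ _ FY Yx; subst.
      by eexists; [exact: FY | apply: YM].
  - by exists X => //; case: gX => _ + _; apply.
  - by have [? [_ [_ _ YW] _ E]] := cmp _ _ FY Yx; subst; apply: (YW x).
have gI : good I by split.
have gA : good A.
  case: PA => // nA; case: (maxA I); last by right.
  split; first by move=> x /nA.
  by move=> sub; case: iI => I0 _ _; exact: (nA 0 (sub 0 I0)).
case: gA => iA sA AW; case: (iA) => A0 AD AM.
pose adj x := fun y => exists a z, A z /\ y = a * x + z.
have adjP x : ~ A x -> exists2 y, adj x y & W y.
  move=> nAx; apply: contrapT => nW.
  apply: (maxA (adj x)); last first.
    right; split=> [|y Iy|y ay Wy].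
    - split=> [|y z [a [u [Au ->]]] [b [v [Av ->]]]|b y [a [u [Au ->]]]].
      + by exists 0, 0; rewrite mul0r addr0.
      + by exists (a + b), (u + v); split; [exact: AD | ring].
      + by exists (b * a), (b * u); split; [exact: AM | ring].
    - by exists 0, y; split; [exact: sA | rewrite mul0r add0r].
    - by apply: nW; exists y.
  split; first by move=> y Ay; exists 0, y; rewrite mul0r add0r.
  by move=> sub; apply: nAx; apply: sub; exists 1, 0; rewrite mul1r addr0.
have [|x y Axy|q qP] := @prime_idealr_of A iA.
- by move=> A1; exact: (AW 1).
- apply: contrapT => /not_orP [/adjP [u [a [z [Az Eu]] Wu]]].
  move=> /adjP [v [b [t [At Ev]] Wv]].
  apply: (AW (u * v)); last exact: WM.
  have -> : u * v = a * b * (x * y) + (a * x * t + v * z) by rewrite Eu Ev; ring.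
  by apply: (AD); [exact: AM | apply: (AD); exact: AM].
exists q; split=> x; first by move=> Ix; apply/qP; exact: sA.
by move=> Wx; apply/negP => /qP Ax; apply: (AW x).
Qed.

Definition regseq xs : Prop :=
  forall i, (i < size xs)%N -> forall v, gen (take i xs) (xs`_i * v) ->
    gen (take i xs) v.

(* Descending from a prime containing a regular sequence, each member can be  *)
(* dropped by passing to a prime that avoids it.                              *)
Lemma regseq_chain xs (p0 : prime_idealr R) :
  {subset xs <= p0} -> regseq xs ->
  exists p : nat -> prime_idealr R, p (size xs) = p0 /\
    forall i, (i < size xs)%N ->
      {subset p i <= p i.+1} /\ ~ {subset p i.+1 <= p i}.
Proof.
elim/last_ind: xs p0 => [|xs x IH] p0 sp reg; first by exists (fun=> p0).
have sp' : {subset xs <= p0}.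
  by move=> y yxs; apply: sp; rewrite mem_rcons inE yxs orbT.
have xp : x \in p0 by apply: sp; rewrite mem_rcons inE eqxx.
(* A prime containing [xs] and missing [W] lies inside [p0] and omits [x]. The set [W] misses
   [gen xs] since [x] is regular modulo [xs] and [gen xs] lies in [p0]. *)
pose W y := exists s n, s \notin p0 /\ y = s * x ^+ n.
have regx v : gen xs (x * v) -> gen xs v.
  have := reg (size xs); rewrite size_rcons ltnSn => /(_ isT v).
  by rewrite -cats1 take_size_cat // nth_cat ltnn subnn.
have [||y z [s [n [sp1 ->]]] [t [k [tp ->]]]|y gy [s [n [sp1 Ey]]]|q [Iq Wq]]
    := @exists_prime_avoiding (gen xs) W.
- exact: gen_ideal.
- by exists 1, 0%N; rewrite idealr1 mulr1.
- exists (s * t), (n + k)%N; rewrite prime_idealrM negb_or sp1 tp exprD.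
  by split=> //; ring.
- have gs : gen xs s.
    elim: n y Ey gy => [|n IHn] y ->; first by rewrite mulr1.
    rewrite exprS mulrCA => /regx; exact: IHn.
  by case/negP: sp1; apply: gen_idealr gs.
have [|i ilt v|p [pe pP]] := IH q.
- by move=> y yxs; apply: Iq; apply: gen_mem.
- have := reg i; rewrite size_rcons (leqW ilt) => /(_ isT v).
  by rewrite -cats1 takel_cat 1?ltnW // nth_cat ilt.
exists (fun i => if (i <= size xs)%N then p i else p0).
rewrite size_rcons ltnn; split=> // i; rewrite ltnS leq_eqVlt => /orP [/eqP->|ilt].
  rewrite /= eqxx ltnn pe; split=> [y|sub].
    apply: contraTT => yp; apply: Wq; exists y, 0%N.
    by rewrite expr0 mulr1.
  have /negP[] : x \notin q; last exact: sub.
  by apply: Wq; exists 1, 1%N; rewrite idealr1 expr1 mul1r.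
by rewrite /= ilt orbT; exact: pP.
Qed.

End Ideals.

Lemma genP (R : comNzRingType) (xs : seq R) (x : R) :
  gen xs x <-> exists c : 'I_(size xs) -> R, x = \sum_i c i * xs`_i.
Proof.
split=> [gx|[c ->]]; last first.
  apply: is_ideal_sum => [|i _]; first exact: gen_ideal.
  by have [_ _] := gen_ideal xs; apply; apply: gen_mem; apply: mem_nth.
apply: (gx (fun x => exists c : 'I_(size xs) -> R, x = \sum_i c i * xs`_i)).
  split=> [|y z [c ->] [d ->]|a y [c ->]].
  - by exists (fun=> 0); rewrite big1 // => i _; rewrite mul0r.
  - exists (fun i => c i + d i); rewrite -big_split /=.
    by apply: eq_bigr => i _; rewrite mulrDl.
  - exists (fun i => a * c i); rewrite mulr_sumr.
    by apply: eq_bigr => i _; rewrite mulrA.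
move=> y yxs; pose i0 : 'I_(size xs) := Ordinal (etrans (index_mem y xs) yxs).
exists (fun i => (i == i0)%:R); rewrite (bigD1 i0) //= eqxx mul1r nth_index //.
by rewrite big1 ?addr0 // => i /negPf ->; rewrite mul0r.
Qed.

Lemma in_smul_gen (R : comNzRingType) (xs : seq R) (x : R) :
  in_smul xs (x : R^o) <-> gen xs x.
Proof.
split=> [[w ->]|/genP [c ->]].
  by apply/genP; exists w; apply: eq_bigr => i _; rewrite mulrC.
by exists c; apply: eq_bigr => i _; rewrite mulrC.
Qed.

(** * Noetherian and Cohen-Macaulay rings *)

Section Noetherian.

Definition noeth (R : comNzRingType) : Prop :=
  forall I : R -> Prop, is_ideal I ->
    exists xs : seq R, (forall x, x \in xs -> I x) /\ forall x, I x -> gen xs x.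

Lemma noeth_noetherian (R : comNzRingType) : noeth R -> noetherian R.
Proof.
move=> nR I; have [xs [xsI Igen]] := nR _ (idealr_ideal I).
exists (size xs), (fun i => xs`_i); split=> [i|x /Igen /genP //].
by apply: xsI; apply: mem_nth.
Qed.

Lemma noeth_image (R S : comNzRingType) (f : {rmorphism R -> S}) :
  (forall y, exists x, f x = y) -> noeth R -> noeth S.
Proof.
move=> fsurj nR I [I0 ID IM].
have [|xs [xsI Igen]] := nR (fun x => I (f x)).
  split=> [|x y|a x]; rewrite ?rmorph0 ?rmorphD ?rmorphM //; first exact: ID.
  exact: IM.
exists (map f xs); split=> [_ /mapP [x /xsI Ix ->] //|y Iy].
have [x fx] := fsurj y; rewrite -fx in Iy *.
apply: (Igen _ Iy (fun x => gen (map f xs) (f x))).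
  have [g0 gD gM] := gen_ideal (map f xs).
  split=> [|u v|a u]; rewrite ?rmorph0 ?rmorphD ?rmorphM //; first exact: gD.
  exact: gM.
by move=> u uxs; apply: gen_mem; apply: map_f.
Qed.

Lemma noeth_localization (R : comNzRingType) (m : idealr R) (B : comNzRingType)
  (f : {rmorphism R -> B}) : is_localization m f -> noeth R -> noeth B.
Proof.
move=> [funit ffrac _] nR I [I0 ID IM].
have [|xs [xsI Igen]] := nR (fun x => I (f x)).
  split=> [|x y|a x]; rewrite ?rmorph0 ?rmorphD ?rmorphM //; first exact: ID.
  exact: IM.
exists (map f xs); split=> [_ /mapP [x /xsI Ix ->] //|y Iy].
have [a [s [sm E]]] := ffrac y; have [t st] := funit s sm.
have [g0 gD gM] := gen_ideal (map f xs).
have -> : y = t * f a by rewrite -E mulrA (mulrC t) st mul1r.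
apply: (gM); have Ia : I (f a) by rewrite -E; apply: (IM).
apply: (Igen _ Ia (fun x => gen (map f xs) (f x))).
  split=> [|u v|c u]; rewrite ?rmorph0 ?rmorphD ?rmorphM //; first exact: gD.
  exact: gM.
by move=> u uxs; apply: gen_mem; apply: map_f.
Qed.

Lemma gen_subset (R : comNzRingType) (xs ys : seq R) :
  {subset xs <= ys} -> forall x, gen xs x -> gen ys x.
Proof. by move=> sub; apply: gen_sub => x /sub; exact: gen_mem. Qed.

(** Hilbert's basis theorem. The ideals [L d] of coefficients in degree [d] increase and stop at
    some [N]; lifts of generators of [L 0], ..., [L N] generate [I], by lowering the degree of an
    element one step at a time. *)
Lemma noeth_poly (R : comNzRingType) : noeth R -> noeth {poly R}.
Proof.
move=> nR I iI; case: (iI) => [I0 ID IM].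
pose L d c := exists p : {poly R}, [/\ I p, (size p <= d.+1)%N & p`_d = c].
have iL d : is_ideal (L d).
  split=> [|x y [p [Ip sp <-]] [q [Iq sq <-]]|a x [p [Ip sp <-]]].
  - by exists 0; rewrite size_poly0 coef0.
  - exists (p + q); rewrite coefD; split=> //; first exact: ID.
    by rewrite (leq_trans (size_polyD _ _)) // geq_max sp.
  - exists (a%:P * p); rewrite coefCM; split=> //; first exact: IM.
    by rewrite mul_polyC (leq_trans (size_scale_leq _ _)).
have LS d k c : L d c -> L (d + k)%N c.
  move=> [p [Ip sp <-]]; exists (p * 'X^k); split; first exact: is_idealMl.
    rewrite (leq_trans (size_polyMleq _ _)) // size_polyXn addnS /=.
    by rewrite -addSn leq_add2r.
  by rewrite coefMXn addnK ltnNge leq_addl.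
have LE d e c : (d <= e)%N -> L d c -> L e c.
  by move=> /subnKC <-; apply: LS.
have fgL d : exists G : seq {poly R}, (forall g, g \in G -> I g) /\
    forall c, L d c -> exists q, [/\ gen G q, (size q <= d.+1)%N & q`_d = c].
  have [xs [xsL Lgen]] := nR _ (iL d).
  have /choice [h hP] c : exists p, L d c ->
      [/\ I p, (size p <= d.+1)%N & p`_d = c].
    by have [[p ?]|nL] := pselect (L d c); [exists p | exists 0].
  exists (map h xs); split=> [_ /mapP [c /xsL /hP [? _ _] ->] //|c /Lgen gc].
  have [g0 gD gM] := gen_ideal (map h xs).
  apply: (gc (fun c => exists q,
    [/\ gen (map h xs) q, (size q <= d.+1)%N & q`_d = c])).
    split=> [|x y [p [Ip sp <-]] [q [Iq sq <-]]|a x [p [Ip sp <-]]].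
    - by exists 0; rewrite size_poly0 coef0.
    - exists (p + q); rewrite coefD; split=> //; first exact: gD.
      by rewrite (leq_trans (size_polyD _ _)) // geq_max sp.
    - exists (a%:P * p); rewrite coefCM; split=> //; first exact: gM.
      by rewrite mul_polyC (leq_trans (size_scale_leq _ _)).
  move=> y yxs; have [_ ? ?] := hP _ (xsL _ yxs).
  by exists (h y); split=> //; apply: gen_mem; apply: map_f.
have [N LN] : exists N, forall d c, L d c -> L N c.
  have [|xs [xsL Lgen]] := nR (fun c => exists d, L d c).
    split=> [|x y [d Lx] [e Ly]|a x [d Lx]].
    - by exists 0%N; case: (iL 0%N).
    - exists (d + e)%N; case: (iL (d + e)%N) => _ + _; apply.
        by apply: LE Lx; rewrite leq_addr.
      by apply: LE Ly; rewrite leq_addl.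
    - by exists d; case: (iL d) => _ _; apply.
  have [N NP] : exists N, forall x, x \in xs -> L N x.
    elim: xs xsL {Lgen} => [|x xs IH] xsL; first by exists 0%N.
    have [|N NP] := IH; first by move=> y yxs; apply: xsL; rewrite inE yxs orbT.
    have [d Ld] := xsL x (mem_head _ _).
    exists (N + d)%N => y; rewrite inE => /orP [/eqP ->|/NP].
      by apply: LE Ld; rewrite leq_addl.
    by apply: LE; rewrite leq_addr.
  exists N => d c Lc; have /Lgen gc : exists d, L d c by exists d.
  by apply: gc.
have [G GP] := choice fgL.
exists (flatten [seq G d | d <- iota 0 N.+1]); split=> [g /flatten_mapP [d _]|p].
  by case: (GP d) => + _; apply.
set GG := flatten _; have [g0 gD gM] := gen_ideal GG.
have gG d q : (d <= N)%N -> gen (G d) q -> gen GG q.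
  move=> dN; apply: gen_subset => g gGd; apply/flatten_mapP.
  by exists d; rewrite ?mem_iota.
move: {2}(size p) (leqnn (size p)) => n; elim: n p => [|d IH] p.
  by rewrite leqn0 size_poly_eq0 => /eqP -> _.
move=> sp Ip.
have [q [gq sq Eq]] : exists q, [/\ gen GG q, (size q <= d.+1)%N & q`_d = p`_d].
  have Ld : L d p`_d by exists p.
  have [dN|Nd] := leqP d N.
    have [_ /(_ _ Ld) [q [gq sq Eq]]] := GP d.
    by exists q; split=> //; apply: gG gq.
  have [_ /(_ _ (LN _ _ Ld)) [q [gq sq Eq]]] := GP N.
  exists (q * 'X^(d - N)); split.
  - by apply: (@is_idealMl _ (gen GG)); [exact: gen_ideal | apply: gG gq].
  - rewrite (leq_trans (size_polyMleq _ _)) // size_polyXn addnS /=.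
    by rewrite -{2}(subnKC (ltnW Nd)) -addSn leq_add2r.
  - by rewrite coefMXn ltnNge leq_subr /= subKn ?(ltnW Nd).
have Iq : I q.
  apply: gq => // g /flatten_mapP [e _]; by case: (GP e) => + _; apply.
rewrite -(subrK q p); apply: (gD) => //; apply: IH; last exact: is_idealB.
apply/leq_sizeP => j; rewrite leq_eqVlt => /orP [/eqP <-|dj].
  by rewrite coefB Eq subrr.
by rewrite coefB !nth_default ?subr0 // (leq_trans _ dj).
Qed.

End Noetherian.

(** * Local Cohen-Macaulay rings *)

Section MaximalIdeals.
Variable R : comNzRingType.

Lemma maximal_ideal_inv (m : idealr R) (x : R) : maximal_ideal m ->
  x \notin m -> exists a, 1 - a * x \in m.
Proof.
move=> mm xm; apply: contrapT => no.
have [||J JP] := @idealr_of R (fun y => exists a u, u \in m /\ y = a * x + u).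
- split=> [|y z [a [u [Au ->]]] [b [v [Av ->]]]|b y [a [u [Au ->]]]].
  + by exists 0, 0; rewrite mul0r addr0 idealr0.
  + by exists (a + b), (u + v); split; [exact: rpredD | ring].
  + by exists (b * a), (b * u); split; [exact: idealMr | ring].
- by move=> [a [u [um E]]]; apply: no; exists a; rewrite E addrC addKr.
have /mm sub : {subset m <= J}.
  by move=> y ym; apply/JP; exists 0, y; rewrite mul0r add0r.
by case/negP: xm; apply: sub; apply/JP; exists 1, 0; rewrite mul1r addr0 idealr0.
Qed.

Lemma maximal_ideal_prime (m : idealr R) : maximal_ideal m ->
  exists q : prime_idealr R, q =i m.
Proof.
move=> mm; have [|||q qP] := @prime_idealr_of R (fun x => x \in m).
- exact: idealr_ideal.
- by rewrite idealr1.
- move=> x y xym; have [xm|xm] := boolP (x \in m); first by left.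
  right; have [a am] := maximal_ideal_inv mm xm.
  have -> : y = y * (1 - a * x) + a * (x * y) by ring.
  by rewrite rpredD // idealMr.
by exists q => x; apply/idP/idP => /qP.
Qed.

Lemma local_with_nonunits (m : idealr R) :
  (forall x, x \notin m -> exists y, y * x = 1) -> local_with m.
Proof.
move=> inv.
have sub (J : idealr R) : {subset J <= m}.
  move=> x xJ; apply/negPn/negP => /inv [y yx].
  by have := idealMr y xJ; rewrite yx idealr1.
split=> [J _ x|J JJ x]; first exact: sub.
by apply/idP/idP; [exact: sub | apply: JJ; exact: sub].
Qed.

(** By [regseq_chain] a regular sequence in [m] yields a chain of primes of the same length. So [xs]
    attains the bound on chains and no regular sequence in [m] is longer: depth and dimension both
    equal [size xs]. *)
Lemma cm_localP (m : prime_idealr R) (xs : seq R) : noeth R ->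
  (forall x, x \notin m -> exists y, y * x = 1) ->
  {subset xs <= m} -> regseq xs ->
  (forall e, prime_chain R e -> (e <= size xs)%N) -> cohen_macaulay_local R.
Proof.
move=> nR inv xsm rxs dim; split; first exact: noeth_noetherian.
exists m, (size xs); split; first exact: local_with_nonunits.
  by split=> //; have [p [_ pP]] := regseq_chain xsm rxs; exists p.
split=> [|ys ysm [rys _]].
  exists xs; split=> //; split=> [i ilt v /in_smul_gen|].
    by move=> /(rxs i ilt) /in_smul_gen.
  by exists 1 => /in_smul_gen /(gen_idealr xsm); rewrite idealr1.
apply: dim; have [|p [_ pP]] := @regseq_chain _ ys m ysm; last by exists p.
by move=> i ilt v /in_smul_gen /(rys i ilt) /in_smul_gen.
Qed.

End MaximalIdeals.

Definition is_prime (R : comNzRingType) (I : R -> Prop) : Prop :=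
  [/\ is_ideal I, ~ I 1 & forall x y, I (x * y) -> I x \/ I y].

Lemma prime_idealr_prime (R : comNzRingType) (q : prime_idealr R) :
  is_prime (fun x => x \in q).
Proof.
split; [exact: idealr_ideal | by rewrite idealr1 |].
by move=> x y; rewrite prime_idealrM => /orP.
Qed.

Lemma is_prime_preim (R S : comNzRingType) (f : {rmorphism R -> S}) (I : S -> Prop) :
  is_prime I -> is_prime (fun x => I (f x)).
Proof.
move=> [[I0 ID IM] I1 IP]; split; rewrite ?rmorph1 //.
  split=> [|x y Ix Iy|a x Ix]; rewrite ?rmorph0 ?rmorphD ?rmorphM //.
    exact: ID.
  exact: IM.
by move=> x y; rewrite rmorphM; apply: IP.
Qed.

Lemma is_primeX (R : comNzRingType) (I : R -> Prop) x n : is_prime I ->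
  I (x ^+ n) -> I x.
Proof. by case=> _ I1 IP; elim: n => [//|n IH]; rewrite exprS => /IP []. Qed.

Lemma is_prime_prod (R : comNzRingType) (I : R -> Prop) (T : Type) (s : seq T)
  (F : T -> R) : is_prime I -> (forall i, ~ I (F i)) -> ~ I (\prod_(i <- s) F i).
Proof.
case=> _ I1 IP IF; elim: s => [|i s IH]; rewrite ?big_nil // big_cons.
by case/IP => [/IF|].
Qed.

(* Regularity after localizing at the prime [q]. *)
Definition wreg (R : comNzRingType) (q : R -> Prop) (xs : seq R) : Prop :=
  forall i, (i < size xs)%N -> forall a, gen (take i xs) (xs`_i * a) ->
    exists s, ~ q s /\ gen (take i xs) (s * a).

(** The witnesses [x i] of strict inclusion are part of the data because chains are bounded through
    polynomial relations between them. *)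
Definition pchain (R : comNzRingType) (e : nat) (P : nat -> R -> Prop)
    (x : nat -> R) : Prop :=
  (forall i, (i <= e)%N -> is_prime (P i)) /\
  forall i, (i < e)%N ->
    [/\ forall y, P i y -> P i.+1 y, P i.+1 (x i) & ~ P i (x i)].

(** * Localization at a maximal ideal *)

Section Localization.
Variables (R : comNzRingType) (m : idealr R) (mm : maximal_ideal m).
Variables (B : comNzRingType) (f : {rmorphism R -> B}).
Hypothesis fP : is_localization m f.

Lemma maximal_idealM x y : x \notin m -> y \notin m -> x * y \notin m.
Proof.
have [q qm] := maximal_ideal_prime mm.
by rewrite -!qm prime_idealrM negb_or => -> ->.
Qed.

Lemma localization_local : exists mB : prime_idealr B,
  (forall x, x \notin mB -> exists y, y * x = 1) /\
  forall a, (f a \in mB) = (a \in m).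
Proof.
have [funit ffrac fker] := fP.
pose I x := exists a s, [/\ s \notin m, a \in m & f s * x = f a].
have I1 a : I (f a) -> a \in m.
  move=> [b [s [sm bm]]]; rewrite -rmorphM => /eqP.
  rewrite -subr_eq0 -rmorphB => /eqP /fker [t tm E].
  apply/negPn/negP => am; have := maximal_idealM tm (maximal_idealM sm am).
  suff -> : t * (s * a) = t * b by rewrite idealMr.
  by apply/eqP; rewrite -subr_eq0 -mulrBr E.
have inv x : ~ I x -> exists y, y * x = 1.
  move=> nIx; have [a [s [sm E]]] := ffrac x.
  have am : a \notin m by apply/negP => am; apply: nIx; exists a, s.
  have [t ta] := funit a am; exists (t * f s).
  by rewrite -mulrA E mulrC.
have iI : is_ideal I.
  split=> [|x y [a [s [sm am E]]] [b [t [tm bm F]]]|y x [a [s [sm am E]]]].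
  - by exists 0, 1; rewrite idealr1 idealr0 rmorph0 mulr0.
  - exists (t * a + s * b), (s * t); split; first exact: maximal_idealM.
      by rewrite rpredD ?idealMr.
    by rewrite rmorphD !rmorphM -E -F; ring.
  - have [b [t [tm F]]] := ffrac y; exists (b * a), (t * s); split.
    + exact: maximal_idealM.
    + exact: idealMr.
    + by rewrite !rmorphM -E -F; ring.
have nI1 : ~ I 1 by rewrite -(rmorph1 f) => /I1; rewrite idealr1.
have [|J JP] := @prime_idealr_of B I iI nI1.
  move=> x y Ixy; apply: contrapT => /not_orP [/inv [u ux] /inv [v vy]].
  apply: nI1; have -> : 1 = u * v * (x * y) by rewrite -(mulr1 1) -{1}ux -vy; ring.
  by case: iI => _ _; apply.
exists J; split=> [x|a].
  by move=> xJ; apply: inv => /JP xJ'; rewrite xJ' in xJ.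
apply/idP/idP => [/JP /I1 //|am]; apply/JP.
by exists a, 1; rewrite idealr1 rmorph1 mul1r.
Qed.

Lemma gen_localization ys b : gen (map f ys) (f b) ->
  exists s, s \notin m /\ gen ys (s * b).
Proof.
have [funit ffrac fker] := fP => gb.
have [g0 gD gM] := gen_ideal ys.
have [|_ /mapP [y yys ->]|s [c [sm gc E]]] :=
    gb (fun y => exists s c, [/\ s \notin m, gen ys c & f s * y = f c]).
- split=> [|x y [s [a [sm ga E]]] [t [c [tm gc F]]]|y x [s [a [sm ga E]]]].
  + by exists 1, 0; rewrite idealr1 rmorph0 mulr0.
  + exists (s * t), (t * a + s * c); split; first exact: maximal_idealM.
      by apply: (gD); apply: (gM).
    by rewrite rmorphD !rmorphM -E -F; ring.
  + have [c [t [tm F]]] := ffrac y; exists (t * s), (c * a); split.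
    * exact: maximal_idealM.
    * exact: gM.
    * by rewrite !rmorphM -E -F; ring.
- by exists 1, y; rewrite idealr1 rmorph1 mul1r; split=> //; exact: gen_mem.
move/eqP: E; rewrite -rmorphM -subr_eq0 -rmorphB => /eqP /fker [t tm E].
exists (t * s); split; first exact: maximal_idealM.
suff -> : t * s * b = t * c by apply: (gM).
by apply/eqP; rewrite -subr_eq0 -mulrA -mulrBr E.
Qed.

Lemma wreg_localization xs : wreg (fun x => x \in m) xs -> regseq (map f xs).
Proof.
have [funit ffrac fker] := fP => wxs i; rewrite size_map => ilt v.
rewrite -map_take (nth_map 0) // => gv.
have [a [s [sm E]]] := ffrac v; have [t st] := funit s sm.
have [g0 gD gM] := gen_ideal (map f (take i xs)).
have /gen_localization [u [um]] : gen (map f (take i xs)) (f (xs`_i * a)).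
  by rewrite rmorphM -E mulrCA; apply: (gM).
rewrite mulrCA => /(wxs i ilt) [w [/negP wm gw]].
have [u' uu] := funit u um; have [w' ww] := funit w wm.
have -> : v = t * u' * w' * f (w * (u * a)).
  rewrite !rmorphM -E.
  transitivity ((f s * t) * (f u * u') * (f w * w') * v); last by ring.
  by rewrite st uu ww !mul1r.
apply: (gM); apply: (gw (fun x => gen (map f (take i xs)) (f x))).
  split=> [|x y|c x]; rewrite ?rmorph0 ?rmorphD ?rmorphM //; first exact: gD.
  exact: gM.
by move=> y yxs; apply: gen_mem; apply: map_f.
Qed.

(** The chain is pulled back along [f]; a witness of strict inclusion is first multiplied by its
    denominator, which is a unit of [B]. *)
Lemma prime_chain_localization e : prime_chain B e ->
  exists P x, [/\ @pchain R e P x & forall i y, P i y -> y \in m].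
Proof.
move=> [p pP]; have [funit ffrac fker] := fP.
have /choice [x xP] i : exists x, (i < e)%N -> f x \in p i.+1 /\ f x \notin p i.
  have [ie|] := boolP (i < e)%N; last by exists 0.
  have [_ /existsNP [y]] := pP i ie => /not_implyP [yp /negP yp'].
  have [a [s [sm E]]] := ffrac y; exists a => _; rewrite -E idealMr //.
  rewrite prime_idealrM negb_or yp' andbT; split=> //.
  have [t st] := funit s sm; apply/negP => fs.
  by have := idealMr t fs; rewrite mulrC st idealr1.
exists (fun i y => f y \in p i), x; split; first split=> i ie.
- exact: is_prime_preim (prime_idealr_prime (p i)).
- have [sub _] := pP i ie; have [? /negP ?] := xP i ie.
  by split=> // y /sub.
- move=> i y fy; apply/negPn/negP => /funit [t ft].
  by have := idealMr t fy; rewrite mulrC ft idealr1.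
Qed.

End Localization.

(** Moves the whole question from the localizations to [R], where sequences are regular up to
    factors outside [m] and only chains inside [m] count. *)
Lemma cm_of_maximal (R : comNzRingType) : noeth R ->
  (forall m : idealr R, maximal_ideal m -> exists xs,
     [/\ {subset xs <= m}, wreg (fun x => x \in m) xs
       & forall e P x, @pchain R e P x -> (forall i y, P i y -> y \in m) ->
           (e <= size xs)%N]) ->
  cohen_macaulay R.
Proof.
move=> nR H; split; first exact: noeth_noetherian.
move=> m mm B f fP; have [xs [xsm wxs dim]] := H m mm.
have [mB [inv mBE]] := localization_local mm fP.
apply: (@cm_localP B mB (map f xs)) => //.
- exact: noeth_localization fP nR.
- by move=> _ /mapP [x /xsm xm ->]; rewrite mBE.
- exact: (wreg_localization mm fP wxs).
- move=> e /(prime_chain_localization fP) [P [x [Px Pm]]].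
  by rewrite size_map; exact: (dim e P x Px Pm).
Qed.

(** * Iterated polynomial rings *)

Fixpoint MP (C : comNzRingType) (r : nat) : comNzRingType :=
  if r is r'.+1 then {poly MP C r'} else C.

Fixpoint mpC (C : comNzRingType) (r : nat) : {rmorphism C -> MP C r} :=
  match r with
  | 0 => idfun
  | r'.+1 => (@polyC (MP C r') \o mpC C r' : {rmorphism C -> {poly MP C r'}})
  end.

Section PolyEval.
Variables (A R : comNzRingType).

Definition pev (f : {rmorphism A -> R}) (x : R) : {poly A} -> R :=
  horner_morph (fun a => mulrC x (f a)).

HB.instance Definition _ f x := GRing.RMorphism.on (pev f x).

Lemma pevC f x a : pev f x a%:P = f a.
Proof. exact: horner_morphC. Qed.

Lemma pevX f x : pev f x 'X = x.
Proof. exact: horner_morphX. Qed.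

Lemma pevE f x p : pev f x p = \sum_(i < size p) f p`_i * x ^+ i.
Proof.
rewrite -{1}[p]coefK poly_def rmorph_sum; apply: eq_bigr => i _.
by rewrite -mul_polyC rmorphM rmorphXn /= pevC pevX.
Qed.

End PolyEval.

Fixpoint ev (C R : comNzRingType) (eta : {rmorphism C -> R}) (r : nat)
    (x : nat -> R) : {rmorphism MP C r -> R} :=
  match r with
  | 0 => eta
  | r'.+1 => (pev (ev eta r' (fun i => x i.+1)) (x 0%N) : {rmorphism {poly MP C r'} -> R})
  end.

Lemma ev_mpC (C R : comNzRingType) (eta : {rmorphism C -> R}) r x c :
  ev eta r x (mpC C r c) = eta c.
Proof. by elim: r x => //= r IH x; rewrite pevC IH. Qed.

(** * Polynomial relations along a chain of primes *)

Section Chain.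
Variables (C R : comNzRingType) (eta : {rmorphism C -> R}) (Z : C -> Prop).

Fixpoint allcoef (r : nat) : MP C r -> Prop :=
  match r with
  | 0 => Z
  | r'.+1 => fun f : {poly MP C r'} => forall i, @allcoef r' f`_i
  end.

Lemma allcoef_ev r x (I : R -> Prop) (f : MP C r) : is_ideal I ->
  (forall c, Z c -> I (eta c)) -> allcoef f -> I (ev eta r x f).
Proof.
move=> iI ZI; elim: r x f => [|r IH] x f /=; first exact: ZI.
move=> fZ; rewrite pevE; apply: is_ideal_sum => // i _.
by apply: is_idealMl => //; apply: IH.
Qed.

(* If [x i] enters the chain of primes at stage [i.+1], a relation between    *)
(* the [x i] makes its lowest coefficient, hence some constant outside [Z],   *)
(* fall into the last prime.                                                  *)
Lemma pchain_coef e P (x : nat -> R) (f : MP C e) : pchain e P x ->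
  (forall c, Z c -> P 0%N (eta c)) -> ~ allcoef f -> P 0%N (ev eta e x f) ->
  exists c, ~ Z c /\ P e (eta c).
Proof.
elim: e P x f => [|e IH] P x f [PP Px] ZP nf Pf; first by exists f.
have [sub01 Px0 nPx0] := Px 0%N isT; have [[P00 P0D P0M] _ P0P] := PP 0%N isT.
have iP0 : is_ideal (P 0%N) by [].
have iP1 : is_ideal (P 1%N) by case: (PP 1%N isT).
have [i nfi ltf] : exists2 i, ~ allcoef ((f : {poly MP C e})`_i)
    & forall j, (j < i)%N -> allcoef ((f : {poly MP C e})`_j).
  have ex : exists i, `[< ~ allcoef ((f : {poly MP C e})`_i) >].
    by move/existsNP: nf => [i nfi]; exists i; apply/asboolP.
  exists (ex_minn ex); first by case: ex_minnP => i /asboolP.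
  move=> j; case: ex_minnP => i _ imin ji; apply: contrapT => /asboolP /imin.
  by rewrite leqNgt ji.
(* The coefficients below [i] contribute elements of [P 0], and [x 0] is outside this prime, so the
   quotient [g] by ['X^i] still takes a value in [P 0]. Modulo [P 1], which contains [x 0], only the
   constant coefficient of [g] survives. *)
set g := drop_poly i (f : {poly MP C e}).
set xe := fun k => x k.+1.
have Pg : P 0%N (pev (ev eta e xe) (x 0%N) g).
  have : P 0%N (pev (ev eta e xe) (x 0%N) (g * 'X^i)).
    have -> : g * 'X^i = f - take_poly i (f : {poly MP C e}).
      by apply: (canRL (addrK _)); rewrite addrC poly_take_drop.
    rewrite rmorphB /=; apply: is_idealB => //.
    rewrite pevE; apply: is_ideal_sum => // j _; apply: is_idealMl => //.
    rewrite coef_take_poly; case: ifP => [ji|_]; last by rewrite rmorph0.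
    by apply: allcoef_ev => //; apply: ltf.
  rewrite rmorphM rmorphXn /= pevX => /P0P [//|].
  by move=> /(is_primeX (PP 0%N isT)) /nPx0.
apply: (IH (fun k => P k.+1) xe ((f : {poly MP C e})`_i)) => //.
- by split=> k ke; [apply: PP | apply: Px].
- by move=> c /ZP /sub01.
have -> : (f : {poly MP C e})`_i = g`_0 by rewrite coef_drop_poly.
have Eg : g = (g`_0)%:P + drop_poly 1 g * 'X.
  rewrite -{1}(poly_take_drop 1 g) expr1; congr (_ + _).
  by apply/polyP => j; rewrite coef_take_poly coefC ltnS leqn0; case: eqP => // ->.
have := sub01 _ Pg; rewrite {1}Eg rmorphD rmorphM /= pevX pevC => Pg1.
rewrite -[ev _ _ _ _](addrK (pev (ev eta e xe) (x 0%N) (drop_poly 1 g) * x 0%N)).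
by apply: (is_idealB iP1) => //; case: (iP1) => _ _; apply.
Qed.

End Chain.

Section Separated.

Definition separated (A : comNzRingType) (a : A) : Prop :=
  forall c : A, c <> 0 -> exists N, ~ divides (a ^+ N) c.

Lemma separated_MP (A : comNzRingType) (a : A) r :
  separated a -> separated (mpC A r a).
Proof.
move=> sa; elim: r => [//|r IH] /= f f0.
have [i fi] : exists i, (f : {poly MP A r})`_i <> 0.
  by apply: contrapT => /forallNP f00; apply: f0; apply/polyP => i;
    rewrite coef0; apply: contrapT.
have [N nN] := IH _ fi; exists N => -[g E]; apply: nN; exists (g : {poly MP A r})`_i.
by rewrite E /= -polyC_exp coefCM.
Qed.

Lemma separated_factor (A : comNzRingType) (a : A) (c : A) :
  separated a -> c <> 0 -> exists N c', c = a ^+ N * c' /\ ~ divides a c'.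
Proof.
move=> sa /sa [N]; elim: N => [|N IH] nd.
  by case: nd; exists c; rewrite mul1r.
have [[c' E]|/IH //] := pselect (divides (a ^+ N) c).
exists N, c'; split=> // -[d Ed]; apply: nd.
by exists d; rewrite E Ed exprSr mulrA.
Qed.

Lemma allcoef_divides (A : comNzRingType) (a : A) r (f : MP A r) :
  allcoef (divides a) f -> divides (mpC A r a) f.
Proof.
elim: r f => [//|r IH] /= f fa.
have /choice [g gP] i : exists g, (f : {poly MP A r})`_i = mpC A r a * g.
  exact: IH.
exists (\poly_(i < size (f : {poly MP A r})) g i).
apply/polyP => i; rewrite coefCM coef_poly.
case: ltnP => [_|fi]; first exact: gP.
by rewrite nth_default ?mulr0.
Qed.

Lemma allcoef_eq0 (A : comNzRingType) r (f : MP A r) :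
  allcoef (fun c => c = 0) f -> f = 0.
Proof.
elim: r f => [//|r IH] f fa; apply/polyP => i; rewrite coef0; exact: IH.
Qed.

End Separated.

Lemma MP_assoc (C : comNzRingType) e k :
  exists iota : {rmorphism MP C (e + k) -> MP (MP C k) e}, injective iota /\
    forall c, iota (mpC C (e + k) c) = mpC (MP C k) e (mpC C k c).
Proof.
elim: e => [|e [iota [iinj iC]]]; first by exists idfun; split=> [x y|c].
exists (map_poly iota : {rmorphism {poly MP C (e + k)} -> {poly MP (MP C k) e}}).
split=> [f g /= E|c /=]; last by rewrite map_polyC /= iC.
by apply/polyP => i; apply: iinj; rewrite -!coef_map E.
Qed.

(** * Algebraic dependence *)

(** Elimination without division: the other rows are cross-multiplied with the pivot row, and a
    dependence between the reduced rows determines the coefficient of the pivot row. *)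
Lemma linear_dependence_ord (O : idomainType) m n (A : 'I_n -> 'I_m -> O) :
  (m < n)%N ->
  exists c : 'I_n -> O, (exists i, c i <> 0) /\ forall j, \sum_i c i * A i j = 0.
Proof.
elim: m n A => [|m IH] [//|n] A mn.
  exists (fun=> 1); split=> [|[]//]; exists ord0; apply/eqP; exact: oner_neq0.
have [[i0 /eqP p0]|/forallNP A0] := pselect (exists i, A i ord0 <> 0); last first.
  have [|c [c0 cP]] := IH n.+1 (fun i j => A i (lift ord0 j)); first exact: ltnW.
  exists c; split=> // j; have [k ->|->] := unliftP ord0 j; first exact: cP.
  by rewrite big1 // => i _; rewrite (contrapT (A0 i)) mulr0.
set p := A i0 ord0 in p0.
have [//|c [[k ck] cP]] := IH n (fun i j => p * A (lift i0 i) (lift ord0 j)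
                                 - A (lift i0 i) ord0 * A i0 (lift ord0 j)).
exists (fun i => if unlift i0 i is Some i' then p * c i'
                 else - \sum_i' c i' * A (lift i0 i') ord0); split.
  exists (lift i0 k); rewrite liftK => /eqP; rewrite mulf_eq0 (negPf p0).
  by move/eqP.
move=> j; rewrite (bigD1_ord i0) //= unlift_none.
under [X in _ + X]eq_bigr => i _ do rewrite liftK.
have [j' ->|->] := unliftP ord0 j; rewrite mulNr mulr_suml addrC -sumrB.
  by rewrite -[RHS](cP j'); apply: eq_bigr => i _; ring.
by rewrite big1 // => i _; rewrite -/p; ring.
Qed.

Lemma linear_dependence (O : idomainType) (I J : finType) (A : I -> J -> O) :
  (#|J| < #|I|)%N ->
  exists c : I -> O, (exists i, c i <> 0) /\ forall j, \sum_i c i * A i j = 0.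
Proof.
move=> /(@linear_dependence_ord O _ _ (fun i j => A (enum_val i) (enum_val j))).
move=> [c [[i ci] cP]]; exists (fun i => c (enum_rank i)); split.
  by exists (enum_val i); rewrite enum_valK.
move=> j; rewrite -[RHS](cP (enum_rank j)) (reindex (@enum_val _ (mem I))) /=.
  by apply: eq_bigr => k _; rewrite enum_valK enum_rankK.
by apply: onW_bij; exact: enum_val_bij.
Qed.

Section Degree.
Variable O : comNzRingType.

(** The degree is bounded in each variable separately, so that the admissible monomials form a cube
    and are easily counted. *)
Fixpoint dg (r d : nat) : MP O r -> Prop :=
  match r with
  | 0 => fun=> True
  | r'.+1 => fun f : {poly MP O r'} =>
      (size f <= d.+1)%N /\ forall i, dg d f`_i
  end.

Lemma dg0 r d : @dg r d 0.
Proof. by elim: r => //= r IH; rewrite size_poly0; split=> // i; rewrite coef0. Qed.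

Lemma dgD r d f g : @dg r d f -> dg d g -> dg d (f + g).
Proof.
elim: r f g => //= r IH f g [sf df] [sg dgg]; split=> [|i].
  by rewrite (leq_trans (size_polyD _ _)) // geq_max sf.
by rewrite coefD; apply: IH.
Qed.

Lemma dg_sum r d (I : Type) (s : seq I) (P : pred I) (F : I -> MP O r) :
  (forall i, P i -> dg d (F i)) -> dg d (\sum_(i <- s | P i) F i).
Proof. by move=> dF; apply: big_ind => //; [exact: dg0 | exact: dgD]. Qed.

Lemma dgM r d e f g : @dg r d f -> dg e g -> dg (d + e) (f * g).
Proof.
elim: r f g => //= r IH f g [sf df] [sg dgg]; split=> [|i].
  rewrite (leq_trans (size_polyMleq _ _)) // -subn1 leq_subLR add1n.
  by rewrite (leq_trans (leq_add sf sg)) // addSn addnS.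
by rewrite coefM; apply: dg_sum => j _; apply: IH.
Qed.

Lemma dg_leq r d e f : (d <= e)%N -> @dg r d f -> dg e f.
Proof.
move=> de; elim: r f => //= r IH f [sf df]; split=> [|i]; last exact: IH.
by rewrite (leq_trans sf).
Qed.

Lemma dgC r d c : @dg r d (mpC O r c).
Proof.
elim: r => //= r IH; split=> [|i].
  by rewrite (leq_trans (size_polyC_leq1 _)).
by rewrite coefC; case: eqP => // _; exact: dg0.
Qed.

Lemma dgX r d f n : @dg r d f -> dg (d * n) (f ^+ n).
Proof.
move=> df; elim: n => [|n IH]; last by rewrite exprS mulnS; apply: dgM.
by rewrite expr0 -(rmorph1 (mpC O r)); apply: dgC.
Qed.

Lemma dg_ex r f : exists d, @dg r d f.
Proof.
elim: r f => [|r IH] f; first by exists 0%N.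
have /choice [d dP] i : exists d, dg d (f : {poly MP O r})`_i by exact: IH.
exists (size (f : {poly MP O r}) + \sum_(i < size (f : {poly MP O r})) d i)%N.
split=> [|i]; first by rewrite -addnS leq_addr.
have [fi|fi] := ltnP i (size (f : {poly MP O r})); last first.
  by rewrite nth_default //; exact: dg0.
apply: dg_leq (dP i); rewrite (leq_trans _ (leq_addl _ _)) //.
by rewrite (bigD1 (Ordinal fi)) //= leq_addr.
Qed.

Lemma dg_rmorph k r (phi : {rmorphism MP O k -> MP O r}) :
  (forall c, phi (mpC O k c) = mpC O r c) ->
  exists d, forall N f, dg N f -> dg (d * N) (phi f).
Proof.
elim: k phi => [|k IH] phi phiC.
  by exists 0%N => N f _; rewrite -[f]/(mpC O 0 f) phiC; apply: dgC.
have [d1 d1P] := IH (phi \o (@polyC (MP O k)) : {rmorphism MP O k -> MP O r}) phiC.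
have [d2 d2P] := dg_ex (phi ('X : {poly MP O k})).
exists (d1 + d2)%N => N f [sf df].
rewrite -[f](@coefK (MP O k)) poly_def rmorph_sum; apply: dg_sum => i _.
rewrite -mul_polyC rmorphM rmorphXn mulnDl; apply: dgM; first by apply: d1P; exact: df.
apply: (@dg_leq _ (d2 * i)); last exact: dgX.
by rewrite leq_mul2l -ltnS (leq_trans (ltn_ord i)) ?orbT.
Qed.

Lemma dg_basis k N : exists (J : finType) (m : J -> MP O k),
  [/\ #|J| = (N.+1 ^ k)%N, forall j, dg N (m j),
      forall c : J -> O, \sum_j mpC O k (c j) * m j = 0 -> forall j, c j = 0
    & forall f, dg N f -> exists c : J -> O, f = \sum_j mpC O k (c j) * m j].
Proof.
elim: k => [|k [J [m [cJ dm fr sp]]]].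
  exists unit, (fun=> 1); split=> [| |c|f _]; rewrite ?card_unit //.
    by rewrite (big_pred1 tt) => [|[]//]; rewrite mulr1 => + [].
  by exists (fun=> f); rewrite (big_pred1 tt) => [|[]//]; rewrite mulr1.
pose m' (u : 'I_N.+1 * J) : {poly MP O k} := (m u.2)%:P * 'X^(u.1).
have m'E (c : 'I_N.+1 * J -> O) : \sum_u mpC O k.+1 (c u) * m' u =
    \sum_(i < N.+1) (\sum_j mpC O k (c (i, j)) * m j)%:P * 'X^i :> {poly MP O k}.
  transitivity (\sum_i \sum_j mpC O k.+1 (c (i, j)) * m' (i, j)).
    by rewrite pair_bigA; apply: eq_bigr => -[].
  apply: eq_bigr => i _; rewrite rmorph_sum mulr_suml; apply: eq_bigr => j _.
  by rewrite rmorphM mulrA.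
exists ('I_N.+1 * J)%type, m'; split=> [|[i j]|c|f [sf df]].
- by rewrite card_prod card_ord cJ expnS.
- rewrite /m' /= mul_polyC; split=> [|l].
    rewrite (leq_trans (size_scale_leq _ _)) // size_polyXn ltnS.
    by rewrite -ltnS ltn_ord.
  rewrite coefZ coefXn; case: eqP => _; rewrite ?mulr1 ?mulr0 //; exact: dg0.
- rewrite m'E => E [i j]; apply: (fr (fun j => c (i, j))).
  move/(congr1 (fun p : {poly MP O k} => p`_i)): E.
  rewrite coef0 coef_sum (bigD1 i) //= coefCM coefXn eqxx mulr1.
  rewrite [X in _ + X]big1 ?addr0 // => l li.
  by rewrite coefCM coefXn eq_sym (inj_eq val_inj) (negPf li) mulr0.
- have /choice [c cP] (i : nat) : exists c : J -> O,
      (f : {poly MP O k})`_i = \sum_j mpC O k (c j) * m j by apply: sp; exact: df.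
  exists (fun u : 'I_N.+1 * J => c u.1 u.2); rewrite m'E /=; apply/polyP => i.
  rewrite coef_sum; have [iN|iN] := ltnP i N.+1; last first.
    rewrite big1 ?nth_default ?(leq_trans sf) // => l _.
    by rewrite coefCM coefXn gtn_eqF ?mulr0 // (leq_trans (ltn_ord l)).
  rewrite (bigD1 (Ordinal iN)) //= -cP coefCM coefXn eqxx mulr1.
  rewrite [X in _ + X]big1 ?addr0 // => l.
  by rewrite -val_eqE /= coefCM coefXn eq_sym => /negPf ->; rewrite mulr0.
Qed.

End Degree.

(* Counting: for large [N] there are more monomials with exponents at most    *)
(* [N] in [k] variables than in [r] variables with exponents at most [d * N]. *)
Lemma algebraic_dependence (O : idomainType) k r
  (phi : {rmorphism MP O k -> MP O r}) :
  (forall c, phi (mpC O k c) = mpC O r c) -> (r < k)%N ->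
  exists f, f <> 0 /\ phi f = 0.
Proof.
move=> phiC rk; have [d dP] := dg_rmorph phiC.
(* With this choice [(d N + 1)^r <= (d + 1)^r (N + 1)^r = N (N + 1)^r < (N + 1)^(r + 1)]. *)
pose N := (d.+1 ^ r)%N.
have [I [mI [cI dI fI sI]]] := dg_basis O k N.
have [J [mJ [cJ dJ fJ sJ]]] := dg_basis O r (d * N).
have /choice [A AP] i : exists c, phi (mI i) = \sum_j mpC O r (c j) * mJ j.
  by apply: sJ; apply: dP.
have [|c [[i ci] cP]] := @linear_dependence O I J A.
  rewrite cI cJ; apply: (@leq_ltn_trans (d.+1 ^ r * N.+1 ^ r)%N).
    rewrite -expnMn; case: (r) => [//|r1]; rewrite leq_exp2r //.
    by rewrite mulSn mulnS addSn ltnS addnA leq_addl.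
  rewrite (leq_trans _ (leq_pexp2l _ rk)) // expnS ltn_mul2r expn_gt0 /=.
  by rewrite /N.
exists (\sum_i mpC O k (c i) * mI i); split=> [E|]; first exact: ci (fI _ E i).
rewrite rmorph_sum /=.
under eq_bigr => l _ do rewrite rmorphM phiC AP mulr_sumr.
rewrite exchange_big big1 // => j _.
under eq_bigr => l _ do rewrite mulrA -rmorphM.
by rewrite -mulr_suml -rmorph_sum cP rmorph0 mul0r.
Qed.

(** * Regular elements and primes of a polynomial ring *)

Lemma size_subn_lead (R : nzRingType) (p : {poly R}) n : (size p <= n.+1)%N ->
  (size (p - (p`_n)%:P * 'X^n)%R <= n)%N.
Proof.
move=> sp; apply/leq_sizeP => j; rewrite leq_eqVlt coefB coefCM coefXn.
case/orP => [/eqP <-|nj]; first by rewrite eqxx mulr1 subrr.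
by rewrite nth_default ?(leq_trans sp) // gtn_eqF // mulr0 subrr.
Qed.

Section RegularPolynomials.
Variables (C : comNzRingType).
Implicit Types (q : {poly C} -> Prop) (xs : seq C).

Lemma gen_polyC xs (f : {poly C}) :
  gen (map polyC xs) f <-> forall i, gen xs f`_i.
Proof.
have [g0 gD gM] := gen_ideal xs; have iP := gen_ideal (map polyC xs).
split=> [gf|gf].
  apply: (gf (fun f : {poly C} => forall i, gen xs f`_i)).
    split=> [i|f1 f2 h1 h2 i|f1 f2 h2 i]; rewrite ?coef0 ?coefD //.
      exact: gD.
    rewrite coefM; apply: is_ideal_sum => [|j _]; first exact: gen_ideal.
    exact: gM.
  move=> _ /mapP [x xxs ->] i; rewrite coefC; case: eqP => // _.
  exact: gen_mem.
rewrite -[f]coefK poly_def; apply: is_ideal_sum => // i _.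
rewrite -mul_polyC; apply: (is_idealMl _ iP).
apply: (gf i (fun c => gen (map polyC xs) c%:P)).
  case: (iP) => h0 hD hM.
  split=> [|x y|a x]; rewrite ?rmorphD ?rmorphM //; first exact: hD.
  exact: hM.
by move=> y yxs; apply: gen_mem; apply: map_f.
Qed.

Lemma wreg_polyC q xs : is_prime q ->
  wreg (fun c => q c%:P) xs -> wreg q (map polyC xs).
Proof.
move=> qP wxs i; rewrite size_map => ix a; rewrite -map_take (nth_map 0) //.
move/gen_polyC => ga.
have /choice [s sP] j : exists s, ~ q s%:P /\ gen (take i xs) (s * a`_j).
  by apply: wxs => //; rewrite -coefCM.
exists (\prod_(j < size a) s j)%:P; split.
  by rewrite rmorph_prod; apply: is_prime_prod => // j; case: (sP j).
apply/gen_polyC => j; rewrite coefCM; case: (ltnP j (size a)) => [ja|ja].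
  rewrite (bigD1 (Ordinal ja)) //= mulrAC; apply: (@is_idealMl _ (gen (take i xs))).
    exact: gen_ideal.
  by case: (sP j).
by rewrite nth_default // mulr0; case: (gen_ideal (take i xs)).
Qed.

Lemma wreg_rcons (R : comNzRingType) (q : R -> Prop) (ys : seq R) g : wreg q ys ->
  (forall a, gen ys (g * a) -> exists s, ~ q s /\ gen ys (s * a)) ->
  wreg q (rcons ys g).
Proof.
move=> wys wg i; rewrite size_rcons ltnS leq_eqVlt => /orP [/eqP ->|iy] a.
  by rewrite -cats1 take_size_cat // nth_cat ltnn subnn; apply: wg.
by rewrite -cats1 takel_cat 1?ltnW // nth_cat iy; apply: wys.
Qed.

(** Localization inverts the leading coefficient [l] of [f]. If [f * a] vanishes modulo [xs], so
    does [l] times the top coefficient of [a]; without its top term [l * a] has smaller degree. *)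
Lemma wreg_lead q xs (f a : {poly C}) : is_prime q ->
  ~ q (lead_coef f)%:P -> gen (map polyC xs) (f * a) ->
  exists s, ~ q s /\ gen (map polyC xs) (s * a).
Proof.
move=> qP qf; case: (qP) => [[q0 qD qM] q1 qPr].
have f0 : f != 0 by apply/eqP => E; apply: qf; rewrite E lead_coef0.
have iP := gen_ideal (map polyC xs); case: (iP) => g0 gD gM.
move: {2}(size a) (leqnn (size a)) => n; elim: n a => [|n IH] a.
  by rewrite leqn0 size_poly_eq0 => /eqP -> _; exists 1; rewrite mulr0.
move=> sa gfa; set l := lead_coef f in qf.
have gl : gen xs (l * a`_n).
  move: sa; rewrite leq_eqVlt => /orP [/eqP sa|sa]; last first.
    by rewrite [a`_n]nth_default // mulr0; case: (gen_ideal xs).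
  have -> : a`_n = lead_coef a by rewrite lead_coefE sa.
  rewrite mul_lead_coef; move/gen_polyC: gfa; exact.
pose t := (l * a`_n)%:P * 'X^n.
have gt : gen (map polyC xs) t.
  apply/gen_polyC => i; rewrite coefCM; apply: (@is_idealMl _ (gen xs)) => //.
  exact: gen_ideal.
have [||s [qs gs]] := IH (l%:P * a - t).
- rewrite /t -coefCM; apply: size_subn_lead.
  by rewrite mul_polyC (leq_trans (size_scale_leq _ _)).
- rewrite mulrBr mulrCA; apply: (is_idealB iP); first exact: gM.
  exact: gM.
exists (s * l%:P); split; first by case/qPr.
have -> : s * l%:P * a = s * (l%:P * a - t) + s * t by ring.
by apply: gD => //; apply: gM.
Qed.

(** If all leading coefficients of elements of [q] lie in [q], removing leading terms one by one
    shows that all coefficients do, and [q] is extended from [C]. *)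
Lemma prime_poly_cases q : is_prime q ->
  (exists f, q f /\ ~ q (lead_coef f)%:P) \/ forall f, q f -> forall i, q (f`_i)%:P.
Proof.
move=> [[q0 qD qM] q1 qPr].
have [|nex] := pselect (exists f, q f /\ ~ q (lead_coef f)%:P); [by left | right].
move=> f; move: {2}(size f) (leqnn (size f)) => n.
elim: n f => [|n IH] f; first by rewrite leqn0 size_poly_eq0 => /eqP -> _ i; rewrite coef0.
move=> sf qf.
have ql : q (f`_n)%:P.
  move: sf; rewrite leq_eqVlt => /orP [/eqP sf|sf]; last by rewrite nth_default.
  apply: contrapT => nq; apply: nex; exists f; split=> //.
  by rewrite lead_coefE sf.
have {}IH := IH (f - (f`_n)%:P * 'X^n) (size_subn_lead sf).
move=> i; have [->//|/eqP ni] := pselect (i = n).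
have -> : f`_i = (f - (f`_n)%:P * 'X^n)`_i.
  by rewrite coefB coefCM coefXn (negPf ni) mulr0 subr0.
apply: IH; apply: (is_idealB (I := q)) => //; rewrite mulrC; exact: qM.
Qed.

End RegularPolynomials.

(** * Finite free extensions of polynomial rings over a valuation ring *)

Definition uniformizer (O : idomainType) (p : O) : Prop :=
  [/\ p != 0, p \isn't a GRing.unit
    & forall x, x != 0 -> exists u k, u \is a GRing.unit /\ x = u * p ^+ k].

Section DVR.
Variables (O : idomainType) (p : O).
Hypothesis unif : uniformizer p.

Lemma uniformizer_separated : separated p.
Proof.
have [p0 pU pP] := unif.
move=> c /eqP /pP [u [k [uU ->]]]; exists k.+1 => -[z E].
have {}E : u = p * z.
  by apply: (mulIf (expf_neq0 k p0)); rewrite E exprS; ring.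
by case/negP: pU; move: uU; rewrite E unitrM => /andP [].
Qed.

Lemma noeth_dvr : noeth O.
Proof.
have [p0 pU pP] := unif; move=> I [I0 ID IM].
have [[x Ix x0]|nI] := pselect (exists2 x, I x & x != 0); last first.
  exists [::]; split=> // x Ix; have -> : x = 0.
    by apply/eqP/negPn/negP => x0; apply: nI; exists x.
  by case: (gen_ideal (Nil O)).
have powI x' : I x' -> x' != 0 -> exists k u, [/\ I (p ^+ k) & x' = u * p ^+ k].
  move=> Ix' /pP [u [k [uU E]]]; exists k, u; split=> //.
  by rewrite -(mulKr uU (p ^+ k)) -E; apply: IM.
have ex : exists k, `[< I (p ^+ k) >].
  by have [k [u [Ik _]]] := powI x Ix x0; exists k; apply/asboolP.
exists [:: p ^+ ex_minn ex]; case: ex_minnP => k /asboolP Ik kmin.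
split=> [y|y Iy]; first by rewrite inE => /eqP ->.
have [g0 gD gM] := gen_ideal [:: p ^+ k].
have [->//|y0] := eqVneq y 0.
have [l [u [/asboolP /kmin kl ->]]] := powI y Iy y0.
rewrite -(subnK kl) exprD mulrA; apply: gM; apply: gen_mem.
by rewrite inE.
Qed.

(** Induction on the variables through [prime_poly_cases]. Each variable either contributes a
    polynomial of [q] that is regular by [wreg_lead], or stays free and joins the source of [tau].
    The count is [r.+1] when [p] lies in [q], because [p] then opens the sequence. *)
Lemma prime_structure r (q : MP O r -> Prop) : is_prime q ->
  exists (k : nat) (xs : seq (MP O r)) (tau : {rmorphism MP O k -> MP O r}),
    [/\ forall c, tau (mpC O k c) = mpC O r c,
        forall x, x \in xs -> q x,
        wreg q xs
      & (q (mpC O r p) /\ (size xs + k)%N = r.+1 /\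
          forall c, q (tau c) -> divides (mpC O k p) c) \/
        (~ q (mpC O r p) /\ (size xs + k)%N = r /\
          forall c, q (tau c) -> c = 0)].
Proof.
have [p0 pU pP] := unif; elim: r q => [|r IH] q qP.
  have [[q0 qD qM] q1 qPr] := qP.
  have unitq (u : O) : u \is a GRing.unit -> ~ q u.
    by move=> uU qu; apply: q1; rewrite -(mulVr uU); apply: qM.
  have powq (c : O) : q c -> c != 0 -> q p /\ exists z, c = p * z.
    move=> qc /pP [u [[|k] [uU E]]].
      by case: (unitq _ uU); rewrite mulr1 in E; rewrite -E.
    split; last by exists (u * p ^+ k); rewrite E exprS mulrCA.
    move: qc; rewrite E => /qPr [/unitq //|].
    exact: is_primeX.
  have [qp|nqp] := pselect (q p).
    exists 0%N, [:: p], idfun; split=> // [x|[|//] _ a /=|].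
    - by rewrite inE => /eqP ->.
    - move/genP => [c]; rewrite big_ord0 => /eqP; rewrite mulf_eq0 (negPf p0).
      by move=> /eqP ->; exists 1; rewrite mulr0; split=> //; case: (gen_ideal (Nil O)).
    left; do 2!split=> //; move=> c qc; have [->|c0] := eqVneq c 0.
      by exists 0; rewrite mulr0.
    by case: (powq c qc c0).
  exists 0%N, [::], idfun; split=> //; right; do 2!split=> //.
  by move=> c /powq h; apply/eqP/negPn/negP => /h [].
pose q1 (c : MP O r) := q (c%:P : {poly MP O r}).
have q1P : is_prime q1 by exact: (is_prime_preim (@polyC (MP O r)) qP).
have [k [xs [tau [tauC xsq wxs H]]]] := IH q1 q1P.
have xsq' x : x \in map (@polyC (MP O r)) xs -> q x.
  by case/mapP => y /xsq qy ->.
have wxs' : wreg q (map (@polyC (MP O r)) xs) by apply: wreg_polyC.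
have [[f [qf nqf]]|allq] := prime_poly_cases (C := MP O r) qP.
  exists k, (rcons (map (@polyC (MP O r)) xs) f).
  exists (@polyC (MP O r) \o tau : {rmorphism MP O k -> {poly MP O r}}).
  split=> [c|x||].
  - by rewrite /= tauC.
  - by rewrite mem_rcons inE => /orP [/eqP -> //|/xsq'].
  - by apply: wreg_rcons => // a; apply: (wreg_lead (C := MP O r)).
  rewrite size_rcons size_map addSn.
  by case: H => [[qp [-> hc]]|[nqp [-> hc]]]; [left | right].
exists k.+1, (map (@polyC (MP O r)) xs).
exists (map_poly tau : {rmorphism {poly MP O k} -> {poly MP O r}}); split=> //.
  by move=> c /=; rewrite map_polyC /= tauC.
rewrite size_map addnS.
case: H => [[qp [-> hc]]|[nqp [-> hc]]]; [left | right]; do 2!split=> //.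
  move=> c /allq qc.
  have /choice [g gP] i : divides (mpC O k p) (c : {poly MP O k})`_i.
    by apply: hc; have := qc i; rewrite coef_map.
  exists (\poly_(i < size (c : {poly MP O k})) g i).
  apply/polyP => i; rewrite /= coefCM coef_poly.
  by case: ltnP => [_|ci]; rewrite -?gP // mulr0 nth_default.
move=> c /allq qc; apply/polyP => i; rewrite coef0; apply: hc.
by have := qc i; rewrite coef_map.
Qed.

End DVR.

Lemma noeth_MP (O : comNzRingType) r : noeth O -> noeth (MP O r).
Proof. by move=> nO; elim: r => //= r; exact: noeth_poly. Qed.

Lemma noeth_adjoin (R : comNzRingType) (ys : seq R) (B : comNzRingType)
  (f : {rmorphism B -> R}) : noeth B ->
  exists (B' : comNzRingType) (f' : {rmorphism B' -> R}),
    [/\ noeth B', forall x, exists y, f' y = f x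
      & forall y, y \in ys -> exists x, f' x = y].
Proof.
move=> nB; elim: ys => [|y ys [B' [f' [nB' ff' ysf']]]]; first by exists B, f; split=> // x; exists x.
exists {poly B'}, (pev f' y : {rmorphism {poly B'} -> R}); split.
- exact: noeth_poly.
- by move=> x; have [z <-] := ff' x; exists z%:P; rewrite /= pevC.
- move=> z; rewrite inE => /orP [/eqP ->|/ysf' [x <-]].
    by exists 'X; rewrite /= pevX.
  by exists x%:P; rewrite /= pevC.
Qed.

Lemma MP_map (C D : comNzRingType) (f : {rmorphism C -> D}) r : injective f ->
  exists g : {rmorphism MP C r -> MP D r}, injective g /\
    forall c, g (mpC C r c) = mpC D r (f c).
Proof.
move=> finj; elim: r => [|r [g [ginj gC]]]; first by exists f.
exists (map_poly g : {rmorphism {poly MP C r} -> {poly MP D r}}).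
split=> [u v /= E|c /=]; last by rewrite map_polyC /= gC.
by apply/polyP => i; apply: ginj; rewrite -!coef_map E.
Qed.

Lemma mpC_lreg (O : idomainType) (a : O) r (f : MP O r) : a != 0 ->
  mpC O r a * f = 0 -> f = 0.
Proof.
move=> a0; elim: r f => [|r IH] f /= E.
  by move/eqP: E; rewrite mulf_eq0 (negPf a0) => /eqP.
apply/polyP => i; rewrite coef0; apply: IH.
by move/(congr1 (fun h : {poly MP O r} => h`_i)): E; rewrite /= coefCM coef0.
Qed.

Lemma pchain_take (R : comNzRingType) e (P : nat -> R -> Prop) x i :
  pchain e P x -> (i <= e)%N -> pchain i P x.
Proof.
move=> [PP Px] ie; split=> k ki; first by apply: PP; apply: leq_trans ie.
by apply: Px; apply: leq_trans ie.
Qed.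

Lemma pchain_drop (R : comNzRingType) e (P : nat -> R -> Prop) x i :
  pchain e P x -> (i <= e)%N ->
  pchain (e - i) (fun k => P (i + k)%N) (fun k => x (i + k)%N).
Proof.
move=> [PP Px] ie; split=> k ki.
  by apply: PP; rewrite -leq_subRL.
by rewrite addnS; apply: Px; rewrite -ltn_subRL.
Qed.

(** * The Cohen-Macaulay criterion *)

Section Criterion.
Variables (O : idomainType) (p : O).
Hypothesis unif : uniformizer p.
Variables (r s : nat) (R : comNzRingType) (theta : {rmorphism MP O r -> R}).
Variable b : 'I_s -> R.
Hypothesis span : forall y, exists c : 'I_s -> MP O r, y = \sum_i theta (c i) * b i.
Hypothesis free : forall c : 'I_s -> MP O r,
  \sum_i theta (c i) * b i = 0 -> forall i, c i = 0.
Variable j : {rmorphism R -> MP O r}.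
Hypothesis j_inj : injective j.
Hypothesis jtheta : forall c, j (theta (mpC O r c)) = mpC O r c.

Local Notation eta := (fun c => theta (mpC O r c)).

Lemma crit_noeth : noeth R.
Proof.
have nB : noeth (MP O r) by apply: noeth_MP; apply: noeth_dvr unif.
have [B' [f' [nB' ff' bf']]] := noeth_adjoin (codom b) theta nB.
apply: (@noeth_image _ _ f' _ nB') => y; have [c ->] := span y.
have /choice [u uP] i : exists u, f' u = theta (c i) by exact: ff'.
have /choice [v vP] i : exists v, f' v = b i by apply: bf'; exact: codom_f.
exists (\sum_i u i * v i); rewrite rmorph_sum; apply: eq_bigr => i _.
by rewrite rmorphM /= uP vP.
Qed.

(** Freeness of [R] makes coordinates unique, so ideals extended from the polynomial ring are read
    off coordinatewise; this carries regular sequences over to [R]. *)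
Lemma gen_theta xs (c : 'I_s -> MP O r) :
  gen (map theta xs) (\sum_i theta (c i) * b i) <-> forall i, gen xs (c i).
Proof.
have iT := gen_ideal (map theta xs); case: (iT) => t0 tD tM.
have [g0 gD gM] := gen_ideal xs.
split=> [gc|gc]; last first.
  apply: is_ideal_sum => // i _; apply: (is_idealMl _ iT).
  apply: (gc i (fun c => gen (map theta xs) (theta c))).
    split=> [|x y|a x]; rewrite ?rmorph0 ?rmorphD ?rmorphM //; first exact: tD.
    exact: tM.
  by move=> y yxs; apply: gen_mem; apply: map_f.
have uniq c1 c2 : \sum_i theta (c1 i) * b i = \sum_i theta (c2 i) * b i ->
    forall i, c1 i = c2 i.
  move=> E i; apply/eqP; rewrite -subr_eq0; apply/eqP.
  apply: (free (c := fun i => c1 i - c2 i)).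
  rewrite -[RHS](subrr (\sum_i theta (c1 i) * b i)) {2}E -sumrB.
  by apply: eq_bigr => k _; rewrite rmorphB mulrBl.
have [|_ /mapP [x xxs ->]|d [dg E]] := gc (fun y =>
    exists d, (forall i, gen xs (d i)) /\ y = \sum_i theta (d i) * b i).
- split=> [|x y [d [gd ->]] [d' [gd' ->]]|a x [d [gd ->]]].
  + by exists (fun=> 0); rewrite big1 // => i _; rewrite rmorph0 mul0r.
  + exists (fun i => d i + d' i); split=> [i|]; first exact: gD.
    by rewrite -big_split; apply: eq_bigr => i _; rewrite rmorphD mulrDl.
  + have /choice [m mP] i := span (a * b i).
    exists (fun k => \sum_i d i * m i k); split=> [k|].
      by apply: is_ideal_sum => // i _; apply: (@is_idealMl _ (gen xs)).
    rewrite mulr_sumr; under eq_bigr => i _ do rewrite mulrCA mP mulr_sumr.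
    rewrite exchange_big; apply: eq_bigr => k _.
    by rewrite rmorph_sum mulr_suml; apply: eq_bigr => i _; rewrite rmorphM mulrA.
- have [m mP] := span 1; exists (fun i => x * m i); split=> [i|].
    by apply: (@is_idealMl _ (gen xs)) => //; apply: gen_mem.
  rewrite -[LHS]mulr1 mP mulr_sumr; apply: eq_bigr => i _.
  by rewrite rmorphM mulrA.
by move=> i; rewrite (uniq _ _ E).
Qed.

Lemma theta_sum t (c : 'I_s -> MP O r) :
  theta t * (\sum_i theta (c i) * b i) = \sum_i theta (t * c i) * b i.
Proof. by rewrite mulr_sumr; apply: eq_bigr => i _; rewrite rmorphM mulrA. Qed.

Lemma wreg_theta (m : R -> Prop) xs : is_prime m ->
  wreg (fun c => m (theta c)) xs -> wreg m (map theta xs).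
Proof.
move=> mP wxs i; rewrite size_map => ix a; rewrite -map_take (nth_map 0) //.
have [c ->] := span a.
rewrite theta_sum => /gen_theta gc.
have /choice [t tP] k : exists t, ~ m (theta t) /\ gen (take i xs) (t * c k).
  exact: wxs.
exists (theta (\prod_k t k)); split.
  by rewrite rmorph_prod; apply: is_prime_prod => // k; case: (tP k).
rewrite theta_sum; apply/gen_theta => k; rewrite (bigD1 k) //= mulrAC.
by apply: (@is_idealMl _ (gen (take i xs))); [exact: gen_ideal | case: (tP k)].
Qed.

(** The embedding [j] moves the question into [MP O r], where more than [r] elements are dependent.
    The relation is regrouped by [MP_assoc] so that the [k] variables of [tau] become
    coefficients. *)
Lemma crit_dependence k e (tau : {rmorphism MP O k -> MP O r}) (x : nat -> R) :
  (forall c, tau (mpC O k c) = mpC O r c) -> (r < e + k)%N ->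
  exists f : MP (MP O k) e, f <> 0 /\
    ev (theta \o tau : {rmorphism MP O k -> R}) e x f = 0.
Proof.
move=> tauC rek; have [iota [iinj iC]] := MP_assoc O e k.
set h := ev _ e x.
have [|f [f0 fE]] := algebraic_dependence
    (phi := (j \o h \o iota : {rmorphism MP O (e + k) -> MP O r})) _ rek.
  by move=> c /=; rewrite iC ev_mpC /= tauC jtheta.
exists (iota f); split=> [E|]; first by apply: f0; apply: iinj; rewrite E rmorph0.
by apply: j_inj; rewrite rmorph0.
Qed.

Section Prime.
Variables (m : R -> Prop) (k : nat) (tau : {rmorphism MP O k -> MP O r}).
Hypothesis tauC : forall c, tau (mpC O k c) = mpC O r c.
Local Notation eta' := (theta \o tau : {rmorphism MP O k -> R}).
Variables (e : nat) (P : nat -> R -> Prop) (x : nat -> R).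
Hypothesis Px : pchain e P x.
Hypothesis Pm : forall i y, P i y -> m y.

(** Otherwise the witnesses of the chain satisfy a relation, and [pchain_coef] leaves a nonzero
    element of [MP O k] in [m]. *)
Lemma height_generic : (forall c, m (eta' c) -> c = 0) -> (e + k <= r)%N.
Proof.
move=> mc; rewrite leqNgt; apply/negP => rek.
have [f [f0 fE]] := crit_dependence x tauC rek.
have [[P00 _ _] _ _] : is_prime (P 0%N) by case: Px => + _; apply.
have [|||c [c0 /Pm /mc //]] := pchain_coef (Z := fun c => c = 0) (eta := eta') (f := f) Px.
- by move=> c ->; rewrite rmorph0.
- by move/allcoef_eq0.
- by rewrite fE.
Qed.

(** The argument depends on where [p] enters the chain. If [p] is in [P 0], the relation is first
    divided by powers of [p], so that some coefficient is prime to [p]. If [p] is not even in [P e],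
    the constant obtained at the end is divided by powers of [p] instead. Otherwise one step of the
    chain is spent on [p], which explains the bound [r.+1]. *)
Lemma height_special : m (theta (mpC O r p)) ->
  (forall c, m (eta' c) -> divides (mpC O k p) c) -> (e + k <= r.+1)%N.
Proof.
move=> mp mc; rewrite leqNgt; apply/negP => rek.
have sepO := uniformizer_separated unif.
have sep := @separated_MP _ _ k sepO.
have etap N : eta' (mpC O k p ^+ N) = theta (mpC O r p) ^+ N.
  by rewrite rmorphXn /= tauC.
have Pprime i : (i <= e)%N -> is_prime (P i) by case: Px => + _; apply.
have Pdiv i N y : (i <= e)%N -> ~ P i (theta (mpC O r p)) ->
    P i (theta (mpC O r p) ^+ N * y) -> P i y.
  move=> ie nP; have [_ _ PP] := Pprime i ie.
  by case/PP => // /(is_primeX (Pprime i ie)).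
have [P0p|nP0p] := pselect (P 0%N (theta (mpC O r p))).
  have [|f [f0 fE]] := @crit_dependence k e tau x tauC; first exact: ltnW.
  have [N [g [fg ng]]] := separated_factor (@separated_MP _ _ e sep) f0.
  have evg : ev eta' e x g = 0.
    apply: j_inj; rewrite rmorph0; apply: (@mpC_lreg O (p ^+ N)).
      by apply: expf_neq0; case: unif.
    rewrite -jtheta -rmorphM -(rmorph0 j) -fE fg; congr (j _).
    by rewrite [RHS]rmorphM [in RHS]rmorphXn /= ev_mpC /= tauC !rmorphXn.
  have [[P00 _ P0M] _ _] := Pprime 0%N isT.
  have [|||c [c0 /Pm /mc //]] := pchain_coef (Z := divides (mpC O k p))
      (eta := eta') (f := g) Px.
  - by move=> c [d ->]; rewrite rmorphM mulrC /= tauC; apply: P0M.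
  - by move/allcoef_divides.
  - by rewrite evg.
have [Pep|nPep] := pselect (P e (theta (mpC O r p))); last first.
  have [|f [f0 fE]] := @crit_dependence k e tau x tauC; first exact: ltnW.
  have [[P00 _ _] _ _] := Pprime 0%N isT.
  have [|||c [c0 Pc]] := pchain_coef (Z := fun c => c = 0) (eta := eta') (f := f) Px.
  - by move=> c ->; rewrite rmorph0.
  - by move/allcoef_eq0.
  - by rewrite fE.
  have [N [g [cg ng]]] := separated_factor sep c0.
  apply: ng; apply: mc; apply: (Pm (i := e)).
  by apply: (Pdiv _ N) => //; rewrite -etap -rmorphM -cg.
have [i [ie nPi Pi]] : exists i, [/\ (i < e)%N, ~ P i (theta (mpC O r p))
    & P i.+1 (theta (mpC O r p))].
  have ex : exists i, (i <= e)%N && `[< P i (theta (mpC O r p)) >].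
    by exists e; rewrite leqnn; apply/asboolP.
  have := ex_minnP ex; case=> -[|i] /andP [ie /asboolP Pi] imin; first by [].
  exists i; split=> // Pi'; have := imin i; rewrite ltnW //= ltnn.
  by move/asboolP: Pi' => -> /(_ isT).
have eS : ((e - i.+1) + k + i > r)%N.
  by rewrite -ltnS (leq_trans rek) // -addnS addnAC subnK.
(* The witness [x i] of the step at which [p] enters is left out of the relation. The earlier
   witnesses are eliminated along [P 0], ..., [P i]; the resulting nonzero coefficient may be
   divided by powers of [p], as [p] is not in [P i]; the later witnesses are then eliminated modulo
   [p]. *)
set x2 := fun l => x (i.+1 + l)%N.
set C1 := MP (MP O k) (e - i.+1).
pose eta1 := ev eta' (e - i.+1) x2.
have [f [f0 fE]] : exists f : MP C1 i, f <> 0 /\ ev eta1 i x f = 0.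
  have [iota [iinj iC]] := MP_assoc O (e - i.+1) k.
  have [iota1 [iinj1 iC1]] := MP_assoc O i (e - i.+1 + k).
  have [psi [psinj psiC]] := MP_map i iinj.
  pose phi : {rmorphism MP O (i + (e - i.+1 + k)) -> MP O r} :=
    (j \o ev eta1 i x \o psi \o iota1).
  have [||f [f0 fE]] := @algebraic_dependence O _ r phi.
  - by move=> c /=; rewrite iC1 psiC ev_mpC iC ev_mpC /= tauC jtheta.
  - by rewrite addnC.
  exists (psi (iota1 f)); split; last by apply: j_inj; rewrite rmorph0.
  by move=> E; apply: f0; apply: iinj1; apply: psinj; rewrite E !rmorph0.
have [[P00 _ _] _ _] := Pprime 0%N isT.
have Pxi : pchain i P x by apply: pchain_take Px _; exact: ltnW.
have [|||c1 [c10 Pc1]] := pchain_coef (Z := fun c => c = 0) (eta := eta1) (f := f) Pxi.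
- by move=> c ->; rewrite rmorph0.
- by move/allcoef_eq0.
- by rewrite fE.
have [N [g [cg ng]]] := separated_factor (@separated_MP _ _ (e - i.+1) sep) c10.
have Pg : P i.+1 (eta1 g).
  have [sub _ _] : [/\ forall y, P i y -> P i.+1 y, P i.+1 (x i) & ~ P i (x i)].
    by case: Px => _; apply.
  apply: sub; apply: (Pdiv _ N) => //; first exact: ltnW.
  by move: Pc1; rewrite cg rmorphM rmorphXn /= ev_mpC /= tauC.
have := pchain_coef (Z := divides (mpC O k p)) (f := g) (pchain_drop Px ie).
rewrite addn0 subnKC // => /(_ _ _ _ Pg) [||c [c0 /Pm /mc //]].
- move=> c [d ->]; rewrite rmorphM mulrC /= tauC.
  by case: (Pprime i.+1 ie) => [[_ _ PM] _ _]; apply: PM.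
- by move/allcoef_divides.
Qed.

End Prime.

Theorem cm_criterion : cohen_macaulay R.
Proof.
apply: cm_of_maximal crit_noeth _ => m mm.
have [q qm] := maximal_ideal_prime mm.
have mP : is_prime (fun x => x \in m).
  case: (prime_idealr_prime q) => _ _ qPr.
  split; [exact: idealr_ideal | by rewrite idealr1 | move=> x y].
  by rewrite -!qm; exact: qPr.
have [k [xs [tau [tauC xsq wxs H]]]] :=
  prime_structure unif (is_prime_preim theta mP).
exists (map theta xs); split=> [_ /mapP [x /xsq xm ->] //||e P x Px Pm].
  exact: wreg_theta.
rewrite size_map -(leq_add2r k).
case: H => [[mp [-> mc]]|[nmp [-> mc]]].
  exact: (height_special tauC Px Pm).
exact: (height_generic tauC Px Pm).
Qed.

End Criterion.

(** * Rigid indecomposable representations of Z/3 *)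

Definition is_basis (O : comNzRingType) (V : lmodType O) r (e : 'I_r -> V) : Prop :=
  (forall v, exists c : 'I_r -> O, v = \sum_i c i *: e i) /\
  forall c : 'I_r -> O, \sum_i c i *: e i = 0 -> forall i, c i = 0.

Definition torsion_free (O : comNzRingType) (V : lmodType O) : Prop :=
  forall (a : O) (v : V), a *: v = 0 -> a = 0 \/ v = 0.

(** * Lattices over a discrete valuation ring *)

Section DVRModules.
Variables (O : idomainType) (p : O).
Hypothesis unif : uniformizer p.

Lemma dvr_unit (x : O) : ~ divides p x -> x \is a GRing.unit.
Proof.
have [p0 pU pP] := unif => nd.
have x0 : x != 0 by apply/eqP => x0; apply: nd; exists 0; rewrite mulr0.
have [u [[|k] [uU E]]] := pP x x0; first by rewrite E mulr1.
by case: nd; exists (u * p ^+ k); rewrite E exprS mulrCA.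
Qed.

Lemma dvr_unit_addl (x y : O) : x \is a GRing.unit -> divides p y ->
  x + y \is a GRing.unit.
Proof.
have [p0 pU pP] := unif => xU [z ->]; apply: dvr_unit => -[t E].
case/negP: pU; have : x = p * (t - z) by rewrite mulrBr -E addrK.
by move=> Ex; move: xU; rewrite Ex unitrM => /andP [].
Qed.

Lemma family_factor n (c : 'I_n -> O) : (exists i, c i <> 0) ->
  exists N d, (forall i, c i = p ^+ N * d i) /\ exists i, d i \is a GRing.unit.
Proof.
move=> [i0 /(uniformizer_separated unif) [N nN]].
elim: N c nN => [|N IH] c nN; first by case: nN; exists (c i0); rewrite mul1r.
have [[i /dvr_unit ci]|/forallNP all_div] := pselect (exists i, ~ divides p (c i)).
  by exists 0%N, c; split=> [k|]; [rewrite mul1r | exists i].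
have /choice [d dP] i : divides p (c i) by exact: contrapT.
have [|M [d' [d'P dU]]] := IH d.
  by move=> [z E]; apply: nN; exists z; rewrite dP E exprS mulrA.
by exists M.+1, d'; split=> // i; rewrite dP d'P exprS mulrA.
Qed.

Section TorsionFree.
Variables (N : lmodType O).
Hypothesis tf : torsion_free N.

(** A relation, divided by the largest power of [p] common to its coefficients, has a unit
    coefficient, and the generator with that coefficient can be discarded. *)
Lemma independent_span n (s : 'I_n -> N) : exists m (t : 'I_m -> N),
  [/\ forall c : 'I_m -> O, \sum_i c i *: t i = 0 -> forall i, c i = 0,
      forall i, exists c : 'I_m -> O, s i = \sum_k c k *: t k
    & forall k, exists c : 'I_n -> O, t k = \sum_i c i *: s i].
Proof.
have self k (t : 'I_k -> N) i : exists c : 'I_k -> O, t i = \sum_l c l *: t l.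
  exists (fun l => (l == i)%:R); rewrite (bigD1 i) //= eqxx scale1r big1 ?addr0 //.
  by move=> l /negPf ->; rewrite scale0r.
elim: n s => [|n IH] s; first by exists 0%N, s; split=> [c _ []|[]|[]].
have [ind|/existsNP [c /not_implyP [E /existsNP c0]]] :=
  pselect (forall c : 'I_n.+1 -> O, \sum_i c i *: s i = 0 -> forall i, c i = 0).
  by exists n.+1, s; split.
have [K [d [cd [i0 dU]]]] := family_factor c0.
have {}E : \sum_i d i *: s i = 0.
  have /tf [/eqP|//] : p ^+ K *: (\sum_i d i *: s i) = 0.
    by rewrite -[RHS]E scaler_sumr; apply: eq_bigr => i _; rewrite scalerA cd.
  by rewrite expf_eq0; case: unif => /negPf -> _ _; rewrite andbF.
have {c c0 cd} si0 : s i0 = \sum_(l < n) (- (d i0)^-1 * d (lift i0 l)) *: s (lift i0 l).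
  move: E; rewrite (bigD1_ord i0) //= => /(canRL (addrK _)); rewrite sub0r => E.
  rewrite -[s i0]scale1r -(mulVr dU) -scalerA E scalerN scaler_sumr -sumrN.
  by apply: eq_bigr => l _; rewrite scalerA mulNr scaleNr.
have [m [t [ti st ts]]] := IH (fun l => s (lift i0 l)).
exists m, t; split=> // [i|k].
  have [l ->|->] := unliftP i0 i; first exact: st.
  have /choice [b bP] l := st l; rewrite si0.
  exists (fun k => \sum_l (- (d i0)^-1 * d (lift i0 l)) * b l k).
  under eq_bigr => l _ do rewrite bP scaler_sumr.
  rewrite exchange_big; apply: eq_bigr => k _; rewrite scaler_suml.
  by apply: eq_bigr => l _; rewrite scalerA.
have [c ->] := ts k.
exists (fun i => if unlift i0 i is Some l then c l else 0).
rewrite (bigD1_ord i0) //= unlift_none scale0r add0r.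
by apply: eq_bigr => l _; rewrite liftK.
Qed.

(** The image of [phi] is free. Since [phi v] is not a multiple of [p] there, one of its coordinates
    is a unit; that coordinate, normalised, is [l]. *)
Lemma separating_functional (M : lmodType O) (phi : {linear M -> N}) (v : M) :
  finitely_generated M -> (forall x, phi v <> p *: phi x) ->
  exists l : {scalar M}, (forall x, phi x = 0 -> l x = 0) /\ l v = 1.
Proof.
move=> [n [s sP]] nv.
have [m [t [ti st ts]]] := independent_span (fun i => phi (s i)).
have coP x : exists c : 'I_m -> O, phi x = \sum_k c k *: t k.
  have [a ->] := sP x; have /choice [b bP] i := st i.
  exists (fun k => \sum_i a i * b i k); rewrite linear_sum.
  under eq_bigr => i _ do rewrite linearZ /= bP scaler_sumr.
  rewrite exchange_big; apply: eq_bigr => k _; rewrite scaler_suml.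
  by apply: eq_bigr => i _; rewrite scalerA.
have /choice [co cP] := coP.
have uniq (c1 c2 : 'I_m -> O) :
    \sum_k c1 k *: t k = \sum_k c2 k *: t k -> forall k, c1 k = c2 k.
  move=> E k; apply/eqP; rewrite -subr_eq0; apply/eqP.
  apply: (ti (fun k => c1 k - c2 k)).
  rewrite -[RHS](subrr (\sum_k c1 k *: t k)) {2}E -sumrB.
  by apply: eq_bigr => i _; rewrite scalerBl.
have [k ck] : exists k, co v k \is a GRing.unit.
  apply: contrapT => /forallNP nU.
  have /choice [d dP] k : divides p (co v k).
    by apply: contrapT => /dvr_unit; apply: nU.
  have /choice [w wP] k : exists w, t k = phi w.
    have [c ->] := ts k; exists (\sum_i c i *: s i); rewrite linear_sum.
    by apply: eq_bigr => i _; rewrite linearZ.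
  apply: (nv (\sum_k d k *: w k)); rewrite cP linear_sum scaler_sumr.
  by apply: eq_bigr => k _; rewrite linearZ /= -wP scalerA dP.
pose l x := (co v k)^-1 * co x k.
have lin : linear_for *%R l.
  move=> a x y; rewrite /l mulrCA -mulrDr; congr (_ * _).
  apply: (uniq _ (fun k => a * co x k + co y k)); rewrite -cP linearP cP (cP y).
  rewrite scaler_sumr -big_split; apply: eq_bigr => i _.
  by rewrite scalerDl scalerA.
pose L : {scalar M} := HB.pack l (GRing.isLinear.Build O M O *%R l lin).
exists L; split=> [x x0|]; last by rewrite /= /l mulVr.
rewrite /= /l; suff -> : co x k = 0 by rewrite mulr0.
apply: (uniq _ (fun=> 0)); rewrite -cP x0 big1 // => i _.
by rewrite scale0r.
Qed.

End TorsionFree.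

Lemma not_pow_divisible (N : lmodType O) : torsion_free N -> finitely_generated N ->
  forall v : N, v <> 0 -> exists K, forall w, v <> p ^+ K *: w.
Proof.
move=> tf [n [s sP]] v v0.
have [m [t [ti st ts]]] := independent_span tf s.
have coP x : exists c : 'I_m -> O, x = \sum_k c k *: t k.
  have [a ->] := sP x; have /choice [b bP] i := st i.
  exists (fun k => \sum_i a i * b i k).
  under eq_bigr => i _ do rewrite bP scaler_sumr.
  rewrite exchange_big; apply: eq_bigr => k _; rewrite scaler_suml.
  by apply: eq_bigr => i _; rewrite scalerA.
have [c vE] := coP v.
have [k ck] : exists k, c k <> 0.
  apply: contrapT => /forallNP c0; apply: v0; rewrite vE big1 // => i _.
  by rewrite (contrapT (c0 i)) scale0r.
have [K nK] := uniformizer_separated unif ck; exists K => w wE.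
have [d dE] := coP w; apply: nK; exists (d k); apply/eqP; rewrite -subr_eq0.
apply/eqP; apply: (ti (fun k => c k - p ^+ K * d k)).
rewrite -[RHS](subrr v) {2}wE {1}vE dE scaler_sumr -sumrB.
by apply: eq_bigr => i _; rewrite scalerBl scalerA.
Qed.

End DVRModules.

(* [X^3 - 1 = (X - a1)(X - a2)(X - a3)] has distinct roots, which are         *)
(* congruent modulo [p].                                                      *)
Definition cube_roots (O : comNzRingType) (p a1 a2 a3 : O) : Prop :=
  [/\ a1 + a2 + a3 = 0, a1 * a2 + a1 * a3 + a2 * a3 = 0, a1 * a2 * a3 = 1,
      [/\ a1 <> a2, a1 <> a3 & a2 <> a3] & divides p (a1 - a2)].

(** * Rigid lattices with an operator of order three *)

Section Classification.
Variables (O : idomainType) (p : O).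
Hypothesis unif : uniformizer p.
Variables (V : lmodType O) (X : {linear V -> V}).
Hypothesis X3 : forall v, X (X (X v)) = v.
Hypothesis tf : torsion_free V.
Hypothesis fg : finitely_generated V.
Hypothesis rig : forall A : {linear V -> V},
  (forall v, X (X (A v)) + X (A (X v)) + A (X (X v)) = 0) ->
  exists H : {linear V -> V}, forall v, A v = X (H v) - H (X v).

Local Notation F a v := (X v - a *: v).

(** The action of an element of the group ring; identities between polynomials in [X] become
    identities between coefficients. *)
Definition orb c0 c1 c2 v := c0 *: v + c1 *: X v + c2 *: X (X v).

Lemma orb1 v : v = orb 1 0 0 v.
Proof. by rewrite /orb scale1r !scale0r !addr0. Qed.

Lemma orb0 v : orb 0 0 0 v = 0.
Proof. by rewrite /orb !scale0r !addr0. Qed.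

Lemma orbX c0 c1 c2 v : X (orb c0 c1 c2 v) = orb c2 c0 c1 v.
Proof. by rewrite /orb !linearD !linearZ /= X3 addrC addrA. Qed.

Lemma orbZ a c0 c1 c2 v : a *: orb c0 c1 c2 v = orb (a * c0) (a * c1) (a * c2) v.
Proof. by rewrite /orb !scalerDr !scalerA. Qed.

Lemma orbD c0 c1 c2 d0 d1 d2 v :
  orb c0 c1 c2 v + orb d0 d1 d2 v = orb (c0 + d0) (c1 + d1) (c2 + d2) v.
Proof. by rewrite /orb !scalerDl addrACA (addrACA (c0 *: v)). Qed.

Lemma orbB c0 c1 c2 d0 d1 d2 v :
  orb c0 c1 c2 v - orb d0 d1 d2 v = orb (c0 - d0) (c1 - d1) (c2 - d2) v.
Proof. by rewrite -[orb d0 _ _ _]scale1r -scaleNr orbZ orbD !mulN1r. Qed.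

Lemma orbF a c0 c1 c2 v :
  F a (orb c0 c1 c2 v) = orb (c2 - a * c0) (c0 - a * c1) (c1 - a * c2) v.
Proof. by rewrite orbX orbZ orbB. Qed.

Lemma FC a b v : F a (F b v) = F b (F a v).
Proof. by rewrite (orb1 v) !orbF; congr orb; ring. Qed.

Lemma FFE a b v : F a (F b v) = orb (a * b) (- (a + b)) 1 v.
Proof. by rewrite {1 2 3 4}(orb1 v) !orbF; congr orb; ring. Qed.

Lemma orb_scalar (l : {scalar V}) c0 c1 c2 v :
  l (orb c0 c1 c2 v) = c0 * l v + c1 * l (X v) + c2 * l (X (X v)).
Proof. by rewrite /orb !linearD !linearZ. Qed.

Lemma F0 a : F a 0 = 0. Proof. by rewrite linear0 scaler0 subr0. Qed.

Lemma FZ a c v : F a (c *: v) = c *: F a v.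
Proof. by rewrite linearZ scalerBr !scalerA (mulrC a). Qed.

Lemma FB a b v : F a v = F b v + (b - a) *: v.
Proof. by rewrite scalerBl addrA subrK. Qed.

Lemma tfZ (a : O) (v : V) : a != 0 -> a *: v = 0 -> v = 0.
Proof. by move=> a0 /tf [/eqP|//]; rewrite (negPf a0). Qed.

Lemma sub_neq0 (a b : O) : a <> b -> a - b != 0.
Proof. by move=> ab; rewrite subr_eq0; apply/eqP. Qed.

Lemma p_neq0 : p != 0. Proof. by case: unif. Qed.

Lemma F3 a1 a2 a3 v : cube_roots p a1 a2 a3 -> F a1 (F a2 (F a3 v)) = 0.
Proof.
move=> [s1 s2 s3 _ _]; rewrite (orb1 v) !orbF -[RHS](orb0 v); congr orb.
- transitivity (1 - a1 * a2 * a3); first by ring.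
  by rewrite s3 subrr.
- by rewrite -[RHS]s2; ring.
- transitivity (- (a1 + a2 + a3)); first by ring.
  by rewrite s1 oppr0.
Qed.

(** Starting from [v0], the value of [phi] is divided by [p] within the image as often as possible,
    keeping [Q]; this stops because no nonzero vector is divisible by all powers of [p]. *)
Lemma not_divisible_image (phi : {linear V -> V}) (Q : V -> Prop) v0 :
  phi v0 <> 0 -> Q v0 -> (forall v w, Q v -> phi v = p *: phi w -> Q w) ->
  exists v, Q v /\ forall x, phi v <> p *: phi x.
Proof.
move=> v00 Qv0 Qp; have [K] := not_pow_divisible unif tf fg v00.
elim: K v0 {v00} Qv0 => [|K IH] v0 Qv0 nK.
  by case: (nK (phi v0)); rewrite scale1r.
have [[x E]|/forallNP nx] := pselect (exists x, phi v0 = p *: phi x).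
  apply: (IH x) => [|w xE]; first exact: Qp E.
  by apply: (nK w); rewrite E xE scalerA -exprS.
by exists v0.
Qed.

Definition Flin a : {linear V -> V} := X \- a \*: idfun.

Lemma FlinE a v : Flin a v = F a v. Proof. by []. Qed.

Definition rank1 (l : {scalar V}) (u : V) (x : V) : V := l x *: u.

Lemma rank1_linear l u : linear (rank1 l u).
Proof. by move=> a x y; rewrite /rank1 linearP scalerDl scalerA. Qed.

HB.instance Definition _ l u :=
  GRing.isLinear.Build O V V _ (rank1 l u) (rank1_linear l u).

Lemma FP b a x y : F b (a *: x + y) = a *: F b x + F b y.
Proof. exact: (linearP (Flin b)). Qed.

Lemma p_nonunit : p \isn't a GRing.unit. Proof. by case: unif. Qed.

(* The hypothesis [rig] for the rank one map [x |-> l x *: u], where [l]      *)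
(* vanishes on the kernel of [X - a1] and [u] lies in it, yields [H] with     *)
(* [(X - a2) H v - H (X - a2) v = l v *: u]; so [X - a2] cannot map the       *)
(* kernel of [(X - a1) (X - a2)] into [p V].                                  *)
Lemma classify_step a1 a2 a3 v0 u0 : cube_roots p a1 a2 a3 ->
  F a1 u0 = 0 -> u0 <> 0 -> F a1 (F a2 v0) = 0 -> F a1 v0 <> 0 ->
  exists v, F a1 (F a2 v) = 0 /\ forall w, F a2 v <> p *: w.
Proof.
move=> aP Fu0 u00 FFv0 Fv0.
apply: contrapT => nex.
have div v : F a1 (F a2 v) = 0 -> exists w, F a2 v = p *: w.
  by move=> Fv; apply: contrapT => /forallNP nw; apply: nex; exists v.
have [u [Fu nu]] : exists u, F a1 u = 0 /\ forall x, u <> p *: x.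
  apply: (@not_divisible_image idfun (fun u => F a1 u = 0) u0) => // v w Fv /= E.
  by apply: (tfZ p_neq0); rewrite -(FZ a1 p) -E.
have [v [Fv nv]] : exists v, F a1 (F a2 v) = 0 /\ forall x, F a1 v <> p *: F a1 x.
  apply: (@not_divisible_image (Flin a1) (fun v => F a1 (F a2 v) = 0) v0) => //.
  move=> x y Fx; rewrite !FlinE => E; apply: (tfZ p_neq0).
  by rewrite FC -(FZ a2 p) -E FC Fx.
have [l [l0 lv]] := separating_functional unif tf (phi := Flin a1) fg nv.
have [s1 s2 s3 _ _] := aP.
have Xu : X u = a1 *: u by apply/eqP; rewrite -subr_eq0 Fu.
have [|H HP] := rig (A := rank1 l u).
  move=> x; rewrite /= /rank1 !linearZ /= Xu !(linearZ, scalerA) /= Xu !scalerA.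
  rewrite -!scalerDl.
  suff -> : a1 * l x * a1 + a1 * l (X x) + l (X (X x)) = 0 by rewrite scale0r.
  have <- : l (F a2 (F a3 x)) = 0 by apply: l0; rewrite FlinE F3.
  have a23 : a2 + a3 = - a1 by apply/eqP; rewrite -addr_eq0 addrC addrA s1.
  have -> : F a2 (F a3 x) = orb (a1 * a1) a1 1 x.
    rewrite FFE a23 opprK; congr orb; apply/eqP; rewrite -subr_eq0; apply/eqP.
    transitivity (a1 * a2 + a1 * a3 + a2 * a3 - a1 * (a1 + a2 + a3)); first by ring.
    by rewrite s1 s2 mulr0 subrr.
  by rewrite orb_scalar; ring.
have HK1 z : F a1 z = 0 -> F a1 (H z) = 0.
  move=> Fz; have Xz : X z = a1 *: z by apply/eqP; rewrite -subr_eq0 Fz.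
  have := HP z; rewrite /= /rank1 l0 // scale0r Xz linearZ /= => /esym ->.
  by [].
have F2H z : F a2 (H z) = H (F a2 z) + l z *: u.
  have -> : l z *: u = X (H z) - H (X z) by rewrite -HP.
  by rewrite linearB [H (a2 *: z)]linearZ /= [RHS]addrC addrA subrK.
have HFv : F a1 (F a2 (H v)) = 0.
  rewrite F2H linearD scalerDr opprD addrACA HK1 // add0r FZ Fu scaler0.
  by [].
(* At [v] the identity [F2H] reads [p w2 = p H w1 + u], against the choice of [u]. *)
have [w1 E1] := div _ Fv; have [w2 E2] := div _ HFv.
apply: (nu (w2 - H w1)); rewrite scalerBr -E2 F2H E1 linearZ /= lv scale1r.
by rewrite addrC addKr.
Qed.

(** The device of [classify_step] one level up: [l] vanishes on the kernel of [(X - a1) (X - a2)],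
    so [l X = a3 l], and the vector of the rank one map is the [v] of that lemma. If
    [(X - a2) (X - a3)] mapped [V] into [p V], its value at [H w] would make [(X - a2) v] divisible
    by [p]. *)
Lemma classify3 a1 a2 a3 u1 u2 u3 : cube_roots p a1 a2 a3 ->
  (F a1 u1 = 0 /\ u1 <> 0) -> (F a2 u2 = 0 /\ u2 <> 0) ->
  (F a3 u3 = 0 /\ u3 <> 0) ->
  exists w, forall x, F a2 (F a3 w) <> p *: x.
Proof.
move=> aP [Fu1 u10] [Fu2 u20] [Fu3 u30].
have [s1 s2 s3 [a12 a13 a23] _] := aP.
apply: contrapT => nex.
have div v : exists w, F a2 (F a3 v) = p *: w.
  by apply: contrapT => /forallNP nw; apply: nex; exists v.
have eigF a b u : F a u = 0 -> F b u = (a - b) *: u.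
  by move=> Fu; rewrite (FB b a) Fu add0r.
have [||v [Fv nv]] := classify_step aP Fu1 u10 (v0 := u2).
- by rewrite Fu2 F0.
- by rewrite (eigF _ _ _ Fu2) => /(tfZ (sub_neq0 (not_eq_sym a12))).
have [w [_ nw]] : exists w, True /\ forall x, F a1 (F a2 w) <> p *: F a1 (F a2 x).
  apply: (@not_divisible_image (Flin a1 \o Flin a2) (fun=> True) u3) => //=.
  rewrite (eigF _ _ _ Fu3) FZ (eigF _ _ _ Fu3).
  by move=> /(tfZ (sub_neq0 (not_eq_sym a23))) /(tfZ (sub_neq0 (not_eq_sym a13))).
have [l [l0 lw]] := separating_functional unif tf (phi := Flin a1 \o Flin a2) fg nw.
have lX x : l (X x) = a3 * l x.
  apply/eqP; rewrite -subr_eq0 -[a3 * _]linearZ -linearB /=; apply/eqP.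
  by apply: l0; exact: F3.
have [|H HP] := rig (A := rank1 l v).
  move=> x; rewrite /= /rank1 !lX.
  transitivity (l x *: F a1 (F a2 v)); last by rewrite Fv scaler0.
  transitivity (orb (a3 * (a3 * l x)) (a3 * l x) (l x) v).
    by rewrite /orb !linearZ /= [LHS]addrC [X in _ + X]addrC addrA.
  rewrite FFE orbZ; congr orb.
  - suff -> : a1 * a2 = a3 * a3 by ring.
    apply/eqP; rewrite -subr_eq0; apply/eqP.
    transitivity (a1 * a2 + a1 * a3 + a2 * a3 - a3 * (a1 + a2 + a3)); first by ring.
    by rewrite s1 s2 mulr0 subrr.
  - suff -> : a3 = - (a1 + a2) by ring.
    by apply/eqP; rewrite -addr_eq0 addrC s1.
  - by rewrite mulr1.
have FH b z : F b (H z) = H (F b z) + l z *: v.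
  have -> : l z *: v = X (H z) - H (X z) by rewrite -HP.
  by rewrite linearB [H (b *: z)]linearZ /= [RHS]addrC addrA subrK.
have lF z : l (F a3 z) = 0 by rewrite linearB linearZ /= lX subrr.
have [w1 E1] := div w; have [w2 E2] := div (H w).
apply: (nv (w2 - H w1)); rewrite scalerBr -E2 -[p *: H w1]linearZ -E1.
rewrite (FH a3) lw scale1r linearD scalerDr opprD addrACA (FH a2) lF scale0r addr0.
by rewrite [RHS]addrC addKr.
Qed.

Section Cyclic.
Hypothesis indec : forall eps : {linear V -> V},
  (forall v, eps (X v) = X (eps v)) -> (forall v, eps (eps v) = eps v) ->
  (forall v, eps v = 0) \/ (forall v, eps v = v).

(** The values [c0], [c1], [c2] of [l] on the orbit of [w] sum to 1, so their circulant determinant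
    [D] is 1 modulo 3, hence a unit. This allows [w] to be replaced by a combination [u] of its
    orbit with [l u = 1] and [l (X u) = l (X (X u)) = 0]. *)
Lemma cyclic3 w : (forall x, w + X w + X (X w) <> p *: x) -> divides p 3%:R ->
  exists u, is_basis (fun i : 'I_3 => tnth [tuple u; X u; X (X u)] i).
Proof.
move=> nw p3.
have [l [_ lw]] := separating_functional unif tf (phi := idfun) fg nw.
pose c0 := l w; pose c1 := l (X w); pose c2 := l (X (X w)).
have c012 : c0 + c1 + c2 = 1 by rewrite -lw !linearD.
pose D := c0 ^+ 3 + c1 ^+ 3 + c2 ^+ 3 - 3%:R * c0 * c1 * c2.
have DU : D \is a GRing.unit.
  have -> : D = 1 + 3%:R * (- (c0 * c1 + c0 * c2 + c1 * c2)).
    have -> : c2 = 1 - c0 - c1 by rewrite -c012; ring.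
    by rewrite /D; have -> : c2 = 1 - c0 - c1 by [rewrite -c012; ring]; ring.
  apply: (dvr_unit_addl unif); first exact: unitr1.
  by have [z ->] := p3; exists (z * - (c0 * c1 + c0 * c2 + c1 * c2)); rewrite mulrA.
(* Cramer's rule for the circulant system that prescribes the values of [l] on the orbit of [u]. *)
pose u := orb ((c0 ^+ 2 - c1 * c2) / D) ((c1 ^+ 2 - c0 * c2) / D)
              ((c2 ^+ 2 - c0 * c1) / D) w.
have l0 : l u = 1.
  rewrite orb_scalar -/c0 -/c1 -/c2 -[RHS](divrr DU) /D; ring.
have l1 : l (X u) = 0.
  rewrite orbX orb_scalar -/c0 -/c1 -/c2; ring.
have l2 : l (X (X u)) = 0.
  rewrite !orbX orb_scalar -/c0 -/c1 -/c2; ring.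
(* The functionals dual to [u], [X u], [X (X u)] are [l], [l X^2], [l X]; so [e] is the equivariant
   projector onto the orbit. *)
pose e x := orb (l x) (l (X (X x))) (l (X x)) u.
have le : linear e.
  move=> a x y; rewrite /e !linearP /= orbZ orbD; by [].
pose eps : {linear V -> V} := HB.pack e (GRing.isLinear.Build O V V _ e le).
have epsE x : eps x = orb (l x) (l (X (X x))) (l (X x)) u by [].
have eX x : eps (X x) = X (eps x) by rewrite /= /e orbX X3.
have eu : eps u = u by rewrite /= /e l0 l1 l2 -orb1.
have eorb a0 a1 a2 x : eps (orb a0 a1 a2 x) = orb a0 a1 a2 (eps x).
  by rewrite [in LHS]/orb !(linearD, linearZ) !eX.
have [||e0|e1] := indec (eps := eps) => //.
- by move=> v; rewrite {1}(epsE v) eorb eu -epsE.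
- have /eqP : l u = 0 by rewrite -eu e0 linear0.
  by rewrite l0 oner_eq0.
have sumE c : \sum_(i < 3) c i *: tnth [tuple u; X u; X (X u)] i =
    orb (c ord0) (c (lift ord0 ord0)) (c (lift ord0 (lift ord0 ord0))) u.
  by rewrite !big_ord_recl big_ord0 addr0 addrA.
exists u; split=> [v|c].
  exists (fun i => tnth [tuple l v; l (X (X v)); l (X v)] i).
  by rewrite sumE -[LHS]e1.
rewrite sumE => E.
have h0 : c ord0 = 0.
  by move/(congr1 l): E; rewrite orb_scalar l0 l1 l2 linear0 !mulr0 !addr0 mulr1.
have h2 : c (lift ord0 (lift ord0 ord0)) = 0.
  move/(congr1 X)/(congr1 l): E; rewrite orbX orb_scalar l0 l1 l2 !linear0.
  by rewrite !mulr0 !addr0 mulr1.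
have h1 : c (lift ord0 ord0) = 0.
  move/(congr1 X)/(congr1 X)/(congr1 l): E; rewrite !orbX orb_scalar l0 l1 l2.
  by rewrite !linear0 !mulr0 !addr0 mulr1.
move=> i; case: (unliftP ord0 i) => [j ->|->//].
case: (unliftP ord0 j) => [k ->|->//].
by rewrite [k]ord1.
Qed.

(** Here [X - a2] satisfies [F^2 = d F] with [d] divisible by [p]. From [l (F w) = 1] one passes to
    [u] with [l u = 0] and [l (F u) = 1], after dividing by [al], which is 1 modulo [p]; [eps] is
    then the equivariant projector onto the span of [u] and [F u]. *)
Lemma cyclic2 a1 a2 w : (forall v, F a1 (F a2 v) = 0) -> divides p (a1 - a2) ->
  (forall x, F a2 w <> p *: x) ->
  exists u, is_basis (fun i : 'I_2 => tnth [tuple u; F a2 u] i).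
Proof.
move=> F12 pd nw; set d := a1 - a2 in pd.
have FF v : F a2 (F a2 v) = d *: F a2 v.
  by rewrite (FB a2 a1 (F a2 v)) F12 add0r.
have [l [_ lw]] := separating_functional unif tf (phi := idfun) fg nw.
have {}lw : l (F a2 w) = 1 by [].
pose b := l w; pose al := 1 - d * b.
have alU : al \is a GRing.unit.
  apply: (dvr_unit_addl unif); first exact: unitr1.
  by have [z ->] := pd; exists (- (z * b)); rewrite mulrN mulrA.
pose u := al^-1 *: (w - b *: F a2 w).
have Fu : F a2 u = F a2 w.
  rewrite /u FZ; have -> : F a2 (w - b *: F a2 w) = al *: F a2 w.
    rewrite -FlinE linearB linearZ /= -/(Flin _ _) -!FlinE.
    by rewrite [Flin a2 (Flin a2 w)]FF scalerA /al scalerBl scale1r mulrC.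
  by rewrite scalerA mulVr // scale1r.
have lu : l u = 0.
  by rewrite /u linearZ linearB linearZ /= lw mulr1 subrr mulr0.
have lFu : l (F a2 u) = 1 by rewrite Fu.
clearbody u.
pose e v := (l (F a2 v) - d * l v) *: u + l v *: F a2 u.
have le : linear e.
  move=> a x y; rewrite /e FP; move: (F a2 u) => y'; rewrite !(linearP l) /=.
  rewrite scalerDr !scalerA [RHS]addrACA -!scalerDl.
  by congr (_ *: _ + _ *: _); ring.
pose eps : {linear V -> V} := HB.pack e (GRing.isLinear.Build O V V _ e le).
have epsE v : eps v = (l (F a2 v) - d * l v) *: u + l v *: F a2 u by [].
have eF v : eps (F a2 v) = F a2 (eps v).
  rewrite !epsE FF linearZ subrr scale0r add0r.
  rewrite FP FZ FF scalerA -scalerDl; congr (_ *: _); ring.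
have eu : eps u = u by rewrite epsE lu lFu mulr0 subr0 scale1r scale0r addr0.
have [||e0|e1] := indec (eps := eps).
- have XF v : X v = F a2 v + a2 *: v by rewrite subrK.
  by move=> v; rewrite [X v]XF linearD eF [eps (a2 *: v)]linearZ -XF.
- move=> v; rewrite {1}(epsE v) linearD [eps (_ *: u)]linearZ.
  by rewrite [eps (_ *: F a2 u)]linearZ eF eu -epsE.
- have /eqP : l (F a2 u) = 0 by rewrite -eu -eF e0 linear0.
  by rewrite lFu oner_eq0.
exists u; split=> [v|c].
  exists (fun i => tnth [tuple l (F a2 v) - d * l v; l v] i).
  by rewrite !big_ord_recl big_ord0 addr0 -[LHS]e1.
rewrite !big_ord_recl big_ord0 addr0 /= !(tnth_nth 0) /= => E.
have h1 : c (lift ord0 ord0) = 0.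
  move/(congr1 l): E; rewrite linearP [l (_ *: F a2 u)]linearZ /= lu lFu.
  by rewrite linear0 mulr0 add0r mulr1.
move: E; rewrite h1 scale0r addr0 => E.
have h0 : c ord0 = 0.
  move/(congr1 (Flin a2))/(congr1 l): E.
  by rewrite /= FZ F0 linearZ /= lFu linear0 mulr1.
move=> i; case: (unliftP ord0 i) => [j ->|->//].
by rewrite [j]ord1.
Qed.

Lemma cyclic1 a : (forall v, F a v = 0) -> (exists v : V, v <> 0) ->
  exists u : V, is_basis (fun i : 'I_1 => u).
Proof.
move=> Fa [v0 v00].
have [w [_ nw]] := @not_divisible_image idfun (fun=> True) v0 v00 I (fun _ _ _ _ => I).
have [l [_ lw]] := separating_functional unif tf (phi := idfun) fg nw.
pose eps : {linear V -> V} := rank1 l w.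
have Xv v : X v = a *: v by apply/eqP; rewrite -subr_eq0 Fa.
have [||e0|e1] := indec (eps := eps).
- by move=> v; rewrite !Xv linearZ.
- by move=> v; rewrite /= /rank1 linearZ /= lw mulr1.
- by case: (nw 0); rewrite scaler0 -(e0 w) /= /rank1 lw scale1r.
exists w; split=> [v|c]; first by exists (fun=> l v); rewrite big_ord1 -[LHS]e1.
rewrite big_ord1 => /(congr1 l); rewrite linearZ linear0 /= lw mulr1 => c0 i.
by rewrite [i]ord1.
Qed.

(** The cases are the nonempty sets of cube roots of unity that occur as eigenvalues: one gives a
    scalar, two give [cyclic2], all three give [cyclic3]. The identity [(1 - zeta)^2 = - 3 zeta]
    shows that the roots agree modulo [p]. *)
Lemma classification (zeta : O) : zeta ^+ 2 + zeta + 1 = 0 -> zeta <> 1 ->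
  3%:R != 0 :> O -> divides p 3%:R -> (exists v : V, v <> 0) ->
  [\/ (forall v, X v = v) /\ exists u : V, is_basis (fun i : 'I_1 => u),
      exists b, [/\ b ^+ 2 + b + 1 = 0, forall v, X v = b *: v
                  & exists u : V, is_basis (fun i : 'I_1 => u)],
      exists b, [/\ b ^+ 2 + b + 1 = 0, forall v, F 1 (F b v) = 0
                  & exists u, is_basis (fun i : 'I_2 => tnth [tuple u; F b u] i)]
    | (exists b, (forall v, X (X v) + X v + v = 0) /\
                exists u, is_basis (fun i : 'I_2 => tnth [tuple u; F b u] i)) \/
      exists u, is_basis (fun i : 'I_3 => tnth [tuple u; X u; X (X u)] i)].
Proof.
move=> z0 z1 n3 p3 V0; have [zeta2 zz] : exists z, zeta * zeta = z by exists (zeta * zeta).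
have z2E : zeta2 = - (zeta + 1) by apply/eqP; rewrite -addr_eq0 addrA -zz -expr2 z0.
have zz2 : zeta * zeta2 = 1.
  by rewrite z2E -[RHS]subr0 -z0; ring.
have z2z2 : zeta2 * zeta2 = zeta by rewrite -{1}zz -mulrA zz2 mulr1.
have z20 : zeta2 ^+ 2 + zeta2 + 1 = 0 by rewrite expr2 z2z2 -z0 -zz; ring.
have z12 : zeta2 <> 1.
  by move=> E; apply: z1; rewrite -z2z2 E mulr1.
have zz2n : zeta <> zeta2.
  move=> E; move: zz2 z0; rewrite -E zz -E => z11; case: z1; exact: z11.
have sq : (1 - zeta) ^+ 2 = 3%:R * - zeta.
  apply/eqP; rewrite -subr_eq0; apply/eqP.
  by transitivity (zeta ^+ 2 + zeta + 1); [ring | rewrite z0].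
have d1z : divides p (1 - zeta).
  apply: contrapT => /(dvr_unit unif) U; have /negP[] := p_nonunit.
  have [t E] := p3; have : (1 - zeta) ^+ 2 \is a GRing.unit by rewrite unitrX.
  by rewrite sq E -mulrA unitrM => /andP [].
have [t tE] := d1z.
have r123 : cube_roots p 1 zeta zeta2.
  split; [by rewrite z2E; ring | | by rewrite mul1r zz2 | | exact: d1z].
    by rewrite zz2 -z0 !mul1r -zz; ring.
  by split; [move/esym | move/esym | ].
have dz2z : divides p (zeta2 - zeta).
  by exists (- (t * zeta)); rewrite mulrN mulrA -tE -zz; ring.
have dz12 : divides p (1 - zeta2).
  by exists (t * (1 + zeta)); rewrite mulrA -tE -zz; ring.
have r132 : cube_roots p 1 zeta2 zeta.
  case: r123 => s1 s2 s3 [h1 h2 h3] _; split => //.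
  - by rewrite -[RHS]s1; ring.
  - by rewrite -[RHS]s2; ring.
  - by rewrite -[RHS]s3; ring.
  - by split=> //; apply: not_eq_sym.
have r231 : cube_roots p zeta2 zeta 1.
  case: r123 => s1 s2 s3 [h1 h2 h3] _; split => //.
  - by rewrite -[RHS]s1; ring.
  - by rewrite -[RHS]s2; ring.
  - by rewrite -[RHS]s3; ring.
  - by split=> //; apply: not_eq_sym.
have r213 : cube_roots p zeta 1 zeta2.
  case: r123 => s1 s2 s3 [h1 h2 h3] _; split => //.
  - by rewrite -[RHS]s1; ring.
  - by rewrite -[RHS]s2; ring.
  - by rewrite -[RHS]s3; ring.
  - by exists (- t); rewrite mulrN -tE opprB.
pose occ a := exists u, F a u = 0 /\ u <> 0.
have inj a v : ~ occ a -> F a v = 0 -> v = 0.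
  by move=> no Fv; apply: contrapT => v0; apply: no; exists v.
have two a1 a2 a3 : cube_roots p a1 a2 a3 -> occ a1 -> occ a2 -> ~ occ a3 ->
    (forall v, F a1 (F a2 v) = 0) /\
    exists u, is_basis (fun i : 'I_2 => tnth [tuple u; F a2 u] i).
  move=> aP [u1 [Fu1 u10]] [u2 [Fu2 u20]] no3.
  have F12 v : F a1 (F a2 v) = 0.
    by apply: (inj a3) => //; rewrite (FC a3) (FC a3) F3.
  split=> //; have [_ _ _ [a12 _ _] pd] := aP.
  have [|v [_ nv]] := classify_step aP Fu1 u10 (F12 u2).
    by rewrite (FB a1 a2) Fu2 add0r => /(tfZ (sub_neq0 (not_eq_sym a12))).
  exact: cyclic2 F12 pd nv.
have one a1 a2 a3 : cube_roots p a1 a2 a3 -> ~ occ a2 -> ~ occ a3 ->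
    (forall v, F a1 v = 0) /\ exists u : V, is_basis (fun i : 'I_1 => u).
  move=> aP no2 no3.
  have F1 v : F a1 v = 0.
    apply: (inj a3) => //; apply: (inj a2) => //.
    by rewrite (FC a3) (FC a2) F3.
  by split=> //; exact: cyclic1 F1 V0.
have XE a : (forall v, F a v = 0) -> forall v, X v = a *: v.
  by move=> Fa v; apply/eqP; rewrite -subr_eq0 Fa.
have [o1|n1] := pselect (occ 1); have [o2|n2] := pselect (occ zeta);
  have [o3|n3'] := pselect (occ zeta2).
- constructor 4; right; case: o1 o2 o3 => [u1 h1] [u2 h2] [u3 h3].
  have [w nw] := classify3 r123 h1 h2 h3.
  apply: (cyclic3 (w := w)) p3 => x E; apply: (nw x); rewrite -E FFE zz2 z2E.
  by rewrite (_ : - (zeta - (zeta + 1)) = 1); [rewrite /orb !scale1r | ring].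
- by constructor 3; exists zeta; have [? ?] := two _ _ _ r123 o1 o2 n3'.
- by constructor 3; exists zeta2; have [? ?] := two _ _ _ r132 o1 o3 n2.
- constructor 1; have [F1 ?] := one _ _ _ r123 n2 n3'; split=> // v.
  by rewrite (XE _ F1) scale1r.
- constructor 4; left; exists zeta; have [F1 ?] := two _ _ _ r231 o3 o2 n1; split=> // v.
  rewrite -[RHS](F1 v) FFE mulrC zz2 z2E (_ : - (- (zeta + 1) + zeta) = 1); last by ring.
  by rewrite /orb !scale1r [LHS]addrC [X in _ + X = _]addrC addrA.
- constructor 2; exists zeta.
  have [F1 ?] := one _ _ _ r213 n1 n3'; split=> //; exact: XE.
- constructor 2; exists zeta2.
  have [F1 ?] := one _ _ _ r231 n2 n1; split=> //; exact: XE.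
- case: V0 => v v0; case: v0; apply: (inj zeta2) => //; apply: (inj zeta) => //.
  by apply: (inj 1) => //; rewrite F3.
Qed.

End Cyclic.

End Classification.

Section KernelModule.
Variables (R : comNzRingType) (M : lmodType R) (f : {linear M -> M}).

Definition in_ker : {pred M} := fun v => f v == 0.

Lemma in_ker_submod : submod_closed in_ker.
Proof.
split=> [|a u v]; rewrite !unfold_in ?linear0 // => /eqP fu /eqP fv.
by rewrite linearP fu fv scaler0 addr0.
Qed.

HB.instance Definition _ := GRing.isSubmodClosed.Build R M in_ker in_ker_submod.

Record kernel : Type := Kernel { kernel_val :> M; _ : kernel_val \in in_ker }.

HB.instance Definition _ := [isSub for kernel_val].
HB.instance Definition _ := [Choice of kernel by <:].
HB.instance Definition _ := [SubChoice_isSubLmodule of kernel by <:].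

End KernelModule.

(** The module is the direct sum of the kernels of [1 - eps] and [eps]. *)
Lemma indecomposable_idempotent (R : comNzRingType) (M : lmodType R)
  (eps : {linear M -> M}) : indecomposable M -> (forall v, eps (eps v) = eps v) ->
  (forall v, eps v = 0) \/ (forall v, eps v = v).
Proof.
move=> [_ ind] ee.
pose del : {linear M -> M} := idfun \- eps.
have k1 v : eps v \in in_ker del by rewrite unfold_in /= ee subrr.
have k2 v : v - eps v \in in_ker eps by rewrite unfold_in linearB ee subrr.
pose phi v : (kernel del * kernel eps)%type := (Kernel (k1 v), Kernel (k2 v)).
have lin : linear phi.
  move=> a u v; congr pair; apply: val_inj; rewrite /= (linearP eps) //.
  by rewrite scalerBr opprD addrACA.
pose Phi : {linear M -> (kernel del * kernel eps)%type} :=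
  HB.pack phi (GRing.isLinear.Build R M _ _ phi lin).
have [|h|h] := ind _ _ Phi.
- exists (fun u : kernel del * kernel eps => (u.1 : M) + (u.2 : M)) => [v|[[u hu] [v hv]]].
    by rewrite /= addrC subrK.
  have /eqP Eu : u - eps u == 0 by exact: hu.
  have /eqP Ev : eps v == 0 by exact: hv.
  move/eqP: Eu; rewrite subr_eq0 => /eqP Eu.
  by congr pair; apply: val_inj; rewrite /= linearD -Eu Ev addr0 // addrC addKr.
- left=> v; exact: (congr1 (@kernel_val _ _ del) (h (Kernel (k1 v)))).
- right=> v; apply/eqP; rewrite eq_sym -subr_eq0; apply/eqP.
  exact: (congr1 (@kernel_val _ _ eps) (h (Kernel (k2 v)))).
Qed.

Lemma rV_projective (R : comNzRingType) n : projective ('rV[R]_n : lmodType R).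
Proof.
move=> M N p f psurj.
have /choice [m mP] (i : 'I_n) : exists m, p m = f (delta_mx 0 i) by exact: psurj.
pose h (c : 'rV[R]_n) := \sum_i c 0 i *: m i.
have lin : linear h.
  move=> a u v; rewrite /h scaler_sumr -big_split; apply: eq_bigr => i _.
  by rewrite !mxE scalerDl scalerA.
pose H : {linear 'rV[R]_n -> M} := HB.pack h (GRing.isLinear.Build R _ _ _ h lin).
exists H => v /=.
rewrite linear_sum [in RHS](row_sum_delta v) linear_sum; apply: eq_bigr => i _.
by rewrite !linearZ /= mP.
Qed.

(** * The group ring of a cyclic group of order three *)

Section GroupAlgebra.
Variables (O : comNzRingType) (gT : finGroupType) (abG : abelian [set: gT]).
Local Notation OG := (group_algebra O abG).
Local Notation gb := (gr_basis O abG).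

Lemma gbM g h : gb g * gb h = gb (g * h)%g.
Proof.
apply/ffunP => k; rewrite !ffunE (bigD1 g) //= ffunE eqxx mul1r big1 ?addr0.
  by rewrite ffunE -(inj_eq (mulgI g)) mulKVg.
by move=> i /negPf ig; rewrite ffunE ig mul0r.
Qed.

Lemma gb_sum (t : OG) : t = \sum_h t h *: gb h.
Proof.
apply/ffunP => k; rewrite sum_ffunE (bigD1 k) //= !ffunE eqxx.
rewrite [_ *: _]mulr1 big1 ?addr0 // => i /negPf ik.
by rewrite !ffunE eq_sym ik [_ *: _]mulr0.
Qed.

Definition augmentation (t : OG) : O := \sum_h t h.

Lemma augmentation_zmod : zmod_morphism augmentation.
Proof. by move=> a b; rewrite /augmentation -sumrB; apply: eq_bigr => h _; rewrite !ffunE. Qed.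

Lemma augmentation_monoid : monoid_morphism augmentation.
Proof.
split=> [|a b]; rewrite /augmentation.
  rewrite (bigD1 1%g) //= ffunE eqxx big1 ?addr0 // => h /negPf h1.
  by rewrite ffunE h1.
under eq_bigr => h _ do rewrite ffunE.
rewrite exchange_big mulr_suml; apply: eq_bigr => h _.
rewrite -mulr_sumr (reindex_inj (mulgI h)) /=; congr (_ * _).
by apply: eq_bigr => k _; rewrite mulKg.
Qed.

HB.instance Definition _ := GRing.isZmodMorphism.Build OG O augmentation
  augmentation_zmod.
HB.instance Definition _ := GRing.isMonoidMorphism.Build OG O augmentation
  augmentation_monoid.

Lemma augmentation_algebra (r : O) : augmentation (r%:A : OG) = r.
Proof.
rewrite /augmentation (bigD1 1%g) //= !ffunE eqxx [_ *: _]mulr1 big1 ?addr0 //.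
by move=> h /negPf h1; rewrite !ffunE h1 [_ *: _]mulr0.
Qed.

Variable g : gT.
Hypothesis gen_g : generator [set: gT] g.
Hypothesis card3 : #|[set: gT]| = 3%N.

Lemma order_g : #[g]%g = 3%N.
Proof. by rewrite -card3 (eqP gen_g). Qed.

Lemma g3 : (g ^+ 3 = 1)%g. Proof. by rewrite -order_g expg_order. Qed.

Local Notation x := (gb g).

Lemma x2E : x ^+ 2 = gb (g ^+ 2)%g. Proof. by rewrite expr2 gbM expgS expg1. Qed.

Lemma x3 : x ^+ 3 = 1.
Proof. by rewrite exprS x2E gbM -expgS g3. Qed.

Lemma big_cyclic3 (U : nmodType) (F : gT -> U) :
  \sum_h F h = F 1%g + F g + F (g ^+ 2)%g.
Proof.
have g1 : g != 1%g by rewrite -order_eq1 order_g.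
have gg1 : (g ^+ 2 != 1)%g by rewrite -order_dvdn order_g.
have ggg : (g ^+ 2 != g)%g by rewrite expgS expg1 -[X in _ != X]mulg1 (inj_eq (mulgI g)).
rewrite (bigD1 1%g) //= (bigD1 g) //= (bigD1 (g ^+ 2)%g) ?gg1 //= big1 ?addr0 ?addrA //.
move=> h /andP [/andP [h1 hg] hgg]; have : h \in <[g]>%g by rewrite -(eqP gen_g) inE.
rewrite cycle_traject order_g /= !inE mulg1 (negPf h1) (negPf hg) /=.
by move: hgg; rewrite expgS expg1 => /negPf ->.
Qed.

Lemma group_algebra_cyclic3 (t : OG) : exists a b c,
  t = a%:A + b *: x + c *: x ^+ 2 /\ augmentation t = a + b + c.
Proof.
exists (t 1%g), (t g), (t (g ^+ 2)%g); rewrite x2E; split; last exact: big_cyclic3.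
by rewrite {1}(gb_sum t) big_cyclic3.
Qed.

Lemma group_algebra_cyclic3_inj a b c a' b' c' :
  a%:A + b *: x + c *: x ^+ 2 = a'%:A + b' *: x + c' *: x ^+ 2 :> OG ->
  [/\ a = a', b = b' & c = c'].
Proof.
have g1 : g != 1%g by rewrite -order_eq1 order_g.
have gg1 : (g ^+ 2 != 1)%g by rewrite -order_dvdn order_g.
have ggg : (g ^+ 2 != g)%g by rewrite expgS expg1 -[X in _ != X]mulg1 (inj_eq (mulgI g)).
rewrite x2E => /ffunP E.
have := E 1%g; have := E g; have := E (g ^+ 2)%g.
rewrite !ffunE !eqxx (negPf g1) (negPf gg1) (negPf ggg).
rewrite ![1%g == _]eq_sym ![g == (g ^+ 2)%g]eq_sym (negPf g1) (negPf gg1) (negPf ggg).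
rewrite ![_ *: true%:R]mulr1 ![_ *: false%:R]mulr0 !(add0r, addr0).
by move=> -> -> ->.
Qed.

End GroupAlgebra.

Section Act.
Variables (O : comNzRingType) (T : comAlgType O) (x : T) (M : lmodType T).

Definition act (v : restrict M) : restrict M := x *: (v : M).

Lemma restrictZ r (v : restrict M) : r *: v = (r%:A : T) *: (v : M) :> M.
Proof. by []. Qed.

Lemma act_linear : linear act.
Proof.
move=> a u v; rewrite /act [in LHS]scalerDr; congr (_ + _).
by rewrite !restrictZ !scalerA mulrC.
Qed.

HB.instance Definition _ :=
  GRing.isLinear.Build O (restrict M) (restrict M) _ act act_linear.

End Act.

Section Link.
Variables (O : idomainType) (p : O).
Hypothesis unif : uniformizer p.
Variables (gT : finGroupType) (abG : abelian [set: gT]) (g : gT).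
Hypothesis gen_g : generator [set: gT] g.
Hypothesis card3 : #|[set: gT]| = 3%N.
Local Notation OG := (group_algebra O abG).
Local Notation x := (gr_basis O abG g).
Variable M : lmodType OG.
Local Notation V := (restrict M).

Local Notation actg := (@act O OG x M).

Lemma actg3 v : actg (actg (actg v)) = v.
Proof. by rewrite /act !scalerA -mulrA -expr2 -exprS (x3 O abG gen_g card3) scale1r. Qed.

Lemma scale_cyclic3 a b c (v : M) :
  (a%:A + b *: x + c *: x ^+ 2 : OG) *: v =
  a *: (v : V) + b *: actg v + c *: actg (actg v) :> V.
Proof.
rewrite !scalerDl; congr (_ + _ + _); rewrite /act restrictZ !scalerA.
  by rewrite mulr_algl.
by rewrite -mulrA mulr_algl expr2.
Qed.

Lemma restrict_finitely_generated : finitely_generated M -> finitely_generated V.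
Proof.
move=> [n [s sP]].
pose t (i : 'I_n * 'I_3) : V := iter i.2 actg (s i.1).
exists #|{: 'I_n * 'I_3}|, (fun k => t (enum_val k)) => v.
have [c ->] := sP v.
have dec i : exists d : 'I_3 -> O, c i *: s i = \sum_(k < 3) d k *: (t (i, k)) :> V.
  have [a0 [a1 [a2 [E _]]]] := group_algebra_cyclic3 gen_g card3 (c i).
  exists (fun k => tnth [tuple a0; a1; a2] k).
  by rewrite E scale_cyclic3 !big_ord_recl big_ord0 addr0 addrA.
have /choice [e eP] := dec.
exists (fun k => e (enum_val k).1 (enum_val k).2).
transitivity (\sum_i \sum_(k < 3) e i k *: t (i, k) : V); first exact: eq_bigr.
rewrite pair_bigA /= (reindex (@enum_val _ (mem {: 'I_n * 'I_3}))) /=.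
  by apply: eq_bigr => k _; case: (enum_val k).
by apply: onW_bij; exact: enum_val_bij.
Qed.

Lemma restrict_indecomposable : indecomposable M ->
  forall eps : {linear V -> V}, (forall v, eps (actg v) = actg (eps v)) ->
  (forall v, eps (eps v) = eps v) ->
  (forall v, eps v = 0) \/ (forall v, eps v = v).
Proof.
move=> ind eps eX ee.
have lin : linear (eps : M -> M).
  move=> t u v; have [a [b [c [-> _]]]] := group_algebra_cyclic3 gen_g card3 t.
  rewrite (scale_cyclic3 a b c u) (scale_cyclic3 a b c (eps u)).
  have -> := raddfD eps (a *: (u : V) + b *: actg u + c *: actg (actg u)) v.
  have E (w : V) : eps (a *: w + b *: actg w + c *: actg (actg w)) =
      a *: eps w + b *: actg (eps w) + c *: actg (actg (eps w)) :> V.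
    by rewrite !linearD !linearZ !eX.
  exact: (congr1 (fun w : V => w + eps v) (E u)).
exact: (@indecomposable_idempotent _ M
  (HB.pack_for {linear M -> M} (eps : M -> M)
     (GRing.isLinear.Build OG M M _ (eps : M -> M) lin)) ind ee).
Qed.

Lemma divides_prime : is_prime (divides p).
Proof.
have [p0 pU pP] := unif; split.
- split=> [|a b [y ->] [z ->]|a b [y ->]].
  + by exists 0; rewrite mulr0.
  + by exists (y + z); rewrite mulrDr.
  + by exists (a * y); rewrite mulrCA.
- by move=> [y E]; case/negP: pU; apply/unitrPr; exists y.
- move=> a b [y E]; apply: contrapT => /not_orP [/(dvr_unit unif) aU /(dvr_unit unif) bU].
  by case/negP: pU; have := unitrM a b; rewrite aU bU E unitrM => /andP [].
Qed.

(** The preimages of [0] and [(p)] under the augmentation. The dimension is therefore positive, and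
    so is the depth of a maximal Cohen-Macaulay module. *)
Lemma group_algebra_prime_chain : @prime_chain OG 1.
Proof.
have [p0 pU pP] := unif.
have aug_prime I := @is_prime_preim _ _ (@augmentation O gT abG : {rmorphism OG -> O}) I.
have zero_prime : is_prime (fun a : O => a = 0).
  split; [split=> [//|a b -> ->|a b ->] | | ]; rewrite ?addr0 ?mulr0 //.
    by move/eqP; rewrite oner_eq0.
  by move=> a b /eqP; rewrite mulf_eq0 => /orP [] /eqP; [left | right].
have [i0 i01 i0P] := aug_prime _ zero_prime.
have [i1 i11 i1P] := aug_prime _ divides_prime.
have [q0 q0P] := prime_idealr_of i0 i01 i0P.
have [q1 q1P] := prime_idealr_of i1 i11 i1P.
exists (fun i => if i is 0%N then q0 else q1) => -[|//] _; split.
  by move=> t /q0P t0; apply/q1P; exists 0; rewrite t0 mulr0.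
move=> sub; have /q0P : (p%:A : OG) \in q0.
  by apply: sub; apply/q1P; rewrite /= augmentation_algebra; exists 1; rewrite mulr1.
by rewrite /= augmentation_algebra; move/eqP: p0.
Qed.

(** The preimage of [(p)] under the augmentation is maximal: an ideal that contains it and an
    element of unit augmentation contains a unit constant. *)
Lemma group_algebra_maximal (m : idealr OG) : local_with m ->
  forall t, t \in m -> divides p (augmentation t).
Proof.
move=> [_ mm] t tm.
have aug_prime I := @is_prime_preim _ _ (@augmentation O gT abG : {rmorphism OG -> O}) I.
have [i1 i11 _] := aug_prime _ divides_prime.
have [q qP] := idealr_of i1 i11.
apply/qP; rewrite (mm q) // => J qJ s sJ; apply/qP; apply: contrapT.
move/(dvr_unit unif) => sU.
have d0 : s - (augmentation s)%:A \in J.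
  apply: qJ; apply/qP; rewrite rmorphB /= augmentation_algebra subrr.
  by exists 0; rewrite mulr0.
have : (augmentation s)%:A \in J by rewrite -[X in X \in _](subKr s) rpredB.
move/(idealMr ((augmentation s)^-1%:A)).
by rewrite mulr_algl scalerA mulVr // scale1r idealr1.
Qed.

Hypothesis p3 : divides p 3%:R.

(** Cubing is additive modulo 3 and [x^3 = 1], so modulo [p] the cube of [t] is the cube of its
    augmentation. *)
Lemma augmentation_cube (t : OG) : divides p (augmentation t) ->
  exists z, t ^+ 3 = p%:A * z.
Proof.
have [a [b [c [-> ->]]]] := group_algebra_cyclic3 gen_g card3 t.
move=> [s E]; have [u E3] := p3.
have xx3 := x3 O abG gen_g card3.
pose y := b *: x; pose w := c *: x ^+ 2.
have y3 : y ^+ 3 = (b ^+ 3)%:A by rewrite exprZn xx3.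
have w3 : w ^+ 3 = (c ^+ 3)%:A by rewrite exprZn -exprM mulnC exprM xx3 expr1n.
have A3 : (a%:A : OG) ^+ 3 = (a ^+ 3)%:A by rewrite exprZn expr1n.
pose k : O := (a + b) * (b + c) * (c + a).
exists ((p ^+ 2 * s ^+ 3 - u * k)%:A + u%:A * (a%:A + y) * (y + w) * (w + a%:A)).
have E3' : (3%:R : OG) = p%:A * u%:A.
  by rewrite -scalerAl mul1r scalerA -E3 -scaler_nat scaler_nat -mulr_natr mul1r.
have -> : (a%:A + y + w) ^+ 3 =
    a%:A ^+ 3 + y ^+ 3 + w ^+ 3 + 3%:R * ((a%:A + y) * (y + w) * (w + a%:A)).
  by ring.
rewrite A3 y3 w3 -!scalerDl.
have -> : a ^+ 3 + b ^+ 3 + c ^+ 3 = p * (p ^+ 2 * s ^+ 3 - u * k).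
  rewrite mulrBr mulrA -exprS -exprMn -E mulrA -E3 /k; ring.
by rewrite E3' [RHS]mulrDr; congr (_ + _); [rewrite mulr_algl scalerA | rewrite !mulrA].
Qed.

(** Some [y] in the maximal ideal is regular on [M], and [y^3] is a multiple of [p], so [p] is
    regular on [M] as well. *)
Lemma restrict_torsion_free : maximal_cohen_macaulay M -> torsion_free V.
Proof.
move=> [_ [m [d [mloc [_ dmax] [[xs [xsm [reg _]] sz] _]]]]].
have d1 : (0 < d)%N by apply: dmax; exact: group_algebra_prime_chain.
case: xs => [|y xs] in xsm reg sz; first by rewrite -sz in d1.
have yreg (v : M) : y *: v = 0 -> v = 0.
  move=> yv; have [|w ->] := reg 0%N isT v; last by rewrite big_ord0.
  by exists (fun=> 0); rewrite yv big_ord0.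
have [|z zE] := @augmentation_cube y.
  by apply: (group_algebra_maximal mloc); apply: xsm; exact: mem_head.
have preg (v : V) : p *: v = 0 -> v = 0.
  move=> pv; apply: (yreg); apply: (yreg); apply: (yreg).
  by rewrite !scalerA -mulrA -expr2 -exprS zE mulrC -scalerA -restrictZ pv scaler0.
move=> a v av; have [a0|a0] := eqVneq a 0; [by left | right].
have [_ _ pP] := unif; have [u [k [uU aE]]] := pP a a0.
have : p ^+ k *: v = 0.
  by rewrite -[LHS]scale1r -(mulVr uU) -scalerA [u *: _]scalerA -aE av scaler0.
elim: k {aE} => [|k IH]; first by rewrite scale1r.
by rewrite exprS -scalerA => /preg.
Qed.

End Link.

Lemma torsion_free_basis (O : idomainType) (p : O) (V : lmodType O) :
  uniformizer p -> torsion_free V -> finitely_generated V ->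
  exists n (e : 'I_n -> V), is_basis e.
Proof.
move=> unif tf [n [s sP]]; have [m [t [ti st ts]]] := independent_span unif tf s.
exists m, t; split=> // v; have [a ->] := sP v.
have /choice [b bP] i := st i.
exists (fun k => \sum_i a i * b i k).
under eq_bigr => i _ do rewrite bP scaler_sumr.
rewrite exchange_big; apply: eq_bigr => k _; rewrite scaler_suml.
by apply: eq_bigr => i _; rewrite scalerA.
Qed.

Section Rigid.
Variables (O : comNzRingType) (T : comAlgType O) (x : T).
Hypothesis x3 : x ^+ 3 = 1.
Hypothesis dec : forall t : T, exists a b c, t = a%:A + b *: x + c *: x ^+ 2.
Hypothesis dec_inj : forall a b c a' b' c',
  a%:A + b *: x + c *: x ^+ 2 = a'%:A + b' *: x + c' *: x ^+ 2 :> T ->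
  [/\ a = a', b = b' & c = c'].
Variable M : lmodType T.
Local Notation V := (restrict M).
Local Notation X := (@act O T x M).

Variables (n : nat) (e : 'I_n -> V).
Hypothesis eB : is_basis e.
Hypothesis rigM : rigid M.

Lemma coordinates : exists co : {linear V -> 'rV[O]_n},
  (forall v, v = \sum_i co v 0 i *: e i) /\
  forall c : 'rV[O]_n, co (\sum_i c 0 i *: e i) = c.
Proof.
have [span ind] := eB; have /choice [co coP] := span.
pose h v : 'rV[O]_n := \row_i co v i.
have uniq (c d : 'I_n -> O) : \sum_i c i *: e i = \sum_i d i *: e i ->
    forall i, c i = d i.
  move=> E i; apply/eqP; rewrite -subr_eq0; apply/eqP.
  apply: (ind (fun k => c k - d k)).
  rewrite -[RHS](subrr (\sum_k c k *: e k)) {2}E -sumrB.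
  by apply: eq_bigr => k _; rewrite scalerBl.
have lin : linear h.
  move=> a u v; apply/rowP => i; rewrite !mxE.
  apply: (uniq _ (fun i => a * co u i + co v i)); rewrite -coP {1}(coP u) {1}(coP v).
  rewrite scaler_sumr -big_split; apply: eq_bigr => k _.
  by rewrite scalerDl scalerA.
pose H : {linear V -> 'rV[O]_n} := HB.pack h (GRing.isLinear.Build O V _ _ h lin).
exists H; split=> [v|c].
  by rewrite {1}(coP v); apply: eq_bigr => i _; rewrite mxE.
by apply/rowP => i; rewrite mxE; apply: uniq; rewrite -coP.
Qed.

Let al : {rmorphism O -> T} := in_alg T.

Lemma row_cyclic3E (c0 c1 c2 : 'rV[O]_n) i :
  (map_mx al c0 + x *: map_mx al c1 + x ^+ 2 *: map_mx al c2) 0 i =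
  (c0 0 i)%:A + c1 0 i *: x + c2 0 i *: x ^+ 2.
Proof.
rewrite 2!mxE [map_mx al c0 0 i]mxE; congr (_ + _ + _).
  by rewrite mxE [map_mx al c1 0 i]mxE mulrC mulr_algl.
by rewrite mxE [map_mx al c2 0 i]mxE mulrC mulr_algl.
Qed.

Lemma row_cyclic3 (c : 'rV[T]_n) : exists c0 c1 c2 : 'rV[O]_n,
  c = map_mx al c0 + x *: map_mx al c1 + x ^+ 2 *: map_mx al c2.
Proof.
have /choice [a aP] i := dec (c 0 i).
have /choice [b bP] := aP; have /choice [d dP] := bP.
exists (\row_i a i), (\row_i b i), (\row_i d i); apply/rowP => i.
by rewrite dP row_cyclic3E !mxE.
Qed.

Lemma row_cyclic3_inj (c0 c1 c2 d0 d1 d2 : 'rV[O]_n) :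
  map_mx al c0 + x *: map_mx al c1 + x ^+ 2 *: map_mx al c2 =
  map_mx al d0 + x *: map_mx al d1 + x ^+ 2 *: map_mx al d2 ->
  [/\ c0 = d0, c1 = d1 & c2 = d2].
Proof.
move/rowP => E.
have H i : [/\ c0 0 i = d0 0 i, c1 0 i = d1 0 i & c2 0 i = d2 0 i].
  apply: dec_inj.
  by rewrite -!row_cyclic3E; exact: E.
by split; apply/rowP => i; have [] := H i.
Qed.

(* A basis of [M] over [O] gives the start [T^n -> T^n -> T^n -> M -> 0] of   *)
(* a free resolution, with differentials [x - Phi] and                        *)
(* [x^2 + x Phi + Phi^2], where [Phi] is the matrix of the action of [x].     *)
Lemma restrict_rigid (A : {linear V -> V}) :
  (forall v, X (X (A v)) + X (A (X v)) + A (X (X v)) = 0) ->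
  exists H : {linear V -> V}, forall v, A v = X (H v) - H (X v).
Proof.
move=> AX; have [co [coP coK]] := coordinates.
pose Xl : {linear V -> V} := X.
pose Phi : 'M[O]_n := \matrix_i co (X (e i)).
have coX v : co (X v) = co v *m Phi.
  rewrite {1}(coP v) (linear_sum Xl) linear_sum mulmx_sum_row; apply: eq_bigr => i _.
  by rewrite [Xl _]linearZ linearZ /= rowK.
have Phi3 : Phi *m Phi *m Phi = 1%:M.
  apply/row_matrixP => i; rewrite !row_mul rowK row1 -!coX /act !scalerA -mulrA -expr2 -exprS x3 scale1r.
  rewrite -[RHS]coK; congr (co _); rewrite (bigD1 i) //= mxE !eqxx scale1r.
  by rewrite big1 ?addr0 // => k /negPf ki; rewrite mxE ki andbF scale0r.
pose Psi := map_mx al Phi.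
have Psi3 : Psi *m Psi *m Psi = 1%:M by rewrite -!map_mxM Phi3 map_mx1.
pose P : lmodType T := 'rV[T]_n.
have [cl clE] : exists cl : ('I_n -> M) -> {linear P -> M},
    forall f (c : 'rV[T]_n), cl f c = \sum_i c 0 i *: f i.
  have comb (f : 'I_n -> M) : linear (fun c : 'rV[T]_n => \sum_i c 0 i *: f i).
    move=> a u v; rewrite scaler_sumr -big_split; apply: eq_bigr => i _.
    by rewrite !mxE scalerDl scalerA.
  exists (fun f => HB.pack_for {linear P -> M}
    (fun c : 'rV[T]_n => \sum_i c 0 i *: f i)
    (GRing.isLinear.Build T P M _ _ (comb f))).
  by [].
have clO (B : {linear V -> V}) (c : 'rV[O]_n) :
    cl (fun i => B (e i)) (map_mx al c) = B (\sum_i c 0 i *: e i).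
  rewrite clE (linear_sum B); apply: eq_bigr => i _.
  by rewrite [B (_ *: _)]linearZ [map_mx al c 0 i]mxE.
have clPsi (B : {linear V -> V}) (c : 'rV[T]_n) :
    cl (fun i => B (e i)) (c *m Psi) = cl (fun i => B (X (e i))) c.
  rewrite mulmx_sum_row linear_sum [RHS]clE; apply: eq_bigr => i _.
  rewrite [cl _ (_ *: _)]linearZ; congr (_ *: _).
  rewrite -map_row rowK clO; congr (B _).
  by rewrite -coP.
have [d1 d1E] : exists d1 : {linear P -> P},
    forall c : 'rV[T]_n, d1 c = x *: c - c *m Psi.
  by exists ((x \*: idfun) \- mulmxr Psi : {linear 'rV[T]_n -> 'rV[T]_n}).
have [d2 d2E] : exists d2 : {linear P -> P}, forall c : 'rV[T]_n,
    d2 c = x ^+ 2 *: c + x *: (c *m Psi) + c *m (Psi *m Psi).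
  by exists (((x ^+ 2 \*: idfun) \+ (x \*: mulmxr Psi)) \+ mulmxr (Psi *m Psi)
    : {linear 'rV[T]_n -> 'rV[T]_n}).
have e0O := clO (idfun : {linear V -> V}); have e0Psi := clPsi (idfun : {linear V -> V}).
set e0 := cl (fun i => e i) in e0O e0Psi.
have e0E : forall c : 'rV[T]_n, e0 c = \sum_i c 0 i *: (e i : M) by exact: clE.
clearbody e0.
have mapB (c : 'rV[O]_n) : map_mx al c *m Psi = map_mx al (c *m Phi) by rewrite map_mxM.
have e0d1 c : e0 (d1 c) = 0.
  rewrite d1E linearB e0Psi [e0 (x *: c)]linearZ /= e0E clE scaler_sumr -sumrB big1 // => i _.
  by rewrite !scalerA mulrC -scalerA subrr.
have d1d2 c : d1 (d2 c) = 0.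
  rewrite d1E d2E !mulmxDl -!scalemxAl !scalerDr !scalerA -exprS x3 -expr2.
  rewrite -[c *m Psi *m Psi]mulmxA -[c *m _ *m Psi]mulmxA Psi3 mulmx1 scale1r.
  set u := x ^+ 2 *: _; set w := x *: (c *m _).
  by rewrite -[c + u + w]addrA [c + _]addrC subrr.
have surj0 : surjective e0.
  by move=> v; exists (map_mx al (co v)); rewrite e0O -coP.
have ex0 c : e0 c = 0 <-> exists w, d1 w = c.
  split=> [|[w <-]]; last exact: e0d1.
  have [c0 [c1 [c2 ->]]] := row_cyclic3 c => E.
  set u0 := map_mx al c0 in E *; set u1 := map_mx al c1 in E *.
  set u2 := map_mx al c2 in E *.
  (* Division by [x - Psi]: modulo the image of [d1], [x] may be replaced by [Psi], which leaves a
     row with entries in [O], and [e0] is injective on such rows. *)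
  have dE : u0 + x *: u1 + x ^+ 2 *: u2 =
      d1 (u1 + x *: u2 + u2 *m Psi) + (u0 + u1 *m Psi + u2 *m (Psi *m Psi)).
    rewrite d1E !mulmxDl -!scalemxAl !scalerDr !scalerA -expr2 -[u2 *m _ *m _]mulmxA.
    move: (x *: u1) (x ^+ 2 *: u2) (x *: (u2 *m Psi)) (u1 *m Psi) (u2 *m (Psi *m Psi)).
    move=> a b d s t.
    apply: (addIr (s + d + t)); rewrite [RHS]addrAC subrK.
    by rewrite (AC (3*3) ((2*3*5)*(1*4*6))).
  have h0 : u0 + u1 *m Psi + u2 *m (Psi *m Psi) = 0.
    have E2 : e0 (u0 + u1 *m Psi + u2 *m (Psi *m Psi)) = 0.
      by move: E; rewrite dE linearD e0d1 add0r.
    move: E2; rewrite mulmxA /u0 /u1 /u2 !mapB -!map_mxD e0O => /(congr1 co).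
    by rewrite coK linear0 => ->; rewrite map_mx0.
  by exists (u1 + x *: u2 + u2 *m Psi); rewrite dE h0 addr0.
have ex1 c : d1 c = 0 <-> exists w, d2 w = c.
  split=> [|[w <-]]; last exact: d1d2.
  have [c0 [c1 [c2 ->]]] := row_cyclic3 c; rewrite d1E => /eqP.
  rewrite subr_eq0 => /eqP.
  rewrite !mulmxDl -!scalemxAl !mapB !scalerDr !scalerA -expr2 -exprS x3 scale1r.
  (* Comparing coefficients of [1], [x], [x^2] in [x c = c Psi] identifies [c] with the value of
     [d2] at its last coefficient. *)
  rewrite addrC addrA => /row_cyclic3_inj [h1 h2 h3].
  exists (map_mx al c2); rewrite d2E mulmxA !mapB -h3 -h2.
  by rewrite addrC [_ + x *: _]addrC addrA.
have fd2 (c : 'rV[T]_n) : cl (fun i => A (e i)) (d2 c) = 0.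
  rewrite d2E !linearD mulmxA clPsi (clPsi (A \o Xl)).
  rewrite [cl _ (x ^+ 2 *: c)]linearZ [cl _ (x *: _)]linearZ /= clPsi !clE.
  rewrite !scaler_sumr -!big_split big1 // => i _ /=.
  transitivity (c 0 i *: (X (X (A (e i))) + X (A (X (e i))) + A (X (X (e i))) : M)).
    by rewrite !scalerDr /act !scalerA expr2 !(mulrC (c 0 i)) (mulrAC x).
  by rewrite (AX (e i)) scaler0.
have prP : projective P := @rV_projective T n.
have [h hP] := rigM prP prP prP surj0 ex0 ex1 fd2.
pose H (v : V) : V := h (map_mx al (co v)).
have lin : linear H.
  move=> a u v; rewrite /H linearP map_mxD map_mxZ linearD [h (_ *: _)]linearZ /=.
  by [].
pose Hl : {linear V -> V} := HB.pack H (GRing.isLinear.Build O V V _ H lin).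
exists Hl => v.
have := hP (map_mx al (co v)); rewrite clO -coP => ->.
by rewrite d1E mapB -coX linearB [h (x *: _)]linearZ.
Qed.

End Rigid.

(** * Symmetric algebras and their invariants *)

(** Makes ring morphisms into [B] algebra morphisms, so that the universal property of the symmetric
    algebra applies to them. *)
Definition alg_along (O B : comNzRingType) (h : {rmorphism O -> B}) : Type := B.

Section AlgAlong.
Variables (O B : comNzRingType) (h : {rmorphism O -> B}).
Local Notation A := (alg_along h).

HB.instance Definition _ := GRing.ComNzRing.on A.

Definition along_scale (r : O) (b : A) : A := h r * (b : B).

Lemma along_scaleA r s b : along_scale r (along_scale s b) = along_scale (r * s) b.
Proof. by rewrite /along_scale rmorphM mulrA. Qed.

Lemma along_scale1 : left_id 1 along_scale.
Proof. by move=> b; rewrite /along_scale rmorph1 mul1r. Qed.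

Lemma along_scaleDr : right_distributive along_scale +%R.
Proof. by move=> r b c; rewrite /along_scale mulrDr. Qed.

Lemma along_scaleDl b : {morph along_scale^~ b : r s / r + s}.
Proof. by move=> r s; rewrite /along_scale rmorphD mulrDl. Qed.

HB.instance Definition _ := GRing.Zmodule_isLmodule.Build O A
  along_scaleA along_scale1 along_scaleDr along_scaleDl.

Lemma along_scalerAl (r : O) (b c : A) : r *: (b * c) = (r *: b) * c.
Proof. exact: mulrA. Qed.

HB.instance Definition _ := GRing.Lmodule_isLalgebra.Build O A along_scalerAl.
HB.instance Definition _ := GRing.Lalgebra_isComAlgebra.Build O A.

End AlgAlong.

(* The variable of index [0] is the outermost one.                            *)
Fixpoint mvar (O : comNzRingType) r (i : nat) : MP O r :=
  match r with
  | 0 => 1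
  | r'.+1 => if i is k.+1 then (mvar O r' k)%:P else ('X : {poly MP O r'})
  end.

Lemma ev_mvar (O B : comNzRingType) (h : {rmorphism O -> B}) r x i : (i < r)%N ->
  ev h r x (mvar O r i) = x i.
Proof.
by elim: r x i => [//|r IH] x [|i] ir /=; [rewrite pevX | rewrite pevC IH].
Qed.

Lemma MP_hom_ext (O B : comNzRingType) r (f1 f2 : {rmorphism MP O r -> B}) :
  (forall c, f1 (mpC O r c) = f2 (mpC O r c)) ->
  (forall i, (i < r)%N -> f1 (mvar O r i) = f2 (mvar O r i)) -> f1 =1 f2.
Proof.
elim: r f1 f2 => [|r IH] f1 f2 EC EX f; first exact: EC.
have E : f1 \o (@polyC (MP O r)) =1 f2 \o (@polyC (MP O r)).
  apply: (IH (f1 \o (@polyC (MP O r)) : {rmorphism MP O r -> B})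
             (f2 \o (@polyC (MP O r)) : {rmorphism MP O r -> B})) => //.
  by move=> i ir; exact: (EX i.+1).
rewrite -[f](@coefK (MP O r)) poly_def !rmorph_sum; apply: eq_bigr => i _.
rewrite -mul_polyC !rmorphM !rmorphXn; congr (_ * _ ^+ _); first exact: E.
exact: (EX 0%N).
Qed.

Section SymmetricAlgebra.
Variables (O : comNzRingType) (V : lmodType O) (S : comAlgType O).
Variable iota : {linear V -> S}.
Hypothesis symS : is_symmetric_algebra iota.

Lemma symalg_hom_ext (B : comNzRingType) (f1 f2 : {rmorphism S -> B}) :
  (forall c, f1 c%:A = f2 c%:A) -> (forall v, f1 (iota v) = f2 (iota v)) ->
  f1 =1 f2.
Proof.
move=> EC Ei.
pose h : {rmorphism O -> B} := f1 \o in_alg S.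
have sc1 : scalable (f1 : S -> alg_along h).
  by move=> a u; rewrite -mulr_algl rmorphM.
have sc2 : scalable (f2 : S -> alg_along h).
  by move=> a u; rewrite -mulr_algl rmorphM -EC.
pose F1 : {lrmorphism S -> alg_along h} := HB.pack (f1 : S -> alg_along h)
  (GRing.isZmodMorphism.Build S (alg_along h) (f1 : S -> alg_along h) (rmorphB f1))
  (GRing.isMonoidMorphism.Build S (alg_along h) (f1 : S -> alg_along h)
     (rmorph1 f1, rmorphM f1))
  (GRing.isScalable.Build O S (alg_along h) *:%R (f1 : S -> alg_along h) sc1).
pose F2 : {lrmorphism S -> alg_along h} := HB.pack (f2 : S -> alg_along h)
  (GRing.isZmodMorphism.Build S (alg_along h) (f2 : S -> alg_along h) (rmorphB f2))
  (GRing.isMonoidMorphism.Build S (alg_along h) (f2 : S -> alg_along h)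
     (rmorph1 f2, rmorphM f2))
  (GRing.isScalable.Build O S (alg_along h) *:%R (f2 : S -> alg_along h) sc2).
have [phi [_ uniq]] := symS (F1 \o iota : {linear V -> alg_along h}).
move=> s; transitivity (phi s); first exact: (uniq F1).
by apply/esym/(uniq F2) => v; exact/esym/Ei.
Qed.

Variables (r : nat) (e : 'I_r -> V).
Hypothesis eB : is_basis e.

Lemma symalg_iso : exists Psi : {rmorphism S -> MP O r}, [/\ bijective Psi,
  forall c, Psi c%:A = mpC O r c & forall i, Psi (iota (e i)) = mvar O r i].
Proof.
have [span ind] := eB; have /choice [co coP] := span.
have uniq (c d : 'I_r -> O) : \sum_i c i *: e i = \sum_i d i *: e i ->
    forall i, c i = d i.
  move=> E i; apply/eqP; rewrite -subr_eq0; apply/eqP.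
  apply: (ind (fun k => c k - d k)).
  rewrite -[RHS](subrr (\sum_k c k *: e k)) {2}E -sumrB.
  by apply: eq_bigr => k _; rewrite scalerBl.
pose A := alg_along (mpC O r).
pose f v : A := \sum_i co v i *: (mvar O r i : A).
have lin : linear f.
  move=> a u v; rewrite /f scaler_sumr -big_split /=; apply: eq_bigr => i _.
  rewrite scalerA -scalerDl; congr (_ *: _).
  apply: (uniq _ (fun i => a * co u i + co v i)).
  rewrite -coP {1}(coP u) {1}(coP v) scaler_sumr -big_split.
  by apply: eq_bigr => k _; rewrite scalerDl scalerA.
pose F : {linear V -> A} := HB.pack f (GRing.isLinear.Build O V A _ f lin).
have fe i : f (e i) = mvar O r i.
  rewrite /f (bigD1 i) //=.
  have ce k : co (e i) k = (k == i)%:R.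
    apply: (uniq _ (fun k => (k == i)%:R)); rewrite -coP (bigD1 i) //= eqxx scale1r.
    by rewrite big1 ?addr0 // => l /negPf ->; rewrite scale0r.
  rewrite ce eqxx scale1r big1 ?addr0 // => k /negPf ki.
  by rewrite ce ki scale0r.
have [phi [phiP _]] := symS F.
pose Psi : {rmorphism S -> MP O r} := HB.pack (phi : S -> MP O r)
  (GRing.isZmodMorphism.Build S (MP O r) (phi : S -> MP O r) (rmorphB phi))
  (GRing.isMonoidMorphism.Build S (MP O r) (phi : S -> MP O r)
     (rmorph1 phi, rmorphM phi)).
have PsiC c : Psi c%:A = mpC O r c.
  by rewrite /= linearZ rmorph1 /=; exact: mulr1.
have Psie i : Psi (iota (e i)) = mvar O r i by rewrite /= phiP /= fe.
pose x k := if insub k is Some i then iota (e i) else 0.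
pose Th : {rmorphism MP O r -> S} := ev (in_alg S) r x.
have Thvar (i : 'I_r) : Th (mvar O r i) = iota (e i).
  by rewrite /Th ev_mvar // /x valK.
exists Psi; split=> //; exists Th.
  move=> s; apply: (symalg_hom_ext (f1 := Th \o Psi) (f2 := idfun)) => [c|v].
    by rewrite [LHS](_ : _ = Th (Psi c%:A)) // PsiC /Th ev_mpC.
  rewrite [LHS](_ : _ = Th (Psi (iota v))) // [in RHS](coP v) [in LHS](coP v).
  rewrite !linear_sum !rmorph_sum; apply: eq_bigr => i _.
  have -> : iota (co v i *: e i) = (co v i)%:A * iota (e i).
    by rewrite mulr_algl linearZ.
  by rewrite !rmorphM PsiC Psie Thvar /Th ev_mpC.
move=> q; apply: (MP_hom_ext (f1 := Psi \o Th) (f2 := idfun)) => [c|i ir].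
  by rewrite [LHS](_ : _ = Psi (Th (mpC O r c))) // /Th ev_mpC PsiC.
rewrite [LHS](_ : _ = Psi (Th (mvar O r (Ordinal ir)))) // Thvar Psie.
by [].
Qed.

End SymmetricAlgebra.

Lemma lift_rmorphism (A R P : comNzRingType) (j : {rmorphism R -> P})
  (f : {rmorphism A -> P}) : injective j -> (forall a, exists x, j x = f a) ->
  exists f' : {rmorphism A -> R}, forall a, j (f' a) = f a.
Proof.
move=> jinj /choice [h hP].
have zm : zmod_morphism h by move=> a b; apply: jinj; rewrite rmorphB !hP rmorphB.
have mm : monoid_morphism h.
  by split=> [|a b]; apply: jinj; rewrite ?rmorphM !hP ?rmorphM // !rmorph1.
pose F : {rmorphism A -> R} := HB.pack h (GRing.isZmodMorphism.Build A R h zm)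
  (GRing.isMonoidMorphism.Build A R h mm).
by exists F.
Qed.

(** The shape of fixed ring that [cm_criterion] accepts, with its inclusion in [MP O r] as the
    embedding. *)
Definition free_invariants (O : comNzRingType) r (gamma theta : {rmorphism MP O r -> MP O r})
    s (b : 'I_s -> MP O r) : Prop :=
  [/\ forall c, theta (mpC O r c) = mpC O r c,
      forall c, gamma (theta c) = theta c,
      forall i, gamma (b i) = b i,
      forall f, gamma f = f -> exists c, f = \sum_i theta (c i) * b i
    & forall c, \sum_i theta (c i) * b i = 0 -> forall i, c i = 0].

Section InvariantRing.
Variables (O : idomainType) (p : O).
Hypothesis unif : uniformizer p.
Variables (V : lmodType O) (S : comAlgType O) (iota : {linear V -> S}).
Hypothesis symS : is_symmetric_algebra iota.
Variables (gT : finGroupType) (g : gT).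
Hypothesis gen_g : generator [set: gT] g.
Variables (sigma : gT -> {lrmorphism S -> S}) (a : gT -> V -> V).
Hypothesis a1 : forall v, a 1%g v = v.
Hypothesis aM : forall h k v, a (h * k)%g v = a h (a k v).
Hypothesis sigmaE : forall h v, sigma h (iota v) = iota (a h v).

Lemma sigma_scalar h c : sigma h c%:A = c%:A.
Proof. by rewrite linearZ rmorph1. Qed.

(** Each [sigma h] is determined by its values on [iota], so [sigma] is multiplicative along the
    powers of [g]. *)
Lemma sigma_fixed s : sigma g s = s -> forall h, sigma h s = s.
Proof.
move=> gs h; have : h \in <[g]>%g by rewrite -(eqP gen_g) inE.
case/cycleP => k ->; elim: k => [|k IH].
  apply: (symalg_hom_ext symS (f1 := sigma 1%g) (f2 := idfun)) => [c|v].
    exact: sigma_scalar.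
  by apply: etrans (sigmaE _ _) _; rewrite a1.
rewrite expgS -[RHS]gs -[in RHS]IH.
apply: (symalg_hom_ext symS (f1 := sigma _) (f2 := sigma g \o sigma (g ^+ k)%g)) => [c|v].
  apply: etrans (sigma_scalar _ _) _; apply/esym.
  exact: etrans (congr1 (sigma g) (sigma_scalar _ _)) (sigma_scalar _ _).
apply: etrans (sigmaE _ _) _; rewrite aM; apply/esym.
exact: etrans (congr1 (sigma g) (sigmaE _ _)) (sigmaE _ _).
Qed.

Variables (r : nat) (e : 'I_r -> V).
Hypothesis eB : is_basis e.

Lemma invariant_ring_cm :
  (forall (Psi : {rmorphism S -> MP O r}) (gamma : {rmorphism MP O r -> MP O r}),
     (forall c, Psi c%:A = mpC O r c) ->
     (forall i, Psi (iota (e i)) = mvar O r i) ->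
     (forall c, gamma (mpC O r c) = mpC O r c) ->
     (forall v, gamma (Psi (iota v)) = Psi (iota (a g v))) ->
     exists theta s b, @free_invariants O r gamma theta s b) ->
  cohen_macaulay (invariant_ring sigma).
Proof.
move=> H; have [Psi [Pbij PC Pe]] := symalg_iso symS eB.
have [Th PsiK ThK] := Pbij.
have zm : zmod_morphism Th.
  by move=> x y; apply: (bij_inj Pbij); rewrite rmorphB /= !ThK.
have mm : monoid_morphism Th.
  by split=> [|x y]; apply: (bij_inj Pbij); rewrite ?rmorphM /= !ThK ?rmorph1.
pose ThR : {rmorphism MP O r -> S} := HB.pack Th
  (GRing.isZmodMorphism.Build (MP O r) S Th zm)
  (GRing.isMonoidMorphism.Build (MP O r) S Th mm).
pose gamma : {rmorphism MP O r -> MP O r} := Psi \o sigma g \o ThR.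
have gammaP s : gamma (Psi s) = Psi (sigma g s) by rewrite /= PsiK.
have [c|v|theta [s [b [thC gth gb span free]]]] := H Psi gamma PC Pe.
- by rewrite -PC gammaP sigma_scalar.
- by rewrite gammaP sigmaE.
pose j : {rmorphism invariant_ring sigma -> MP O r} := Psi \o val.
have jinj : injective j by move=> x y /(bij_inj Pbij) /val_inj.
have jfix x : gamma (j x) = j x.
  by rewrite gammaP; have /forallP/(_ g)/eqP -> := valP x.
have jim f : gamma f = f -> exists x, j x = f.
  move=> gf; have fixed : Th f \in Defs.invariant sigma.
    apply/forallP => h; apply/eqP; apply: sigma_fixed.
    by apply: (bij_inj Pbij); rewrite -gammaP !ThK.
  by exists (Sub (Th f) fixed); rewrite /= ThK.
have [th thP] := lift_rmorphism jinj (fun c => jim _ (gth c)).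
have /choice [d dP] i := jim _ (gb i).
apply: (cm_criterion unif (theta := th) (b := d) _ _ jinj).
- move=> y; have [c E] := span _ (jfix y); exists c; apply: jinj.
  by rewrite E rmorph_sum; apply: eq_bigr => i _; rewrite rmorphM dP thP.
- move=> c /(congr1 j); rewrite rmorph0 rmorph_sum => E; apply: free.
  by rewrite -[RHS]E; apply: eq_bigr => i _; rewrite rmorphM dP thP.
- by move=> c; rewrite thP.
Qed.

End InvariantRing.

(** * Invariants of polynomial rings *)

Section MonicExpansion.
Variables (C : comNzRingType) (N : {poly C}) (d : nat).
Hypothesis Nmonic : N \is monic.
Hypothesis Nsize : size N = d.+1.
Hypothesis d0 : (0 < d)%N.

(** Repeated division by [N]: the remainder gives the constant terms of the [c i], and the quotient
    is expanded in turn. *)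
Lemma monic_expansion (f : {poly C}) : exists c : 'I_d -> {poly C},
  f = \sum_i (c i \Po N) * 'X^i.
Proof.
move: {2}(size f) (leqnn (size f)) => n; elim: n f => [|n IH] f.
  rewrite leqn0 size_poly_eq0 => /eqP ->; exists (fun=> 0).
  by rewrite big1 // => i _; rewrite comp_poly0 mul0r.
move=> sf; have N0 := monic_neq0 Nmonic.
set q := Pdiv.CommonRing.rdivp f N; set t := Pdiv.CommonRing.rmodp f N.
have fE : f = q * N + t by rewrite -Pdiv.RingMonic.rdivp_eq.
have st : (size t <= d)%N.
  by rewrite -ltnS -Nsize Pdiv.CommonRing.ltn_rmodpN0.
have [|c cE] := IH q.
  have [->|q0] := eqVneq q 0; first by rewrite size_poly0.
  have := sf; rewrite fE size_polyDl.
    rewrite size_Mmonic // Nsize addnS /= => h.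
    by rewrite -(leq_add2r d) (leq_trans h) // -addn1 leq_add2l.
  rewrite size_Mmonic // Nsize addnS /= (leq_ltn_trans st) //.
  by rewrite -[X in (X < _)%N]add0n ltn_add2r size_poly_gt0.
have tE : t = \sum_(i < d) (t`_i)%:P * 'X^i.
  transitivity (\poly_(i < d) t`_i).
    apply/polyP => i; rewrite coef_poly; case: ltnP => // di.
    by rewrite nth_default // (leq_trans st).
  by rewrite poly_def; apply: eq_bigr => i _; rewrite mul_polyC.
exists (fun i => c i * 'X + (t`_i)%:P).
rewrite fE cE mulr_suml {1}tE.
rewrite -big_split; apply: eq_bigr => i _ /=.
by rewrite comp_polyD comp_polyM comp_polyX comp_polyC mulrDl mulrAC.
Qed.

(** The constant terms of the [c i] form a remainder modulo [N]; for reasons of degree it vanishes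
    together with the quotient, which is an expansion with [c i] of smaller size. *)
Lemma monic_expansion_uniq (c : 'I_d -> {poly C}) :
  \sum_i (c i \Po N) * 'X^i = 0 -> forall i, c i = 0.
Proof.
have [n] : exists n, forall i, (size (c i) <= n)%N.
  by exists (\max_i size (c i)) => i; rewrite (leq_bigmax i).
elim: n c => [|n IH] c sc E.
  by move=> i; apply/eqP; rewrite -size_poly_leq0.
pose c' i := drop_poly 1 (c i).
have cE i : c i = c' i * 'X + ((c i)`_0)%:P.
  rewrite -{1}(poly_take_drop 1 (c i)) expr1 addrC; congr (_ + _).
  by apply/polyP => k; rewrite coef_take_poly coefC ltnS leqn0; case: eqP => // ->.
set q := \sum_i (c' i \Po N) * 'X^i; set t := \poly_(i < d) (if insub i is Some k then (c k)`_0 else 0).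
have tE : t = \sum_(i < d) ((c i)`_0)%:P * 'X^i.
  rewrite /t poly_def; apply: eq_bigr => i _.
  by rewrite valK mul_polyC.
have Eqt : q * N + t = 0.
  rewrite -[RHS]E tE /q mulr_suml -big_split; apply: eq_bigr => i _ /=.
  by rewrite [in RHS]cE comp_polyD comp_polyM comp_polyX comp_polyC mulrDl mulrAC.
have q0 : q = 0.
  apply/eqP/negPn/negP => q0; have := congr1 (fun f : {poly C} => size f) Eqt.
  rewrite size_polyDl ?size_Mmonic // Nsize addnS /=.
    by rewrite size_poly0 => /eqP; rewrite addn_eq0 size_poly_eq0 (negPf q0).
  rewrite (leq_ltn_trans (size_poly _ _)) //.
  by rewrite -[X in (X < _)%N]add0n ltn_add2r size_poly_gt0.
have t0 : t = 0 by rewrite -Eqt q0 mul0r add0r.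
have c'0 : forall i, c' i = 0.
  apply: IH q0 => i; rewrite size_drop_poly leq_subLR add1n; exact: sc.
move=> i; rewrite cE c'0 mul0r add0r.
have := congr1 (fun f : {poly C} => f`_i) t0.
by rewrite coef_poly ltn_ord valK coef0 => ->.
Qed.

End MonicExpansion.

Lemma pev_comp (C : comNzRingType) (N f : {poly C}) :
  pev (@polyC C) N f = f \Po N.
Proof.
rewrite pevE comp_polyE; apply: eq_bigr => i _.
by rewrite mul_polyC.
Qed.

Lemma size_monic_lead (C : comNzRingType) (t : {poly C}) d : (size t <= d)%N ->
  'X^d + t \is monic /\ size ('X^d + t) = d.+1.
Proof.
move=> st; have sX : (size t < size ('X^d : {poly C}))%N by rewrite size_polyXn ltnS.
by rewrite monicE lead_coefDl // lead_coefXn eqxx size_polyDl // size_polyXn.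
Qed.

Section TrivialAction.
Variables (O : comNzRingType).

Lemma free_invariants_trivial (gamma : {rmorphism MP O 1 -> MP O 1}) :
  (forall c, gamma (mpC O 1 c) = mpC O 1 c) ->
  gamma (mvar O 1 0) = mvar O 1 0 ->
  exists theta s b, @free_invariants O 1 gamma theta s b.
Proof.
move=> gC gX; exists idfun, 1%N, (fun=> 1).
have gid : gamma =1 idfun.
  by apply: (MP_hom_ext (f2 := idfun)) => // -[|//] _; exact: gX.
split=> //= [f _|c].
- by exists (fun=> f); rewrite big_ord1 mulr1.
- by rewrite big_ord1 mulr1 => c0 i; rewrite [i]ord1.
Qed.

End TrivialAction.

(* A reflection [x |-> w x + y]: the invariants are generated over the        *)
(* coefficients by the norm [x (w x + y) (w^2 x - w^2 y)] of [x].             *)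
Section Reflection.
Variables (O : idomainType) (r : nat) (w : O) (y : MP O r).
Hypothesis w3 : w ^+ 2 + w + 1 = 0.
Hypothesis w1 : w <> 1.
Local Notation C := (MP O r).
Local Notation om := (mpC O r w).

Lemma free_invariants_reflection (gamma : {rmorphism MP O r.+1 -> MP O r.+1}) :
  (forall c : C, gamma (c%:P) = c%:P) ->
  gamma ('X : {poly C}) = om%:P * ('X : {poly C}) + y%:P ->
  exists theta s b, @free_invariants O r.+1 gamma theta s b.
Proof.
move=> gC gX.
have om3 : om ^+ 2 + om + 1 = 0.
  by rewrite -[RHS](rmorph0 (mpC O r)) -w3 !rmorphD rmorphXn rmorph1.
pose t : {poly C} := ((om ^+ 2 - 1) * y)%:P * 'X^2 - (om ^+ 2 * y ^+ 2)%:P * 'X.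
pose N : {poly C} := 'X^3 + t.
have st : (size t <= 3)%N.
  rewrite /t !mul_polyC (leq_trans (size_polyD _ _)) // geq_max size_polyN.
  by rewrite !(leq_trans (size_scale_leq _ _)) ?size_polyXn ?size_polyX.
have [Nm sN] := size_monic_lead st.
pose W : {poly C} := om%:P; pose Y : {poly C} := y%:P.
have W2 : W ^+ 2 + W + 1 = 0 by rewrite -polyC_exp -polyCD -polyCD om3.
have W3 : W ^+ 3 = 1.
  by apply/eqP; rewrite -subr_eq0 -[X in _ == X](mulr0 (W - 1)) -W2; apply/eqP; ring.
have NE : N = 'X * (W * 'X + Y) * (W * W * ('X - Y)).
  transitivity (W ^+ 3 * ('X^3 - Y * 'X^2) + (W ^+ 2 * Y * 'X^2 - W ^+ 2 * Y ^+ 2 * 'X)).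
    by rewrite /N /t W3 !polyCM !polyCB !polyC_exp -/W -/Y; ring.
  by ring.
pose theta : {rmorphism MP O r.+1 -> MP O r.+1} := pev (@polyC C) N.
have thE c : theta c = (c : {poly C}) \Po N by exact: pev_comp.
have W1 : W * (W * 'X + Y) + Y = W ^+ 2 * ('X - Y).
  apply/eqP; rewrite -subr_eq0 -[X in _ == X](mul0r Y) -W2; apply/eqP; ring.
have gW : gamma W = W by exact: gC.
have gY : gamma Y = Y by exact: gC.
have gX' : gamma ('X : {poly C}) = W * 'X + Y by exact: gX.
have gN : gamma N = N.
  transitivity (gamma ('X : {poly C}) * (gamma W * gamma ('X : {poly C}) + gamma Y) *
                (gamma W * gamma W * (gamma ('X : {poly C}) - gamma Y))).
    by rewrite {1}NE !rmorphM rmorphB rmorphD rmorphM.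
  rewrite gX' gW gY W1 [in RHS]NE -[RHS]mul1r -W3; ring.
have gth c : gamma (theta c) = theta c.
  rewrite /theta /= !pevE rmorph_sum; apply: eq_bigr => i _.
  by rewrite rmorphM rmorphXn gC gN.
have expand3 (c : 'I_3 -> {poly C}) : \sum_i (c i \Po N) * 'X^i =
    theta (c ord0) + theta (c (lift ord0 ord0)) * ('X : {poly C}) +
      theta (c (lift ord0 (lift ord0 ord0))) * ('X : {poly C}) ^+ 2.
  by rewrite !big_ord_recl big_ord0 addr0 expr0 mulr1 expr1 addrA !thE.
have uniq3 (c0 c1 c2 : {poly C}) :
    theta c0 + theta c1 * ('X : {poly C}) + theta c2 * ('X : {poly C}) ^+ 2 = 0 ->
    [/\ c0 = 0, c1 = 0 & c2 = 0].
  move=> E; have u := monic_expansion_uniq Nm sN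
    (c := fun i : 'I_3 => tnth [tuple c0; c1; c2] i) (etrans (expand3 _) E).
  split; [exact: (u ord0) | exact: (u (lift ord0 ord0)) |].
  exact: (u (lift ord0 (lift ord0 ord0))).
have reg (f : {poly C}) : (W * 'X + Y - 'X) * f = 0 -> f = 0.
  move=> E; apply/eqP; rewrite -lead_coef_eq0; apply/eqP.
  apply: (@mpC_lreg O (w - 1)); first by rewrite subr_eq0; apply/eqP.
  have := congr1 (fun h : {poly C} => h`_(size f)) E; rewrite coef0.
  rewrite [_ * f](_ : _ = (om - 1)%:P * ('X * f) + Y * f); last first.
    by rewrite polyCB -/W; ring.
  rewrite coefD !coefCM coefXM [f`_(size f)]nth_default // mulr0 addr0.
  rewrite rmorphB rmorph1 lead_coefE; case: eqP => [E0 _|_ //].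
  by rewrite nth_default ?E0 // mulr0.
exists theta, 1%N, (fun=> 1); split=> //.
- by move=> c; rewrite /theta /= pevC.
- by move=> i; exact: rmorph1.
- move=> f gf; have [c fE] := monic_expansion Nm sN isT f.
  move: fE; rewrite expand3.
  move: (c ord0) (c (lift ord0 ord0)) (c (lift ord0 (lift ord0 ord0))).
  move=> c0 c1 c2 fE.
  (* The difference [gamma f - f] is this element times [gamma X - X], which is regular because its
     leading coefficient [w - 1] is nonzero. *)
  have : theta c1 + theta c2 * (W * 'X + Y + ('X : {poly C})) = 0.
    apply: reg; transitivity (gamma f - f); last by rewrite gf subrr.
    by rewrite fE !(rmorphD, rmorphM, rmorphXn) !gth gX'; ring.
  have thY : theta Y = Y by rewrite /theta /= pevC.
  have thW : theta W = W by rewrite /theta /= pevC.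
  move=> E; have [|h1 h2 _] := uniq3 (c1 + c2 * Y) ((W + 1) * c2) 0.
    rewrite rmorph0 mul0r addr0 -[RHS]E rmorphD !rmorphM rmorphD rmorph1 thY thW.
    by ring.
  (* The factor [W + 1] is [- W^2], a unit. *)
  have c20 : c2 = 0.
    rewrite -[LHS]mul1r -W3 -[RHS](mulr0 (- W)) -h2.
    apply/eqP; rewrite -subr_eq0 -[X in _ == X](mul0r (W * c2)) -W2; apply/eqP; ring.
  exists (fun=> c0); rewrite big_ord1 mulr1 fE.
  by move: h1; rewrite c20 mul0r addr0 => ->; rewrite rmorph0 !mul0r !addr0.
- move=> c; rewrite big_ord1 mulr1 => E i; rewrite [i]ord1.
  have [|-> //] := uniq3 (c ord0) 0 0.
  by rewrite E rmorph0 !mul0r !addr0.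
Qed.

End Reflection.

(** The argument of [f] is [rho] below, with [a], [b], [c], [d] for [E2], [E1], [x], [y]. *)
Lemma rmorph_cyclic (R : comNzRingType) (f : {rmorphism R -> R}) (a b c d : R) :
  f ((a - b * b) * c + b * (c * c) + (- a + 2%:R * b * c - 3%:R * (c * c)) * d) =
  (f a - f b * f b) * f c + f b * (f c * f c) +
    (- f a + 2%:R * f b * f c - 3%:R * (f c * f c)) * f d.
Proof.
by rewrite !(rmorph_nat, rmorphB, rmorphN, rmorphD, rmorphM).
Qed.

Lemma rmorph_expansion (R : comNzRingType) (f : {rmorphism R -> R})
    (u0 u1 u2 v0 v1 v2 x y : R) :
  f (u0 + u1 * x + u2 * x ^+ 2 + (v0 + v1 * x + v2 * x ^+ 2) * y) =
  f u0 + f u1 * f x + f u2 * f x ^+ 2 + (f v0 + f v1 * f x + f v2 * f x ^+ 2) * f y.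
Proof. by rewrite !(rmorphD, rmorphM). Qed.

(* With [th s = - e2 (x, y, E - x - y)], the coordinates of the difference    *)
(* between [x, y |-> y, E - x - y] applied to an element and that element.    *)
Lemma rmorph_difference (R : comNzRingType) (th : {rmorphism R -> R})
    (u0 u1 u2 v0 v1 v2 A s E x y : R) :
  th A = E -> th s = - (x * y + (x + y) * (E - x - y)) ->
  th (A * v0 + s * (u2 - v1)) + th (- u1 + A * (u2 - v1) - v0) * x +
    th (v1 - u2 - u2) * x ^+ 2 +
  (th (u1 + A * v1 - v0 - s * v2 + A * (u2 - v1) - v0) +
    th (v1 - u2 - 2%:R * v1 - A * v2) * x + th 0 * x ^+ 2) * y =
  (th u0 + th u1 * y + th u2 * y ^+ 2 +
    (th v0 + th v1 * y + th v2 * y ^+ 2) * (E - x - y)) -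
  (th u0 + th u1 * x + th u2 * x ^+ 2 + (th v0 + th v1 * x + th v2 * x ^+ 2) * y).
Proof.
move=> EA Es; rewrite rmorph0 !(rmorph_nat, rmorphB, rmorphN, rmorphD, rmorphM) EA Es.
by ring.
Qed.

Lemma rmorph_rho (R : comNzRingType) (th : {rmorphism R -> R}) (c A s E e2 x y : R) :
  th A = E -> th s = - e2 ->
  th c * ((e2 - E ^+ 2) * x + E * x ^+ 2 + (- e2 + 2%:R * E * x - 3%:R * x ^+ 2) * y) =
  th 0 + th (- (s + A ^+ 2) * c) * x + th (A * c) * x ^+ 2 +
  (th (s * c) + th (2%:R * A * c) * x + th (- 3%:R * c) * x ^+ 2) * y.
Proof.
move=> EA Es; rewrite rmorph0 !(rmorph_nat, rmorphB, rmorphN, rmorphD, rmorphM) EA Es.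
by ring.
Qed.

(* The cyclic permutation of three variables [x], [y], [z] whose sum [e1] is  *)
(* a constant: the polynomials are free over the symmetric ones on the        *)
(* monomials [x^i y^j] with [i < 3] and [j < 2], and solving for the fixed    *)
(* ones in this basis leaves the multiples of [1] and of one more element.    *)
Section CyclicPermutation.
Variables (C : comNzRingType) (e1 : C).
Hypothesis three : forall c : C, 3%:R * c = 0 -> c = 0.
Local Notation P := {poly {poly C}}.

Let x : P := 'X%:P.
Let y : P := 'X.
Let E1 : P := e1%:P%:P.
Let E2 : P := x * y + (x + y) * (E1 - x - y).
Let E3 : P := x * y * (E1 - x - y).

(** A tower of two monic extensions. [N1] is [- E2] as a polynomial in [y] over [C[x]]; [N2] is [E3]
    as a polynomial in [x], with the inner variable standing for [- E2]. So [C[x, y]] is free over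
    [C[x, E2]] on [1, y], which is free over [C[E2, E3]] on [1, x, x^2]. *)
Let N1 : P := 'X^2 + (('X - e1%:P)%:P * 'X + ('X * ('X - e1%:P))%:P).
Let N2 : P := 'X^3 + (- (e1%:P%:P * 'X^2) - 'X%:P * 'X).

Let swap_hom : {rmorphism P -> P} :=
  (pev (@polyC {poly C}) N1 : {rmorphism P -> P}) \o (@swapXY C : {rmorphism P -> P}).

Let swap_homC (c : C) : swap_hom (c%:P%:P) = c%:P%:P.
Proof. by rewrite /swap_hom /= swapXY_polyC map_polyC pevC. Qed.

Let swap_homY : swap_hom 'X%:P = - E2.
Proof.
rewrite /swap_hom /= swapXY_polyC map_polyX pevX /N1 /E2 /E1 polyCB polyCM polyCB -/x -/y.
ring.
Qed.

Let swap_homX : swap_hom 'X = x.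
Proof. by rewrite /swap_hom /= swapXY_X pevC. Qed.

Let swap_hom3 (a b c : P) : swap_hom (a + b * 'X + c * 'X^2) =
  swap_hom a + swap_hom b * x + swap_hom c * x ^+ 2.
Proof. by rewrite -swap_homX -!rmorphXn -!rmorphM -!rmorphD. Qed.

Let sym_hom : {rmorphism P -> P} :=
  swap_hom \o (pev (@polyC {poly C}) N2 : {rmorphism P -> P}).

Let sym_homE (u : P) : sym_hom u = swap_hom (pev (@polyC {poly C}) N2 u).
Proof. by []. Qed.

Lemma sym_homC (c : C) : sym_hom (c%:P%:P : P) = c%:P%:P.
Proof.
by rewrite sym_homE pevC swap_homC.
Qed.

Lemma sym_homY : sym_hom ('X%:P : P) = - E2.
Proof.
by rewrite sym_homE pevC swap_homY.
Qed.

Lemma sym_homX : sym_hom ('X : P) = E3.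
Proof.
rewrite sym_homE pevX.
transitivity (swap_hom 'X ^+ 3 -
  (swap_hom e1%:P%:P * swap_hom 'X ^+ 2) - swap_hom 'X%:P * swap_hom 'X).
  by rewrite /N2 -!rmorphXn -!rmorphM -!rmorphB addrA.
rewrite swap_homC swap_homX swap_homY /E2 /E3 -/E1; ring.
Qed.

Let N1P : N1 \is monic /\ size N1 = 3%N.
Proof.
apply: size_monic_lead; rewrite (leq_trans (size_polyD _ _)) // geq_max.
rewrite mul_polyC (leq_trans (size_scale_leq _ _)) ?size_polyX //.
by rewrite (leq_trans (size_polyC_leq1 _)).
Qed.

Let N2P : N2 \is monic /\ size N2 = 4%N.
Proof.
apply: size_monic_lead; rewrite (leq_trans (size_polyD _ _)) // geq_max !size_polyN.
by rewrite !mul_polyC !(leq_trans (size_scale_leq _ _)) ?size_polyX ?size_polyXn.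
Qed.

Let expand2 (u0 u1 u2 : P) : sym_hom u0 + sym_hom u1 * x + sym_hom u2 * x ^+ 2 =
  swapXY (\sum_(i < 3) (tnth [tuple u0; u1; u2] i \Po N2) * 'X^i) \Po N1.
Proof.
rewrite !big_ord_recl big_ord0 addr0 addrA expr0 mulr1 expr1 -pev_comp.
by rewrite -[pev _ _ _]/(swap_hom _) swap_hom3 !sym_homE !pev_comp.
Qed.

Lemma sym_basis (f : P) : exists u0 u1 u2 v0 v1 v2 : P,
  f = sym_hom u0 + sym_hom u1 * x + sym_hom u2 * x ^+ 2 +
      (sym_hom v0 + sym_hom v1 * x + sym_hom v2 * x ^+ 2) * y.
Proof.
have [[m1 s1] [m2 s2]] := (N1P, N2P).
have exp2 (c : P) : exists u0 u1 u2 : P,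
    c \Po N1 = sym_hom u0 + sym_hom u1 * x + sym_hom u2 * x ^+ 2.
  have [d dE] := monic_expansion m2 s2 isT (swapXY c).
  exists (d ord0), (d (lift ord0 ord0)), (d (lift ord0 (lift ord0 ord0))).
  rewrite expand2 -[c in LHS]swapXYK dE !big_ord_recl !big_ord0.
  by [].
have [c ->] := monic_expansion m1 s1 isT f.
have [u0 [u1 [u2 uE]]] := exp2 (c ord0).
have [v0 [v1 [v2 vE]]] := exp2 (c (lift ord0 ord0)).
exists u0, u1, u2, v0, v1, v2.
rewrite (big_ord_recl 1) big_ord1 expr0 mulr1 expr1.
exact: (congr2 (fun a b : P => a + b * y) uE vE).
Qed.

Lemma sym_basis_uniq (u0 u1 u2 v0 v1 v2 : P) :
  sym_hom u0 + sym_hom u1 * x + sym_hom u2 * x ^+ 2 +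
  (sym_hom v0 + sym_hom v1 * x + sym_hom v2 * x ^+ 2) * y = 0 ->
  [/\ u0 = 0, u1 = 0 & u2 = 0] /\ [/\ v0 = 0, v1 = 0 & v2 = 0].
Proof.
have [[m1 s1] [m2 s2]] := (N1P, N2P).
rewrite expand2 (expand2 v0 v1 v2) => E.
have h1 := monic_expansion_uniq m1 s1 (c := fun i : 'I_2 => tnth [tuple
  swapXY (\sum_(i < 3) (tnth [tuple u0; u1; u2] i \Po N2) * 'X^i);
  swapXY (\sum_(i < 3) (tnth [tuple v0; v1; v2] i \Po N2) * 'X^i)] i).
have {}h1 : forall i : 'I_2, tnth [tuple
  swapXY (\sum_(i < 3) (tnth [tuple u0; u1; u2] i \Po N2) * 'X^i);
  swapXY (\sum_(i < 3) (tnth [tuple v0; v1; v2] i \Po N2) * 'X^i)] i = 0.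
  apply: h1; rewrite (big_ord_recl 1) big_ord1 expr0 mulr1 expr1.
  exact: E.
have z (w0 w1 w2 : P) :
    swapXY (\sum_(i < 3) (tnth [tuple w0; w1; w2] i \Po N2) * 'X^i) = 0 ->
    [/\ w0 = 0, w1 = 0 & w2 = 0].
  move/eqP; rewrite swapXY_eq0 => /eqP /(monic_expansion_uniq m2 s2) h.
  split; [exact: (h ord0) | exact: (h (lift ord0 ord0)) |].
  exact: (h (lift ord0 (lift ord0 ord0))).
by split; apply: z; [exact: (h1 ord0) | exact: (h1 (lift ord0 ord0))].
Qed.

Lemma sym_hom_exists : exists theta : {rmorphism P -> P},
  [/\ forall c : C, theta (c%:P%:P : P) = c%:P%:P,
      theta ('X%:P : P) = - E2, theta ('X : P) = E3,
      forall f : P, exists u0 u1 u2 v0 v1 v2 : P,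
        f = theta u0 + theta u1 * x + theta u2 * x ^+ 2 +
            (theta v0 + theta v1 * x + theta v2 * x ^+ 2) * y
    & forall u0 u1 u2 v0 v1 v2 : P,
        theta u0 + theta u1 * x + theta u2 * x ^+ 2 +
        (theta v0 + theta v1 * x + theta v2 * x ^+ 2) * y = 0 ->
        [/\ u0 = 0, u1 = 0 & u2 = 0] /\ [/\ v0 = 0, v1 = 0 & v2 = 0]].
Proof.
exists sym_hom; split; [exact: sym_homC | exact: sym_homY | exact: sym_homX | |].
  exact: sym_basis.
exact: sym_basis_uniq.
Qed.

Let A1 : P := e1%:P%:P.
(** This is [- (x^2 y + y^2 z + z^2 x)] with [z = E1 - x - y], written in the basis [x^i y^j]. *)
Let rho : P := (E2 - E1 ^+ 2) * x + E1 * x ^+ 2 +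
               (- E2 + 2%:R * E1 * x - 3%:R * x ^+ 2) * y.

Section Invariants.
Variables gamma theta : {rmorphism P -> P}.
Hypothesis thetaC : forall c : C, theta (c%:P%:P : P) = c%:P%:P.
Hypothesis thetaY : theta ('X%:P : P) = - E2.
Hypothesis thetaX : theta ('X : P) = E3.
Hypothesis basis : forall f : P, exists u0 u1 u2 v0 v1 v2 : P,
  f = theta u0 + theta u1 * x + theta u2 * x ^+ 2 +
      (theta v0 + theta v1 * x + theta v2 * x ^+ 2) * y.
Hypothesis basis_uniq : forall u0 u1 u2 v0 v1 v2 : P,
  theta u0 + theta u1 * x + theta u2 * x ^+ 2 +
  (theta v0 + theta v1 * x + theta v2 * x ^+ 2) * y = 0 ->
  [/\ u0 = 0, u1 = 0 & u2 = 0] /\ [/\ v0 = 0, v1 = 0 & v2 = 0].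
Hypothesis gammaC : forall c : C, gamma (c%:P%:P : P) = c%:P%:P.
Hypothesis gammaX : gamma x = y.
Hypothesis gammaY : gamma y = E1 - x - y.

Let gammaE1 : gamma E1 = E1. Proof. exact: gammaC. Qed.

Lemma gamma_sym (c : P) : gamma (theta c) = theta c.
Proof.
apply: (@MP_hom_ext C P 2 (gamma \o theta) theta) => [a|[|[|//]] _].
- change (gamma (theta (a%:P%:P : P)) = theta (a%:P%:P : P)).
  by rewrite thetaC gammaC.
- change (gamma (theta ('X : P)) = theta ('X : P)).
  rewrite thetaX /E3 !(rmorphM, rmorphB, rmorphD) gammaX gammaY gammaE1; ring.
- change (gamma (theta ('X%:P : P)) = theta ('X%:P : P)).
  rewrite thetaY /E2 rmorphN !(rmorphM, rmorphB, rmorphD) gammaX gammaY gammaE1.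
  ring.
Qed.

Let three_lreg (c : P) : 3%:R * c = 0 -> c = 0.
Proof.
move=> E; apply/polyP => i; apply/polyP => k; rewrite !coef0; apply: three.
by rewrite mulr_natl -!coefMn -mulr_natl E !coef0.
Qed.

(** Multiplication by a variable only shifts coefficients, so it does not affect divisibility by
    3. *)
Let three_div (v c : P) : 'X%:P * v = 3%:R * c -> exists h : P, v = 3%:R * h.
Proof.
move=> E; exists (\poly_(i < size v) drop_poly 1 c`_i); apply/polyP => i.
rewrite mulr_natl coefMn coef_poly; case: ltnP => [_|vi]; last first.
  by rewrite nth_default ?mul0rn.
apply/polyP => k; rewrite coefMn coef_drop_poly.
have := congr1 (fun f : P => f`_i`_k.+1) E.
by rewrite coefCM coefXM /= mulr_natl !coefMn addn1.
Qed.

Let rhoE (c : P) : theta c * rho =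
  theta 0 + theta (- ('X%:P + A1 ^+ 2) * c) * x + theta (A1 * c) * x ^+ 2 +
  (theta ('X%:P * c) + theta (2%:R * A1 * c) * x + theta (- 3%:R * c) * x ^+ 2) * y.
Proof.
exact: (rmorph_rho c x y (thetaC e1) thetaY).
Qed.

Lemma gamma_rho : gamma rho = rho.
Proof.
have gE2 : gamma E2 = E2 by apply: oppr_inj; rewrite -rmorphN -thetaY gamma_sym.
apply: etrans (rmorph_cyclic gamma E2 E1 x y) _.
rewrite gE2 gammaE1 gammaX gammaY /rho /E2; ring.
Qed.

(** In the basis the equation [gamma f = f] is a linear system. It gives [3 u2 = - A1 v2] and
    ['X v2 = 3 (u1 + A1 u2)], so 3 divides [v2]; with [v2 = 3 h] all coordinates except [u0] are
    those of [- h rho], since 3 is regular. *)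
Lemma cyclic_span (f : P) : gamma f = f ->
  exists c0 c1, f = theta c0 + theta c1 * rho.
Proof.
move=> gf; have [u0 [u1 [u2 [v0 [v1 [v2 fE]]]]]] := basis f.
have [|[k0 kx kxx] [ky kxy _]] := @basis_uniq
    (A1 * v0 + 'X%:P * (u2 - v1)) (- u1 + A1 * (u2 - v1) - v0) (v1 - u2 - u2)
    (u1 + A1 * v1 - v0 - 'X%:P * v2 + A1 * (u2 - v1) - v0)
    (v1 - u2 - 2%:R * v1 - A1 * v2) 0.
  apply: (etrans (rmorph_difference _ _ _ _ _ _ (thetaC e1) thetaY)).
  transitivity (gamma f - f); last by rewrite gf subrr.
  rewrite fE; congr (_ - _); apply/esym; apply: etrans (rmorph_expansion _ _ _ _ _ _ _ _ _) _.
  by rewrite gammaX gammaY !gamma_sym.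
have v1E : v1 = 2%:R * u2.
  by apply/eqP; rewrite -subr_eq0 -[X in _ == X]kxx; apply/eqP; ring.
have h2 : 3%:R * u2 = - (A1 * v2).
  apply/eqP; rewrite -subr_eq0 -[X in _ == X]oppr0 -kxy v1E; apply/eqP; ring.
have v0E : v0 = - u1 - A1 * u2.
  apply/eqP; rewrite -subr_eq0 -[X in _ == X]oppr0 -kx v1E; apply/eqP; ring.
have hX : 'X%:P * v2 = 3%:R * (u1 + A1 * u2).
  by apply/eqP; rewrite -subr_eq0 -[X in _ == X]oppr0 -ky v1E v0E; apply/eqP; ring.
have [h v2E] := three_div hX.
have u2E : u2 = - A1 * h.
  by apply/eqP; rewrite -subr_eq0; apply/eqP/three_lreg; rewrite mulrBr h2 v2E; ring.
have u1E : u1 = ('X%:P + A1 ^+ 2) * h.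
  apply/eqP; rewrite -subr_eq0; apply/eqP/three_lreg.
  have -> : u1 = (u1 + A1 * u2) - A1 * u2 by ring.
  rewrite mulrBr mulrBr -hX v2E u2E; ring.
exists u0, (- h); rewrite rhoE fE rmorph0 add0r !addrA.
congr (theta _ + theta _ * _ + theta _ * _ + (theta _ + theta _ * _ + theta _ * _) * _).
- by rewrite u1E; ring.
- by rewrite u2E; ring.
- by rewrite v0E u1E u2E; ring.
- by rewrite v1E u2E; ring.
- by rewrite v2E; ring.
Qed.

Lemma cyclic_span_uniq (c0 c1 : P) : theta c0 + theta c1 * rho = 0 ->
  c0 = 0 /\ c1 = 0.
Proof.
rewrite rhoE rmorph0 add0r => E.
have [|[-> _ _] [_ _ /eqP]] := @basis_uniq c0 (- ('X%:P + A1 ^+ 2) * c1)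
    (A1 * c1) ('X%:P * c1) (2%:R * A1 * c1) (- 3%:R * c1).
  by rewrite -[RHS]E !addrA.
by rewrite mulNr oppr_eq0 => /eqP /three_lreg.
Qed.

End Invariants.

Lemma cyclic_invariants (gamma : {rmorphism P -> P}) :
  (forall c : C, gamma (c%:P%:P : P) = c%:P%:P) -> gamma x = y ->
  gamma y = E1 - x - y ->
  exists (theta : {rmorphism P -> P}) (rho : P),
    [/\ forall c : C, theta (c%:P%:P : P) = c%:P%:P,
        forall c, gamma (theta c) = theta c,
        gamma rho = rho,
        forall f, gamma f = f -> exists c0 c1, f = theta c0 + theta c1 * rho
      & forall c0 c1, theta c0 + theta c1 * rho = 0 -> c0 = 0 /\ c1 = 0].
Proof.
move=> gC gX gY; have [theta [tC tY tX b u]] := sym_hom_exists.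
exists theta, rho; split=> //.
- exact: (gamma_sym tC tY tX gC gX gY).
- exact: (gamma_rho tC tY tX gC gX gY).
- exact: (cyclic_span tC tY tX b u gC gX gY).
- exact: (cyclic_span_uniq tC tY u).
Qed.

End CyclicPermutation.

Lemma free_invariants_cyclic (O : idomainType) r (e1 : MP O r)
  (gamma : {rmorphism MP O r.+2 -> MP O r.+2}) :
  3%:R != 0 :> O ->
  (forall c : MP O r, gamma (c%:P%:P : {poly {poly MP O r}}) = c%:P%:P) ->
  gamma ('X%:P : {poly {poly MP O r}}) = ('X : {poly {poly MP O r}}) ->
  gamma ('X : {poly {poly MP O r}}) =
    (e1%:P%:P - 'X%:P - 'X : {poly {poly MP O r}}) ->
  exists theta s b, @free_invariants O r.+2 gamma theta s b.
Proof.
move=> n3 gC gX gY.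
have three (c : MP O r) : 3%:R * c = 0 -> c = 0.
  by move=> E; apply: (@mpC_lreg O 3%:R r c) => //; rewrite rmorph_nat.
have [theta [rho [tC gt gr span uniq]]] := cyclic_invariants three gC gX gY.
exists theta, 2%N, (fun i : 'I_2 => tnth [tuple 1; rho] i).
split=> [c|c|i|f gf|c E i].
- exact: tC.
- exact: gt.
- by case: i => [[|[|//]] i2]; [exact: rmorph1 | exact: gr].
- have [c0 [c1 ->]] := span f gf; exists (fun i : 'I_2 => tnth [tuple c0; c1] i).
  by rewrite (big_ord_recl 1) big_ord1 mulr1.
- have [|h0 h1] := uniq (c ord0) (c (lift ord0 ord0)).
    by rewrite -[RHS]E (big_ord_recl 1) big_ord1 mulr1.
  case: i => [[|[|//]] i2]; [rewrite -[RHS]h0 | rewrite -[RHS]h1].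
    by congr c; apply: val_inj.
  by congr c; apply: val_inj.
Qed.

Section Bases.
Variables (O : comNzRingType) (V : lmodType O).
Implicit Types u v w : V.

Lemma is_basis2P u v : is_basis (fun i : 'I_2 => tnth [tuple u; v] i) <->
  (forall w, exists a b, w = a *: u + b *: v) /\
  (forall a b, a *: u + b *: v = 0 -> a = 0 /\ b = 0).
Proof.
have S (c : 'I_2 -> O) : \sum_i c i *: tnth [tuple u; v] i =
    c ord0 *: u + c (lift ord0 ord0) *: v by rewrite (big_ord_recl 1) big_ord1.
split=> -[span ind]; split.
- by move=> w; have [c ->] := span w; rewrite S; do 2 eexists.
- move=> a b E; have := ind (fun i => tnth [tuple a; b] i).
  by rewrite S => /(_ E) h; split; [exact: (h ord0) | exact: (h (lift ord0 ord0))].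
- move=> w; have [a [b ->]] := span w; exists (fun i => tnth [tuple a; b] i).
  by rewrite S.
- move=> c; rewrite S => /ind [c0 c1] i.
  case: i => [[|[|//]] i2]; [rewrite -[RHS]c0 | rewrite -[RHS]c1].
    by congr c; apply: val_inj.
  by congr c; apply: val_inj.
Qed.

Lemma is_basis3P u v w : is_basis (fun i : 'I_3 => tnth [tuple u; v; w] i) <->
  (forall t, exists a b c, t = a *: u + b *: v + c *: w) /\
  (forall a b c, a *: u + b *: v + c *: w = 0 -> [/\ a = 0, b = 0 & c = 0]).
Proof.
have S (c : 'I_3 -> O) : \sum_i c i *: tnth [tuple u; v; w] i =
    c ord0 *: u + c (lift ord0 ord0) *: v + c (lift ord0 (lift ord0 ord0)) *: w.
  by rewrite !big_ord_recl big_ord0 addr0 addrA.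
split=> -[span ind]; split.
- by move=> t; have [c ->] := span t; rewrite S; do 3 eexists.
- move=> a b c E; have := ind (fun i => tnth [tuple a; b; c] i).
  rewrite S => /(_ E) h; split; [exact: (h ord0) | exact: (h (lift ord0 ord0)) |].
  exact: (h (lift ord0 (lift ord0 ord0))).
- move=> t; have [a [b [c ->]]] := span t; exists (fun i => tnth [tuple a; b; c] i).
  by rewrite S.
- move=> c; rewrite S => /ind [c0 c1 c2] i.
  case: i => [[|[|[|//]]] i2]; [rewrite -[RHS]c0 | rewrite -[RHS]c1 | rewrite -[RHS]c2].
  + by congr c; apply: val_inj.
  + by congr c; apply: val_inj.
  + by congr c; apply: val_inj.
Qed.

Lemma basis_cyclic2 (b : O) u v :
  is_basis (fun i : 'I_2 => tnth [tuple u; v - b *: u] i) ->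
  is_basis (fun i : 'I_2 => tnth [tuple v; u] i).
Proof.
move=> /is_basis2P [span ind]; apply/is_basis2P; split=> [w|c d E].
  have [c [d ->]] := span w; exists d, (c - d * b).
  by rewrite scalerBr scalerBl scalerA addrCA.
have [|d0 c0] := ind (d + c * b) c.
  by rewrite -[RHS]E scalerBr scalerDl scalerA addrC [_ + (c * b) *: u]addrC addrA subrK.
by move: d0; rewrite c0 mul0r addr0.
Qed.

(** Puts the fixed vector [u + v + w] in the innermost place, where it serves as the constant [e1]
    of [free_invariants_cyclic]. *)
Lemma basis_cyclic3 u v w :
  is_basis (fun i : 'I_3 => tnth [tuple u; v; w] i) ->
  is_basis (fun i : 'I_3 => tnth [tuple v; u; u + v + w] i).
Proof.
move=> /is_basis3P [span ind]; apply/is_basis3P; split=> [t|a b c E].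
  have [a [b [c ->]]] := span t; exists (b - c), (a - c), c.
  rewrite !scalerBl !scalerDr; move: (a *: u) (b *: v) (c *: u) (c *: v) (c *: w).
  move=> au bv cu cv cw; rewrite addrA; congr (_ + _).
  by rewrite [cu + cv]addrC addrACA !subrK addrC.
have [|a0 b0 c0] := ind (b + c) (a + c) c.
  rewrite -[RHS]E !scalerDl !scalerDr.
  by rewrite addrACA [b *: u + a *: v]addrC -!addrA.
by move: a0 b0; rewrite c0 !addr0.
Qed.

End Bases.

(** * The invariants in each case of the classification *)

Section InvariantsOfModule.
Variables (O : idomainType) (p : O).
Hypothesis unif : uniformizer p.
Hypothesis three : 3%:R != 0 :> O.
Variables (V : lmodType O) (S : comAlgType O) (iota : {linear V -> S}).
Hypothesis symS : is_symmetric_algebra iota.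
Variables (gT : finGroupType) (g : gT).
Hypothesis gen_g : generator [set: gT] g.
Variables (sigma : gT -> {lrmorphism S -> S}) (a : gT -> V -> V) (X : {linear V -> V}).
Hypothesis a1 : forall v, a 1%g v = v.
Hypothesis aM : forall h k v, a (h * k)%g v = a h (a k v).
Hypothesis sigmaE : forall h v, sigma h (iota v) = iota (a h v).
Hypothesis aX : forall v, a g v = X v.

Let cm := invariant_ring_cm unif symS gen_g a1 aM sigmaE.

Lemma cube_root_neq1 (b : O) : b ^+ 2 + b + 1 = 0 -> b <> 1.
Proof. by move=> E b1; move: three; rewrite -E b1 expr1n !mulrS mulr0n !addr0 addrA eqxx. Qed.

Let PsiZ r (Psi : {rmorphism S -> MP O r}) (PC : forall c, Psi c%:A = mpC O r c) c v :
  Psi (iota (c *: v)) = mpC O r c * Psi (iota v).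
Proof.
have -> : iota (c *: v) = c%:A * iota v by rewrite mulr_algl linearZ.
by rewrite rmorphM PC.
Qed.

Let PsiD r (Psi : {rmorphism S -> MP O r}) u v :
  Psi (iota (u + v)) = Psi (iota u) + Psi (iota v).
Proof. by rewrite linearD rmorphD. Qed.

Lemma cm_trivial (u : V) : (forall v, X v = v) -> @is_basis O V 1 (fun=> u) ->
  cohen_macaulay (invariant_ring sigma).
Proof.
move=> X1 uB; apply: (cm uB) => Psi gamma PC Pe gC gP.
apply: free_invariants_trivial => //.
by rewrite -(Pe ord0) gP aX X1.
Qed.

Lemma cm_scalar b (u : V) : b ^+ 2 + b + 1 = 0 -> (forall v, X v = b *: v) ->
  @is_basis O V 1 (fun=> u) -> cohen_macaulay (invariant_ring sigma).
Proof.
move=> b3 Xb uB; apply: (cm uB) => Psi gamma PC Pe gC gP.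
apply: (free_invariants_reflection (r := 0) (y := 0) b3 (cube_root_neq1 b3)) => //.
rewrite -[X in gamma X](Pe ord0) gP aX Xb PsiZ // (Pe ord0).
by rewrite polyC0 addr0.
Qed.

Lemma cm_reflection b (u : V) : b ^+ 2 + b + 1 = 0 ->
  (forall v, X (X v - b *: v) - 1 *: (X v - b *: v) = 0) ->
  @is_basis O V 2 (fun i => tnth [tuple u; X u - b *: u] i) ->
  cohen_macaulay (invariant_ring sigma).
Proof.
move=> b3 Xb uB; apply: (cm uB) => Psi gamma PC Pe gC gP.
have Pu : Psi (iota u) = ('X : {poly MP O 1}) := Pe ord0.
have Py : Psi (iota (X u - b *: u)) = ((mvar O 1 0)%:P : {poly MP O 1}).
  exact: (Pe (lift ord0 ord0)).
apply: (free_invariants_reflection (r := 1) (y := mvar O 1 0) b3 (cube_root_neq1 b3)).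
  apply: (@MP_hom_ext O _ 1 (gamma \o @polyC (MP O 1)) (@polyC (MP O 1))) => [c|[|//] _].
    exact: gC.
  rewrite [LHS](_ : _ = gamma ((mvar O 1 0)%:P : {poly MP O 1})) // -{1}Py gP aX.
  apply: etrans Py; congr (Psi (iota _)); apply/eqP.
  by rewrite -subr_eq0 -[X in _ - X]scale1r Xb.
rewrite -Pu gP aX -{1}(subrK (b *: u) (X u)) PsiD PsiZ // Pu Py addrC.
by [].
Qed.

(** A cyclic permutation of [u], [X u], [X (X u)], which have sum zero: the case [e1 = 0]. *)
Lemma cm_cyclic2 b (u : V) : (forall v, X (X v) + X v + v = 0) ->
  @is_basis O V 2 (fun i => tnth [tuple u; X u - b *: u] i) ->
  cohen_macaulay (invariant_ring sigma).
Proof.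
move=> X2 /basis_cyclic2 uB; apply: (cm uB) => Psi gamma PC Pe gC gP.
have Py : Psi (iota (X u)) = ('X : {poly {poly MP O 0}}) := Pe ord0.
have Pu : Psi (iota u) = ('X%:P : {poly {poly MP O 0}}) := Pe (lift ord0 ord0).
apply: (@free_invariants_cyclic O 0 0) => //.
  by rewrite -Pu gP aX Py.
rewrite -{1}Py gP aX -Py -Pu.
have -> : X (X u) = - (X u + u) by apply/eqP; rewrite -addr_eq0 addrA X2.
by rewrite !linearN rmorphN PsiD Py Pu !polyC0 sub0r opprD addrC.
Qed.

Lemma cm_cyclic3 (u : V) : (forall v, X (X (X v)) = v) ->
  @is_basis O V 3 (fun i => tnth [tuple u; X u; X (X u)] i) ->
  cohen_macaulay (invariant_ring sigma).
Proof.
move=> X3 /basis_cyclic3 uB; apply: (cm uB) => Psi gamma PC Pe gC gP.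
have Py : Psi (iota (X u)) = ('X : {poly {poly MP O 1}}) := Pe ord0.
have Pu : Psi (iota u) = ('X%:P : {poly {poly MP O 1}}) := Pe (lift ord0 ord0).
have Ps : Psi (iota (u + X u + X (X u))) = ((mvar O 1 0)%:P%:P : {poly {poly MP O 1}}).
  exact: (Pe (lift ord0 (lift ord0 ord0))).
apply: (@free_invariants_cyclic O 1 (mvar O 1 0)) => //.
- pose pC : {rmorphism MP O 1 -> MP O 3} := (@polyC {poly MP O 1}) \o (@polyC (MP O 1)).
  apply: (@MP_hom_ext O _ 1 (gamma \o pC) pC) => [c|[|//] _].
    exact: gC.
  rewrite [LHS](_ : _ = gamma ((mvar O 1 0)%:P%:P : {poly {poly MP O 1}})) //.
  rewrite -{1}Ps gP aX; apply: etrans Ps; congr (Psi (iota _)).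
  by rewrite !linearD X3 addrAC -addrA addrCA addrA.
- by rewrite -Pu gP aX Py.
- rewrite -{1}Py gP aX -Py -Pu -Ps !PsiD.
  by apply/esym; rewrite -addrA -opprD addrC addKr.
Qed.

End InvariantsOfModule.

Lemma rigid_invariants_cm (O : idomainType) (p : O) (unif : uniformizer p)
    (three : 3%:R != 0 :> O) (p3 : divides p 3%:R)
    (zeta : O) (zetaE : zeta ^+ 2 + zeta + 1 = 0)
    (gT : finGroupType) (abG : abelian [set: gT]) (g : gT)
    (gen_g : generator [set: gT] g) (card3 : #|[set: gT]| = 3%N)
    (M : lmodType (group_algebra O abG)) (S : comAlgType O)
    (iota : {linear restrict M -> S}) (sigma : gT -> {lrmorphism S -> S}) :
  indecomposable M -> rigid M -> maximal_cohen_macaulay M ->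
  is_symmetric_algebra iota ->
  (forall (h : gT) (v : M), sigma h (iota v) = iota (gr_basis O abG h *: v)) ->
  cohen_macaulay (invariant_ring sigma).
Proof.
move=> indM rigM mcmM symS sigmaE.
pose X : {linear restrict M -> restrict M} := @act O _ (gr_basis O abG g) M.
have X3 v : X (X (X v)) = v := actg3 gen_g card3 v.
have tf : torsion_free (restrict M).
  by move=> c v; exact: (restrict_torsion_free unif gen_g card3 p3 mcmM).
have fg : finitely_generated (restrict M).
  by apply: (restrict_finitely_generated gen_g card3); case: mcmM.
have [n [e eB]] := torsion_free_basis unif tf fg.
have dec (t : group_algebra O abG) : exists a b c : O,
    t = a%:A + b *: gr_basis O abG g + c *: gr_basis O abG g ^+ 2.
  by have [a [b [c [E _]]]] := group_algebra_cyclic3 gen_g card3 t; exists a, b, c.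
have dec_inj := @group_algebra_cyclic3_inj O gT abG g gen_g card3.
have rig := restrict_rigid (x3 O abG gen_g card3) dec dec_inj eB rigM.
have ind (eps : {linear restrict M -> restrict M}) :=
  @restrict_indecomposable O gT abG g gen_g card3 M indM eps.
have zeta1 := cube_root_neq1 three zetaE.
pose a (h : gT) (v : restrict M) : restrict M := act (gr_basis O abG h) v.
have a1 v : a 1%g v = v by exact: (scale1r (v : M)).
have aM h k v : a (h * k)%g v = a h (a k v).
  by rewrite /a /act scalerA gbM.
have aX v : a g v = X v by [].
have [[X1 [u uB]]|[b [b3 Xb [u uB]]]|[b [b3 Xb [u uB]]]|[[b [X2 [u uB]]]|[u uB]]] :=
  classification unif X3 tf fg rig ind zetaE zeta1 three p3 indM.1.
- exact: (cm_trivial unif symS gen_g a1 aM sigmaE aX X1 uB).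
- exact: (cm_scalar unif three symS gen_g a1 aM sigmaE aX b3 Xb uB).
- exact: (cm_reflection unif three symS gen_g a1 aM sigmaE aX b3 Xb uB).
- exact: (cm_cyclic2 unif three symS gen_g a1 aM sigmaE aX X2 uB).
- exact: (cm_cyclic3 unif three symS gen_g a1 aM sigmaE aX X3 uB).
Qed.

(* Destructing the structure makes its ring operations convertible to those   *)
(* of the packed integral domain.                                             *)
Lemma idomain_of_comNzRing (R : comNzRingType) :
  (forall x y : R, x * y = 0 -> x = 0 \/ y = 0) ->
  exists D : idomainType, (D : comNzRingType) = R.
Proof.
case: R => T [m1 m2 m3 m4 m5 m6 m7 m8 m9 m10 m11 m12].
pose R : comNzRingType := GRing.ComNzRing.Pack (@GRing.ComNzRing.Class T m1 m2 m3 m4 m5 m6 m7 m8 m9 m10 m11 m12).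
move=> dom; have {}dom : forall x y : R, x * y = 0 -> x = 0 \/ y = 0 by exact: dom.
pose U : pred R := fun x => `[< exists y, y * x = 1 >].
pose I (x : R) : R := if pselect (exists y, y * x = 1) is left e then projT1 (cid e) else x.
have IV : {in U, left_inverse 1 I *%R}.
  move=> x /asboolP e; rewrite /I; case: pselect => // e'; exact: (projT2 (cid e')).
have IU : forall x y : R, y * x = 1 -> U x.
  by move=> x y E; apply/asboolP; exists y.
have IO : {in [predC U], I =1 id}.
  move=> x /asboolP e; rewrite /I; case: pselect => // e'; by case: e.
have dm : GRing.integral_domain_axiom R.
  by move=> x y /dom [->|->]; rewrite eqxx ?orbT.
pose CU : comUnitRingType := HB.pack R
  (GRing.ComNzRing_hasMulInverse.Build R IV IU IO).
pose D : idomainType := HB.pack R CU (GRing.ComUnitRing_isIntegral.Build CU dm).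
by exists D.
Qed.

(** * Completions *)

Section Completion.
Variables (B C : comNzRingType) (q : B) (c : {rmorphism B -> C}).
Hypothesis compl : is_completion q c.
Hypothesis unitB : forall b, ~ divides q b -> exists b', b * b' = 1.

(** The inverse is the limit of the partial sums of the geometric series. *)
Lemma completion_geometric (w : C) : exists l, (1 - c q * w) * l = 1.
Proof.
have [_ _ sep lim] := compl; pose u n := \sum_(i < n) (c q * w) ^+ i.
have [|l lP] := lim u.
  by move=> n; exists (w ^+ n); rewrite /u big_ord_recr /= [LHS]addrC addKr exprMn.
exists l; apply/eqP; rewrite -subr_eq0; apply/eqP/sep => n.
have [z zE] := lP n; exists (- (1 - c q * w) * z - w ^+ n).
have lE : l = u n - c q ^+ n * z by rewrite -zE opprB addrCA subrr addr0.
have uE : (c q * w) ^+ n - 1 = (c q * w - 1) * u n by rewrite subrX1.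
have -> : (1 - c q * w) * l - 1 =
    - ((c q * w - 1) * u n + 1) - c q ^+ n * (1 - c q * w) * z by rewrite lE; ring.
by rewrite -uE subrK exprMn; ring.
Qed.

Lemma completion_unit (y : C) : ~ divides (c q) y -> exists y', y * y' = 1.
Proof.
have [inj dense _ _] := compl => ny; have [b [z]] := dense 1%N y.
rewrite expr1 => E; have [|b' bb'] := unitB (b := b).
  by move=> [b' bE]; apply: ny; exists (c b' + z); rewrite mulrDr -rmorphM -bE -E addrC subrK.
have [l lP] := completion_geometric (- z * c b').
exists (c b' * l); rewrite -lP.
have -> : y = c b + c q * z by rewrite -E addrC subrK.
have cb : c b * c b' = 1 by rewrite -rmorphM bb' rmorph1.
rewrite mulrA mulrDl cb; ring.
Qed.

Hypothesis nilC : forall k, c q ^+ k <> 0.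

Lemma completion_uniformizer_nonunit y : c q * y <> 1.
Proof.
have [_ _ sep _] := compl => E; case: (nilC (k := 0%N)); rewrite expr0; apply: sep => n.
by exists (y ^+ n); rewrite -exprMn E expr1n.
Qed.

(** Separatedness bounds the powers of [c q] that divide [x]; after division by the largest one, the
    cofactor is a unit by [completion_unit]. *)
Lemma completion_factor (x : C) : x <> 0 ->
  exists u v k, u * v = 1 /\ x = u * c q ^+ k.
Proof.
have [_ _ sep _] := compl => x0.
have [n ndiv] : exists n, ~ divides (c q ^+ n) x.
  by apply/existsNP => h; apply: x0; exact: sep.
have ex : exists n, `[< ~ divides (c q ^+ n) x >] by exists n; apply/asboolP.
case: (ex_minnP ex) => -[|k] /asboolP kdiv kmin.
  by case: kdiv; exists x; rewrite expr0 mul1r.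
have [y yE] : divides (c q ^+ k) x.
  by apply: contrapT => h; have := kmin k (asboolT h); rewrite ltnn.
have [|v yv] := @completion_unit y.
  by move=> [z zE]; apply: kdiv; exists z; rewrite yE zE exprS; ring.
by exists y, v, k; split=> //; rewrite yE mulrC.
Qed.

Lemma completion_domain (x y : C) : x * y = 0 -> x = 0 \/ y = 0.
Proof.
move=> E; have [->|/eqP/completion_factor [u [v [k [uv xE]]]]] := eqVneq x 0; first by left.
have [->|/eqP/completion_factor [u' [v' [k' [uv' yE]]]]] := eqVneq y 0; first by right.
case: (nilC (k := (k + k')%N)); rewrite exprD.
have -> : c q ^+ k * c q ^+ k' = (u * v) * (u' * v') * (c q ^+ k * c q ^+ k').
  by rewrite uv uv' !mul1r.
have -> : u * v * (u' * v') * (c q ^+ k * c q ^+ k') = v * v' * (x * y).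
  by rewrite xE yE; ring.
by rewrite E mulr0.
Qed.

End Completion.

(** * The group ring as a quotient of a polynomial ring *)

Section CyclicAlgebra.
Variables (R : comNzRingType) (A : comAlgType R) (x : A).
Hypothesis x3 : x ^+ 3 = 1.
Hypothesis dec : forall t : A, exists a b c, t = a%:A + b *: x + c *: x ^+ 2.
Hypothesis dec_inj : forall a b c a' b' c',
  a%:A + b *: x + c *: x ^+ 2 = a'%:A + b' *: x + c' *: x ^+ 2 ->
  [/\ a = a', b = b' & c = c'].
Local Notation h := ('X^3 - 1 : {poly R}).
Local Notation Q := {poly %/ h}.

Let h_monic : h \is monic /\ size h = 4%N.
Proof.
have [] := @size_monic_lead R (- 1) 3; last by split.
by rewrite size_polyN size_poly1.
Qed.

Let mkE : mk_monic h = h.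
Proof. by rewrite /mk_monic; have [-> ->] := h_monic. Qed.

Let size_mk : size (mk_monic h) = 4%N.
Proof. by rewrite mkE; have [] := h_monic. Qed.

Variable F : {rmorphism {poly R} -> A}.
Hypothesis FC : forall c, F c%:P = c%:A.
Hypothesis FX : F 'X = x.

Definition qpoly_eval (q : Q) : A := F (val q).

Let FZ c f : F (c *: f) = c *: F f.
Proof. by rewrite -mul_polyC rmorphM FC mulr_algl. Qed.

Let Fh : F h = 0.
Proof. by rewrite rmorphB rmorph1 rmorphXn FX x3 subrr. Qed.

Let F_mod (f : {poly R}) :
  F (Pdiv.CommonRing.rmodp f (mk_monic h)) = F f.
Proof.
rewrite [in RHS](Pdiv.RingMonic.rdivp_eq (monic_mk_monic h) f).
by rewrite rmorphD rmorphM mkE Fh mulr0 add0r.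
Qed.

Lemma qpoly_eval_linear : linear qpoly_eval.
Proof. by move=> a u v; rewrite /qpoly_eval linearP rmorphD FZ. Qed.

Lemma qpoly_eval_monoid : monoid_morphism qpoly_eval.
Proof.
split=> [|u v]; rewrite /qpoly_eval.
  exact: rmorph1.
by rewrite -rmorphM; exact: F_mod.
Qed.

Let qpoly_coefE (q : Q) : qpoly_eval q = ((val q)`_0)%:A + (val q)`_1 *: x + (val q)`_2 *: x ^+ 2.
Proof.
have sq : (size (val q) <= 3)%N.
  by rewrite -ltnS (leq_trans (size_mk_monic q)) // size_mk.
have E : val q = ((val q)`_0)%:P + (val q)`_1 *: 'X + (val q)`_2 *: 'X^2.
  apply/polyP => i; rewrite !coefD !coefZ coefC coefX coefXn.
  case: i => [|[|[|i]]] /=; rewrite ?mulr0 ?mulr1 ?addr0 ?add0r //.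
  by rewrite nth_default // (leq_trans sq).
by rewrite /qpoly_eval {1}E !rmorphD FC !FZ rmorphXn FX.
Qed.

Lemma qpoly_cyclic_iso : exists phi : {lrmorphism Q -> A},
  bijective phi /\ phi 'qX = x.
Proof.
pose phi : {lrmorphism Q -> A} := HB.pack qpoly_eval
  (GRing.isLinear.Build R Q A _ qpoly_eval qpoly_eval_linear)
  (GRing.isMonoidMorphism.Build Q A qpoly_eval qpoly_eval_monoid).
have phi_in (f : {poly R}) : phi (in_qpoly h f) = F f by exact: F_mod.
exists phi; split; last by rewrite phi_in.
have inj : injective phi.
  move=> u v; rewrite /= !qpoly_coefE => /dec_inj [e0 e1 e2].
  apply/npolyP => -[|[|[|i]]] //.
  have s3 (q : Q) : (size (val q) <= i.+3)%N.
    apply: (@leq_trans 3) => //.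
    by rewrite -ltnS (leq_trans (size_mk_monic q)) // size_mk.
  by rewrite !nth_default // s3.
have /choice [f fP] t : exists q, phi q = t.
  have [a [b [c ->]]] := dec t.
  exists (in_qpoly h (a%:P + b *: 'X + c *: 'X^2)).
  by rewrite phi_in !rmorphD FC !FZ rmorphXn FX.
by exists f => [q|t]; [apply: inj; rewrite fP | exact: fP].
Qed.

End CyclicAlgebra.

Lemma rigid_invariants_cm_of_valuation (R : comNzRingType) (q w zeta : R)
    (dom : forall x y : R, x * y = 0 -> x = 0 \/ y = 0)
    (qN : forall y, q * y <> 1) (q0 : q <> 0)
    (factor : forall x : R, x <> 0 -> exists u v k, u * v = 1 /\ x = u * q ^+ k)
    (q3 : 3%:R = q * w) (three : 3%:R <> 0 :> R)
    (zetaE : zeta ^+ 2 + zeta + 1 = 0)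
    (gT : finGroupType) (abG : abelian [set: gT]) (g : gT)
    (gen_g : generator [set: gT] g) (card3 : #|[set: gT]| = 3%N)
    (M : lmodType (group_algebra R abG)) (S : comAlgType R)
    (iota : {linear restrict M -> S}) (sigma : gT -> {lrmorphism S -> S}) :
  indecomposable M -> rigid M -> maximal_cohen_macaulay M ->
  is_symmetric_algebra iota ->
  (forall (h : gT) (v : M), sigma h (iota v) = iota (gr_basis R abG h *: v)) ->
  cohen_macaulay (invariant_ring sigma).
Proof.
have [D DR] := idomain_of_comNzRing dom; case: _ / DR in q w zeta dom qN q0 factor q3 three
  zetaE M S iota sigma *.
have unif : uniformizer q.
  split; first exact/eqP.
    by apply/negP => /unitrP [y [_ E]]; apply: (qN y).
  move=> x /eqP/factor [u [v [k [uv xE]]]]; exists u, k; split=> //.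
  by apply/unitrP; exists v; split; first rewrite mulrC.
move/eqP in three; apply: (rigid_invariants_cm unif three _ zetaE gen_g card3).
by exists w.
Qed.

Lemma localization_unit (R : comNzRingType) (P : idealr R) (B : comNzRingType)
    (f : {rmorphism R -> B}) (b : B) :
  is_localization P f -> ~ ideal_extension f P b -> exists b', b * b' = 1.
Proof.
move=> [inv frac _] nb; have [a [s [sP E]]] := frac b; have [t st] := inv s sP.
have [aP|aP] := boolP (a \in P).
  case: nb; exists 1%N, (fun=> a), (fun=> t); split=> //.
  by rewrite big_ord1 -E mulrAC st mul1r.
have [t' at'] := inv a aP; exists (f s * t').
by rewrite mulrA [b * _]mulrC E.
Qed.

Lemma pchar_ideal_quot (R : comNzRingType) (m : idealr R) p :
  p \in [pchar {ideal_quot m}] -> p%:R \in m.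
Proof.
case/andP => _ /eqP E; rewrite -[p%:R]subr0 Quotient.idealrBE; apply/eqP.
by rewrite rmorph_nat rmorph0.
Qed.

Lemma primitive_root3 (R : comNzRingType) (z : R) :
  (forall x y : R, x * y = 0 -> x = 0 \/ y = 0) ->
  3.-primitive_root z -> z ^+ 2 + z + 1 = 0.
Proof.
move=> dom zP; have [|/eqP|//] := dom (z - 1) (z ^+ 2 + z + 1).
- by transitivity (z ^+ 3 - 1); [ring | rewrite (prim_expr_order zP) subrr].
- by rewrite subr_eq0 -[z]expr1 -(prim_order_dvd zP).
Qed.

Theorem proposition1p11
  (A : idomainType) (A_int : is_global_integers A)
  (gT : finGroupType) (n : nat) (rG : mx_representation A [set: gT] n)
  (rG_faithful : mx_faithful rG)
  (P : idealr A) (P_max : maximal_ideal P)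
  (O : comNzRingType) (loc : {rmorphism A -> O}) (loc_P : is_localization P loc)
  (pi : O) (pi_gen : forall x : O, divides pi x <-> ideal_extension loc P x)
  (Ohat : comNzRingType) (cpl : {rmorphism O -> Ohat})
  (cpl_pi : is_completion pi cpl)
  (G_Z3 : [set: gT] \isog [set: 'Z_3])
  (mhat : idealr Ohat) (mhat_local : local_with mhat)
  (mixed : mixed_characteristic mhat)
  (zeta : Ohat) (zeta_prim : 3.-primitive_root zeta)
  (res_char3 : 3%N \in [pchar {ideal_quot mhat}]) :
  let OG := group_algebra Ohat (abelian_of_isog_Z3 G_Z3) in
  (forall g : gT, generator [set: gT] g ->
     exists phi : {lrmorphism {poly %/ ('X^3 - 1 : {poly Ohat})} -> OG},
       bijective phi /\ phi 'qX = gr_basis Ohat (abelian_of_isog_Z3 G_Z3) g) /\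
  (forall (M : lmodType OG) (S : comAlgType Ohat)
          (iota : {linear restrict M -> S})
          (sigma : gT -> {lrmorphism S -> S}),
     indecomposable M -> rigid M -> maximal_cohen_macaulay M ->
     is_symmetric_algebra iota ->
     (forall (g : gT) (v : M),
        sigma g (iota v) =
        iota (gr_basis Ohat (abelian_of_isog_Z3 G_Z3) g *: v)) ->
     cohen_macaulay (invariant_ring sigma)).
Proof.
have card3 : #|[set: gT]| = 3%N by rewrite (card_isog G_Z3) cardsT card_ord.
split=> [g gen_g|M S iota sigma].
  have dec (t : group_algebra Ohat (abelian_of_isog_Z3 G_Z3)) : exists a b c : Ohat,
      t = a%:A + b *: gr_basis Ohat _ g + c *: gr_basis Ohat _ g ^+ 2.
    by have [a [b [c [E _]]]] := group_algebra_cyclic3 gen_g card3 t; exists a, b, c.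
  apply: (qpoly_cyclic_iso (x3 Ohat _ gen_g card3) dec
    (group_algebra_cyclic3_inj gen_g card3) (F := horner_alg _)).
    exact: horner_algC.
  exact: horner_algX.
have unitO (x : O) : ~ divides pi x -> exists x', x * x' = 1.
  by move=> nx; apply: (localization_unit loc_P) => /pi_gen.
(* Otherwise 3 would be a unit, although it lies in [mhat]. *)
have [w q3] : divides (cpl pi) 3%:R.
  apply: contrapT => /(completion_unit cpl_pi unitO) [y y3].
  by have := idealr1 mhat; rewrite -y3 mulrC idealMr // pchar_ideal_quot.
(* Characteristic zero keeps the powers of 3 nonzero, and with them the powers of its divisor
   [cpl pi]. *)
have nil3 k : 3%:R ^+ k <> 0 :> Ohat.
  by rewrite -natrX => /(mixed.1 _ 0%N) /eqP; rewrite expn_eq0.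
have nilq k : cpl pi ^+ k <> 0.
  by move=> qk; apply: (nil3 k); rewrite q3 exprMn qk mul0r.
have dom := completion_domain cpl_pi unitO nilq.
have /cyclicP [g gE] : cyclic [set: gT].
  by rewrite (isog_cyclic G_Z3); apply/cyclicP; exists Zp1; exact: Zp_cycle.
apply: (rigid_invariants_cm_of_valuation dom _ _ _ q3 _ (primitive_root3 dom zeta_prim) _ card3).
- exact: (completion_uniformizer_nonunit cpl_pi nilq).
- exact: (nilq 1%N).
- exact: (completion_factor cpl_pi unitO).
- exact: (nil3 1%N).
- by rewrite /generator gE.
Qed.
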